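(* The rail arc classes $2_3$ and $2_6$ both have stick number $6$.
   Context: Everything is in the piecewise linear category. Let $\ell_1,\ell_2\subset\mathbb{R}^3$ be two parallel lines, called rails. A rail arc is an embedding of a simple arc $r$ in $\mathbb{R}^3$ with one endpoint on $\ell_1$, the other on $\ell_2$, and interior disjoint from $\ell_1\cup\ell_2$. Two rail arcs are rail isotopic if there is an ambient isotopy of $\mathbb{R}^3$ taking one to the other while mapping each rail onto itself throughout. A rail arc class is a rail isotopy class of rail arcs. A stick rail arc is a rail arc that is a finite union of line segments (sticks), and the stick number $s[r]$ of a class is the minimum number of sticks of a stick rail arc representing it. Planar knotoids. A planar knotoid diagram is a generic immersion of $[0,1]$ in $\mathbb{R}^2$ with over/under information at each double point and with distinct endpoints, called the tail and the head. Planar knotoids are equivalence classes of such diagrams under planar isotopy and Reidemeister moves performed in disks disjoint from the endpoints. Generic projection to a plane perpendicular to the rails gives a one-to-one correspondence between rail arc classes and planar knotoids (a planar knotoid diagram lifts to a rail arc whose rails are the perpendicular lines through its endpoints). Named classes are considered up to reversal of orientation and the involutions: mirror reflection (change every crossing), symmetry (reflect the diagram in a line of the plane), and their composition. The stick number is unchanged by these operations. Let $c$ be the plane curve that starts at the tail $(1,0)$, follows the spiral given in polar coordinates by $\rho(\theta)=1+\theta/\pi$ for $0\le\theta\le5\pi$, and then follows the straight segment along the negative $x$-axis from $(-6,0)$ to the head $(-1,0)$. It has exactly two double points, and head and tail lie in the same region of the complement. The class $2_3$ is represented by $c$ with the spiral passing over the final segment at both crossings. The class $2_6$ is represented by $c$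 with the spiral passing over the final segment at one crossing and under it at the other. Each is determined up to orientation reversal and the involutions. *)

(* Defs.v *)
From mathcomp Require Import all_boot all_order all_algebra.
From mathcomp Require Import all_classical all_reals all_analysis.
Set Implicit Arguments.
Unset Strict Implicit.
Unset Printing Implicit Defensive.
Import Order.TTheory GRing.Theory Num.Theory.
Import numFieldNormedType.Exports.
Local Open Scope classical_set_scope.
Local Open Scope ring_scope.

(** * Piecewise linear maps *)

Definition polyhedron (R : realType) (m : nat) (P : set 'rV[R]_m) : Prop :=
  exists (k : nat) (A : 'M[R]_(m, k)) (b : 'rV[R]_k),
    P = [set x | forall j, (x *m A) 0 j <= b 0 j].

(* Every point of D has a neighbourhood in D covered by finitely many closed
   polyhedra on each of which f is affine.  Continuity of f on D follows. *)
Definition PL_on (R : realType) (m n : nat) (D : set 'rV[R]_m)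
    (f : 'rV[R]_m -> 'rV[R]_n) : Prop :=
  forall x, D x ->
    exists (k : nat) (P : 'I_k -> set 'rV[R]_m),
      [/\ forall i, polyhedron (P i),
          \forall y \near x, D y -> exists i, P i y
        & forall i, exists (A : 'M[R]_(m, n)) (b : 'rV[R]_n),
            forall y, D y -> P i y -> f y = y *m A + b].

Definition PL_curve (R : realType) (n : nat) (g : R -> 'rV[R]_n) : Prop :=
  PL_on [set s : 'rV[R]_1 | 0 <= s 0 0 <= 1] (fun s => g (s 0 0)).

(** * Ambient isotopies *)

(* A level-preserving self-homeomorphism of R^n x [0,1], starting at the
   identity; [reg] is the regularity required of the map and of its inverse. *)
Definition ambient_isotopy (R : realType) (n : nat)
    (reg : (R -> 'rV[R]_n -> 'rV[R]_n) -> Prop)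
    (H : R -> 'rV[R]_n -> 'rV[R]_n) : Prop :=
  (forall x, H 0 x = x) /\
  exists G : R -> 'rV[R]_n -> 'rV[R]_n,
    [/\ reg H, reg G &
        forall t : R, 0 <= t <= 1 -> cancel (H t) (G t) /\ cancel (G t) (H t)].

Definition PL_track (R : realType) (n : nat)
    (H : R -> 'rV[R]_n -> 'rV[R]_n) : Prop :=
  PL_on [set y : 'rV[R]_(n + 1) | 0 <= rsubmx y 0 0 <= 1]
        (fun y => H (rsubmx y 0 0) (lsubmx y)).

Definition continuous_track (R : realType) (n : nat)
    (H : R -> 'rV[R]_n -> 'rV[R]_n) : Prop :=
  {within [set z : R * 'rV[R]_n | 0 <= z.1 <= 1],
     continuous (fun z : R * 'rV[R]_n => H z.1 z.2)}.

(** * Rail arcs *)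

(* Coordinates of R^3 = R^2 x R are chosen so that the rails are vertical: the
   rail through [p : R^2] is [rail p], and [plane_proj] is the projection to a
   plane perpendicular to the rails. *)
Definition plane_proj (R : realType) (x : 'rV[R]_(2 + 1)) : 'rV[R]_2 :=
  lsubmx x.

Definition height (R : realType) (x : 'rV[R]_(2 + 1)) : R := rsubmx x 0 0.

Definition rail (R : realType) (p : 'rV[R]_2) : set 'rV[R]_(2 + 1) :=
  [set x | plane_proj x = p].

Definition rail_arc (R : realType) (p1 p2 : 'rV[R]_2)
    (r : set 'rV[R]_(2 + 1)) : Prop :=
  exists g : R -> 'rV[R]_(2 + 1),
    [/\ PL_curve g, {in `[0, 1] &, injective g}, r = g @` `[0, 1],
        rail p1 (g 0) /\ rail p2 (g 1)
      & forall s : R, 0 < s < 1 -> ~ rail p1 (g s) /\ ~ rail p2 (g s)].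

Definition rail_isotopic (R : realType) (p1 p2 : 'rV[R]_2)
    (r r' : set 'rV[R]_(2 + 1)) : Prop :=
  exists H : R -> 'rV[R]_(2 + 1) -> 'rV[R]_(2 + 1),
    [/\ ambient_isotopy (@PL_track R (2 + 1)) H,
        forall t : R, 0 <= t <= 1 ->
          H t @` rail p1 = rail p1 /\ H t @` rail p2 = rail p2
      & H 1 @` r = r'].

Definition stick (R : realType) (a b : 'rV[R]_(2 + 1)) :
    set 'rV[R]_(2 + 1) :=
  [set (1 - t) *: a + t *: b | t in `[0, 1]].

Definition union_of_sticks (R : realType) (n : nat)
    (r : set 'rV[R]_(2 + 1)) : Prop :=
  exists a b : 'I_n -> 'rV[R]_(2 + 1),
    (forall i, a i != b i) /\ r = \bigcup_i stick (a i) (b i).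

(* [n] is the minimum number of sticks of an element of [K]. *)
Definition stick_number (R : realType)
    (K : set (set 'rV[R]_(2 + 1))) (n : nat) : Prop :=
  (exists2 r, K r & union_of_sticks n r) /\
  (forall r m, K r -> union_of_sticks m r -> (n <= m)%N).

(** * Planar knotoid diagrams *)

(* The curve is parametrized by [0,1], from tail to head.  If [s != s'] are the
   two parameters of a double point, [passes_over s s'] says that the strand at [s]
   passes over the strand at [s']; other values of [passes_over] are irrelevant. *)
Record diagram (R : realType) := Diagram {
  curve : R -> 'rV[R]_2;
  passes_over : R -> R -> Prop
}.

Definition plane_point (R : realType) (x y : R) : 'rV[R]_2 :=
  \row_(i < 2) [:: x; y]`_i.

Definition reversal (R : realType) (D : diagram R) : diagram R :=
  Diagram (fun s => curve D (1 - s)) (fun s s' => passes_over D (1 - s) (1 - s')).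

Definition mirror (R : realType) (D : diagram R) : diagram R :=
  Diagram (curve D) (fun s s' => passes_over D s' s).

(* Reflections in different lines differ by a rigid motion of the plane, hence
   give planar isotopic diagrams: the x-axis suffices. *)
Definition symmetry (R : realType) (D : diagram R) : diagram R :=
  Diagram (fun s => plane_point (curve D s 0 0) (- curve D s 0 1)) (passes_over D).

Inductive same_name (R : realType) (D : diagram R) : diagram R -> Prop :=
| same_name_refl : same_name D D
| same_name_reversal D' : same_name D D' -> same_name D (reversal D')
| same_name_mirror D' : same_name D D' -> same_name D (mirror D')
| same_name_symmetry D' : same_name D D' -> same_name D (symmetry D').

(* [r] is a lift, with rails [rail p1] (tail) and [rail p2] (head), of a
   diagram planar isotopic to [D].  Planar isotopies are topological here, as
   the curve of [D] is not required to be piecewise linear; [r] itself is. *)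
Definition lifts (R : realType) (p1 p2 : 'rV[R]_2) (D : diagram R)
    (r : set 'rV[R]_(2 + 1)) : Prop :=
  rail_arc p1 p2 r /\
  exists (g : R -> 'rV[R]_(2 + 1)) (H : R -> 'rV[R]_2 -> 'rV[R]_2),
    [/\ [/\ {within `[0, 1], continuous g}, {in `[0, 1] &, injective g},
            r = g @` `[0, 1] & rail p1 (g 0) /\ rail p2 (g 1)],
        ambient_isotopy (@continuous_track R 2) H,
        forall s : R, 0 <= s <= 1 -> H 1 (plane_proj (g s)) = curve D s
      & forall s s' : R, 0 <= s <= 1 -> 0 <= s' <= 1 -> s != s' ->
          curve D s = curve D s' ->
          (passes_over D s s' <-> height (g s') < height (g s))].

(* The rail arc class represented by a diagram. *)
Definition rail_arc_class (R : realType) (p1 p2 : 'rV[R]_2) (D : diagram R) :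
    set (set 'rV[R]_(2 + 1)) :=
  [set r | rail_arc p1 p2 r /\
           exists2 r0, lifts p1 p2 D r0 & rail_isotopic p1 p2 r0 r].

(** * The diagrams of 2_3 and 2_6 *)

Definition spiral (R : realType) (theta : R) : 'rV[R]_2 :=
  (1 + theta / pi) *: plane_point (cos theta) (sin theta).

(* The spiral, with theta = 10 pi s, for s in [0, 1/2]; then the segment from
   (-6, 0) to (-1, 0). *)
Definition curve_c (R : realType) (s : R) : 'rV[R]_2 :=
  if s <= 1 / 2 then spiral (10 * pi * s)
  else plane_point (- 6 + 10 * (s - 1 / 2)) 0.

(* At a double point the smaller parameter belongs to the spiral and the larger
   one to the final segment. *)
Definition diagram_2_3 (R : realType) : diagram R :=
  Diagram (@curve_c R) (fun s s' => s < s').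

(* The two double points are (-2, 0) and (-4, 0).  Exchanging the two crossings
   amounts to taking the mirror image. *)
Definition diagram_2_6 (R : realType) : diagram R :=
  Diagram (@curve_c R)
    (fun s s' => (curve_c s = plane_point (- 2) 0 /\ s < s') \/
                 (curve_c s = plane_point (- 4) 0 /\ s' < s)).

(* Main.v *)
Require Import Defs.
From mathcomp Require Import all_boot all_order all_algebra.
From mathcomp Require Import all_classical all_reals all_analysis.
From mathcomp Require Import zify ring lra.
Set Implicit Arguments.
Unset Strict Implicit.
Unset Printing Implicit Defensive.
Import Order.TTheory GRing.Theory Num.Theory.
Import numFieldNormedType.Exports.
Local Open Scope classical_set_scope.
Local Open Scope ring_scope.

(** The rails are vertical, so that a rail arc is studied through its projection
    to the plane, a curve between the two points on the rails.

    Lower bound.  Normalise these two points to (1,0) and (-1,0); a rail isotopy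
    followed by the planar isotopy to the diagram gives a homotopy from c to the
    projected arc in which interior points never meet the endpoints.  Away from
    its critical values 1 and -1 the cosine is a covering of the plane, each strip
    k pi < Re < (k+1) pi being mapped onto the plane cut along the rays of the
    axis outside the segment of critical values.  The lift of c starts at 0 and
    ends at 5 pi, and the lift of a homotopic curve still connects neighbourhoods
    of these points, hence crosses the vertical lines through pi, 2 pi, 3 pi and
    4 pi: the curve changes side of the axis at least four times
    ([homotopy_side_changes]).  On a stick an affine function changes sign at
    most once, and on the sticks through the two ends of the arc, where the
    function vanishes, not at all; so there are at least four sticks besides the
    first and the last one ([sticks_ge_side_changes], [class_sticks_ge6]).
    The lift is followed by counting: the strip index moves along a fine grid of
    parameters, and [strip_step_square] is the homotopy invariance on one square
    of the grid.

    Upper bound.  The polygon with vertices (1,0), (-1,4), (6,-60), (-3,120),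
    (20,-2000), (0,2000), (0,1) is a rapidly growing spiral around the origin,
    closed off by a last edge along the vertical half-axis; it is c with
    straightened half turns.  The homeomorphism [straighten], isotopic to the
    identity, maps c to it: a radial map adjusts on every ray the distances at
    which the spiral crosses it, and [fold] opens the lower half-plane to three
    quadrants, which gives the descending edges enough room.  Lifting the edges,
    with the first and the last one tilted, gives six sticks ([model_arc]); the
    two slopes realise both patterns of crossings.  Affine maps move the two
    rails to any position, and carry the picture through reversal, mirror
    reflection and symmetry ([drawing_affine], [drawable_same_name]). *)

(** * Strips of the cosine and crossings of the axis *)

(** Strips are indexed by their left end in units of pi.  Across the ray left of -1
    the strip 2j is adjacent to 2j+1, because the cosine is -1 at odd multiples of
    pi; across the ray right of 1, the strip 2j is adjacent to 2j-1. *)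
Definition swap_left (k : int) : int :=
  if (2 %| k)%Z then k + 1 else k - 1.
Definition swap_right (k : int) : int :=
  if (2 %| k)%Z then k - 1 else k + 1.

Lemma swap_leftK : involutive swap_left.
Proof. by move=> k; rewrite /swap_left; case: ifP; case: ifP; lia. Qed.

Lemma swap_rightK : involutive swap_right.
Proof. by move=> k; rewrite /swap_right; case: ifP; case: ifP; lia. Qed.

Section Strip.
Variable R : realType.
Implicit Types z w : 'rV[R]_2.

Definition upper z : bool := 0 <= z 0 1.

(** Abscissa of the point where the line through z and w meets the axis. *)
Definition axis_crossing z w : R :=
  (z 0 0 * w 0 1 - w 0 0 * z 0 1) / (w 0 1 - z 0 1).

(** Crossing the axis between -1 and 1 stays inside a strip.  Both directions of
    crossing have the same effect, so that steps are involutions. *)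
Definition strip_swap (x : R) : int -> int :=
  if x < -1 then swap_left else if 1 < x then swap_right else id.

Definition strip_step z w (k : int) : int :=
  if upper z == upper w then k else strip_swap (axis_crossing z w) k.

Lemma strip_swapK x : involutive (strip_swap x).
Proof.
by rewrite /strip_swap; case: ifP => _; [exact: swap_leftK|case: ifP => _ //; exact: swap_rightK].
Qed.

Lemma axis_crossing_between z w (a b : R) : upper z != upper w ->
  a < z 0 0 < b -> a < w 0 0 < b -> a < axis_crossing z w < b.
Proof.
rewrite /axis_crossing /upper; move: (z 0 0) (z 0 1) (w 0 0) (w 0 1) => x y u v.
move=> yv /andP[ax xb] /andP[au ub].
case: (leP 0 y) yv => y0; case: (leP 0 v) => // v0 _.
- have d0 : v - y < 0 by lra.
  rewrite ltr_ndivlMr // ltr_ndivrMr //; apply/andP; split; nra.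
- have d0 : 0 < v - y by lra.
  rewrite ltr_pdivlMr // ltr_pdivrMr //; apply/andP; split; nra.
Qed.

(** Away from the two marked points, a small box meets at most one of the three
    intervals into which they cut the axis. *)
Lemma strip_step_local z0 : (z0 0 0, z0 0 1) != (1, 0) ->
  (z0 0 0, z0 0 1) != (-1, 0) ->
  exists e : R, 0 < e /\ exists f : int -> int, involutive f /\
   forall z w, (forall j, `|z 0 j - z0 0 j| < e) ->
     (forall j, `|w 0 j - z0 0 j| < e) ->
   forall k, strip_step z w k = if upper z == upper w then k else f k.
Proof.
set x := z0 0 0; set y := z0 0 1 => n1 nN1.
have [y0|y0] := eqVneq y 0; last first.
  exists `|y|; split; first by rewrite normr_gt0.
  exists id; split=> // z w hz hw k; rewrite /strip_step.
  suff -> : upper z = upper w by rewrite eqxx.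
  move: (hz 1) (hw 1); rewrite /upper -/y.
  move: (z 0 1) (w 0 1) => u v; case: (ltrgt0P y) y0 => // hy _; rewrite !ltr_norml => /andP[? ?] /andP[? ?].
    by rewrite !ltW //; lra.
  by apply/idP/idP; lra.
have x1 : x != 1 by apply: contra n1 => /eqP->; rewrite y0.
have xN1 : x != -1 by apply: contra nN1 => /eqP->; rewrite y0.
exists (Num.min `|x - 1| `|x + 1|); split.
  by rewrite lt_min !normr_gt0 subr_eq0 x1 addr_eq0.
exists (strip_swap x); split; first exact: strip_swapK.
move=> z w /(_ 0) + /(_ 0) + k; rewrite /strip_step -/x => hz hw.
case: ifPn => // zw; congr (_ _).
move: hz hw; set e := Num.min _ _; rewrite !ltr_norml => hz hw.
have /andP[a1 a2] : x - e < axis_crossing z w < x + e.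
  by apply: axis_crossing_between => //; apply/andP; split; lra.
have ex1 : e <= `|x - 1| by rewrite /e ge_min lexx.
have ex2 : e <= `|x + 1| by rewrite /e ge_min lexx orbT.
move: ex1 ex2 a1 a2; move: (axis_crossing z w) => X.
rewrite /strip_swap.
case: (ltgtP x (-1)) xN1 => // hx _.
  rewrite !ler0_norm; [|lra|lra] => *.
  by have -> : X < -1 by lra.
rewrite (gtr0_norm (_ : 0 < x + 1)); last lra.
case: (ltgtP x 1) x1 => // hx1 _.
  rewrite !ltr0_norm; last lra. move=> *.
  have -> : X < -1 = false by lra.
  by have -> : 1 < X = false by lra.
rewrite !gtr0_norm; last lra. move=> *.
have -> : X < -1 = false by lra.
by have -> : 1 < X = true by lra.
Qed.

(** Inside a small box all steps across the axis are one and the same involution, so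
    a succession of steps depends only on the sides of its two ends. *)
Lemma strip_step_square z0 : (z0 0 0, z0 0 1) != (1, 0) ->
  (z0 0 0, z0 0 1) != (-1, 0) ->
  exists e : R, 0 < e /\ forall a b c d : 'rV[R]_2,
   (forall j, `|a 0 j - z0 0 j| < e) -> (forall j, `|b 0 j - z0 0 j| < e) ->
   (forall j, `|c 0 j - z0 0 j| < e) -> (forall j, `|d 0 j - z0 0 j| < e) ->
   forall k, strip_step b d (strip_step a b k) = strip_step c d (strip_step a c k).
Proof.
move=> n1 n2; have [e [e0 [f [fK ef]]]] := strip_step_local n1 n2.
exists e; split=> // a b c d ha hb hc hd k; rewrite !ef //.
by case: (upper a) (upper b) (upper c) (upper d) => [] [] [] []; rewrite /= ?fK.
Qed.

Lemma strip_step_dist z w k : (`|(strip_step z w k - k)%R| <= (upper z != upper w))%N.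
Proof.
rewrite /strip_step; case: ifP => _ /=; first by rewrite subrr.
rewrite /strip_swap; case: (_ < -1); last case: (1 < _).
- by rewrite /swap_left; case: (2 %| k)%Z; rewrite addrAC subrr add0r.
- by rewrite /swap_right; case: (2 %| k)%Z; rewrite addrAC subrr add0r.
- by rewrite subrr.
Qed.

Fixpoint strip_row (p : nat -> 'rV[R]_2) (k : int) (j : nat) : int :=
  if j is j'.+1 then strip_step (p j') (p j) (strip_row p k j') else k.

(** Discrete homotopy invariance: the squares of the grid are crossed one at a time. *)
Lemma strip_grid (p : nat -> nat -> 'rV[R]_2) m n k :
  (forall i j, (i < m)%N -> (j < n)%N -> forall l,
     strip_step (p i j.+1) (p i.+1 j.+1) (strip_step (p i j) (p i j.+1) l) =
     strip_step (p i.+1 j) (p i.+1 j.+1) (strip_step (p i j) (p i.+1 j) l)) ->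
  strip_row (p^~ n) (strip_row (p 0) k n) m =
  strip_row (p m) (strip_row (p^~ 0) k m) n.
Proof.
move=> sq.
pose q i j := strip_row (p^~ j) (strip_row (p 0) k j) i.
have hq i j : (i <= m)%N -> (j < n)%N -> q i j.+1 = strip_step (p i j) (p i j.+1) (q i j).
  elim: i j => [//|i IH] j im jn.
  by rewrite /q /= -!/(q _ _) IH ?(ltnW im) // sq.
have {hq} hq j : (j <= n)%N -> q m j = strip_row (p m) (q m 0) j.
  by elim: j => [//|j IH] jn; rewrite hq // IH // ltnW.
exact: hq.
Qed.

Lemma strip_row_dist p k n :
  (`|(strip_row p k n - k)%R| <= \sum_(j < n) (upper (p j) != upper (p j.+1)))%N.
Proof.
elim: n => [|n IH] /=; first by rewrite big_ord0 subrr.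
rewrite big_ord_recr /=; have := strip_step_dist (p n) (p n.+1) (strip_row p k n).
move: IH; move: (\sum_(j < n) _)%N (_ != _ : nat) (strip_row _ _ _) (strip_step _ _ _) => a b c d ? ?; lia.
Qed.

(** Right of -1 the axis can only be crossed in the middle interval, which fixes the
    index, or right of 1, which exchanges 0 and -1. *)
Lemma strip_row_right (p : nat -> 'rV[R]_2) n (k : int) : (forall j, (j <= n)%N -> -1 < p j 0 0) ->
  k = 0 \/ k = -1 -> strip_row p k n = 0 \/ strip_row p k n = -1.
Proof.
elim: n => [//|n IH] h hk /=.
have {IH} := IH (fun j jn => h j (leqW jn)) hk.
rewrite /strip_step /strip_swap; case: ifPn => // un.
have [u1|] := ltP (axis_crossing _ _) (-1).
  pose b := Num.max (p n 0 0) (p n.+1 0 0) + 1.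
  have : -1 < axis_crossing (p n) (p n.+1) < b.
    by apply: axis_crossing_between => //; rewrite h //= /b; case: (leP (p n 0 0) (p n.+1 0 0)); lra.
  by move=> /andP[/(lt_trans u1)]; rewrite ltxx.
by case: ifP => // _ _; rewrite /swap_right => -[->|->] /=; [right|left].
Qed.

Lemma strip_row_left (p : nat -> 'rV[R]_2) n (k : int) : (forall j, (j <= n)%N -> p j 0 0 < 1) ->
  k = 4 \/ k = 5 -> strip_row p k n = 4 \/ strip_row p k n = 5.
Proof.
elim: n => [//|n IH] h hk /=.
have {IH} := IH (fun j jn => h j (leqW jn)) hk.
rewrite /strip_step /strip_swap; case: ifPn => // un.
case: ifP => [_|_].
  by rewrite /swap_left => -[->|->] /=; [right|left].
case: ifP => // u1 _.
pose b := Num.min (p n 0 0) (p n.+1 0 0) - 1.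
have : b < axis_crossing (p n) (p n.+1) < 1.
  by apply: axis_crossing_between => //; rewrite h ?andbT //= /b; case: (leP (p n 0 0) (p n.+1 0 0)); lra.
by move=> /andP[_]; rewrite ltNge ltW.
Qed.
End Strip.

(** * The curve of the two diagrams *)

Lemma swap_left_even (n : nat) : ~~ odd n -> swap_left n = n.+1.
Proof. by rewrite /swap_left => on; case: ifP; lia. Qed.

Lemma swap_right_odd (n : nat) : odd n -> swap_right n = n.+1.
Proof. by rewrite /swap_right => on; case: ifP; lia. Qed.

Section SpiralCurve.
Variable R : realType.
Implicit Types s u v : R.

Lemma plane_point0 (x y : R) : plane_point x y 0 0 = x.
Proof. by rewrite mxE. Qed.

Lemma plane_point1 (x y : R) : plane_point x y 0 1 = y.
Proof. by rewrite mxE. Qed.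

Lemma plane_pointE (z : 'rV[R]_2) : z = plane_point (z 0 0) (z 0 1).
Proof.
by apply/rowP => -[[|[|//]] i]; rewrite mxE /=; congr (z _ _); apply/val_inj.
Qed.

Lemma plane_point_inj (x y u v : R) :
  plane_point x y = plane_point u v -> x = u /\ y = v.
Proof.
by move=> e; have := plane_point0 x y; have := plane_point1 x y;
   rewrite e plane_point0 plane_point1.
Qed.

(** The spiral with the angle measured in half turns. *)
Definition archimedean v : 'rV[R]_2 :=
  plane_point ((1 + v) * cos (pi * v)) ((1 + v) * sin (pi * v)).

Lemma curve_c_spiral s : s <= 1 / 2 -> curve_c s = archimedean (10 * s).
Proof.
move=> s2; rewrite /curve_c s2 /spiral.
have e : 10 * pi * s = pi * (10 * s) by ring.
have -> : 10 * pi * s / pi = 10 * s by rewrite e mulrAC mulfV ?mul1r // gt_eqF ?pi_gt0.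
rewrite e; apply/rowP => i; rewrite !mxE.
by case: i => [[|[|//]] i] /=.
Qed.

(** The square of this cosine is 1/2, while 49/100 is smaller. *)
Lemma cos_piquarter_gt : 7 / 10 < cos (pi / 4) :> R.
Proof.
have := cos_mulr2n (pi / 4 : R).
have -> : (pi / 4) *+ 2 = pi / 2 :> R by field.
have : 0 <= cos (pi / 4) :> R.
  by apply: cos_ge0_pihalf; have p0 := pi_gt0 R; apply/andP; split; lra.
rewrite cos_pihalf mulr2n; move: (cos _) => c; nra.
Qed.

Lemma cos_near v : `|v| <= 1 / 4 -> 7 / 10 < cos (pi * v).
Proof.
have p0 := pi_gt0 R.
have pos (w : R) : 0 <= w -> w <= 1 / 4 -> 7 / 10 < cos (pi * w).
  move=> w0 hw; apply: lt_le_trans cos_piquarter_gt _.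
  have [->|ne] := eqVneq w (1 / 4); first by rewrite mulrA mulr1.
  have lw : w < 1 / 4 by rewrite lt_neqAle ne.
  rewrite ltW // ltr_cos ?in_itv /=; first by nra.
  - by apply/andP; split; nra.
  - by apply/andP; split; nra.
by rewrite -cos_norm normrM (gtr0_norm p0); apply: pos.
Qed.

Lemma cos_pi_shift v : cos (pi * (v + 1)) = - cos (pi * v).
Proof. by rewrite mulrDr mulr1 cosDpi. Qed.
Lemma sin_pi_shift v : sin (pi * (v + 1)) = - sin (pi * v).
Proof. by rewrite mulrDr mulr1 sinDpi. Qed.

Lemma cos_pi_nat (n : nat) v : cos (pi * (v + n%:R)) = (-1) ^+ n * cos (pi * v).
Proof.
elim: n => [|n IH]; first by rewrite addr0 mul1r.
by rewrite -natr1 addrA cos_pi_shift IH exprS mulN1r mulNr.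
Qed.

Lemma sin_pi_nat (n : nat) v : sin (pi * (v + n%:R)) = (-1) ^+ n * sin (pi * v).
Proof.
elim: n => [|n IH]; first by rewrite addr0 mul1r.
by rewrite -natr1 addrA sin_pi_shift IH exprS mulN1r mulNr.
Qed.

(** The formula extends to the last point of the spiral, where the two pieces meet. *)
Lemma curve_c_final s : 1 / 2 <= s -> curve_c s = plane_point (10 * s - 11) 0.
Proof.
rewrite le_eqVlt => /predU1P[<-|s2]; last first.
  by rewrite /curve_c leNgt s2 /=; congr plane_point; lra.
rewrite curve_c_spiral // /archimedean.
have e : 10 * (1 / 2) = 0 + 5%:R :> R by lra.
rewrite e sin_pi_nat cos_pi_nat mulr0 cos0 sin0.
by congr plane_point; rewrite -signr_odd /=; lra.
Qed.

Lemma archimedean_upper (n : nat) v : n%:R <= v <= n%:R + 1 -> ~~ odd n ->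
  upper (archimedean v).
Proof.
move=> /andP[v1 v2] on; rewrite /upper plane_point1.
have -> : v = (v - n%:R) + n%:R by lra.
rewrite sin_pi_nat -signr_odd (negbTE on) mul1r.
have n0 : 0 <= n%:R :> R by [].
apply: mulr_ge0; first lra.
by apply: sin_ge0_pi; have p0 := pi_gt0 R; apply/andP; split; nra.
Qed.

Lemma archimedean_lower (n : nat) v : n%:R < v < n%:R + 1 -> odd n ->
  ~~ upper (archimedean v).
Proof.
move=> /andP[v1 v2] on; rewrite /upper plane_point1.
have -> : v = (v - n%:R) + n%:R by lra.
rewrite sin_pi_nat -signr_odd on mulN1r mulrN oppr_ge0 -ltNge.
have n0 : 0 <= n%:R :> R by [].
apply: mulr_gt0; first lra.
by apply: sin_gt0_pi; have p0 := pi_gt0 R; apply/andP; split; nra.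
Qed.

(** Half turns of even rank include both ends, where the curve is on the axis: the
    axis counts as part of the upper side. *)
Definition half_turns v : nat :=
  if v <= 1 then 0 else if v < 2 then 1 else if v <= 3 then 2 else
  if v < 4 then 3 else 4.

Lemma curve_c_upper s : 0 <= s -> upper (curve_c s) = ~~ odd (half_turns (10 * s)).
Proof.
move=> s0; case: (leP s (1 / 2)) => s2; last first.
  rewrite curve_c_final ?ltW // /upper plane_point1 lexx /half_turns.
  by do 4![case: ltP => ? //=; try lra].
rewrite curve_c_spiral // /half_turns.
case: (leP (10 * s) 1) => h1; first by apply: (@archimedean_upper 0) => //; lra.
case: (ltP (10 * s) 2) => h2; first by apply/negbTE/(@archimedean_lower 1) => //; lra.
case: (leP (10 * s) 3) => h3; first by apply: (@archimedean_upper 2) => //; lra.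
case: (ltP (10 * s) 4) => h4; first by apply/negbTE/(@archimedean_lower 3) => //; lra.
by apply: (@archimedean_upper 4) => //; lra.
Qed.

(** Near the end of its n-th half turn the spiral crosses the axis outside the
    segment between the marked points, on the side given by the parity of n. *)
Lemma archimedean_abscissa (n : nat) v : (0 < n <= 4)%N -> `|v - n%:R| <= 1 / 10 ->
  if odd n then -10 < archimedean v 0 0 < -1 else 1 < archimedean v 0 0 < 10.
Proof.
move=> /andP[n0 n4] hv; rewrite plane_point0.
have e : v = (v - n%:R) + n%:R by lra.
have : 7 / 10 < cos (pi * (v - n%:R)) by apply: cos_near; lra.
have := cos_le1 (pi * (v - n%:R)).
rewrite [in cos (pi * v)]e cos_pi_nat -signr_odd.
have n1 : 1 <= n%:R :> R by rewrite ler1n.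
have n5 : n%:R <= 4 :> R by rewrite (ler_nat _ n 4).
move: hv; rewrite ler_norml => /andP[a1 a2].
move: (cos _) => c c1 c0.
case: (odd n); rewrite /= ?mulN1r ?mul1r; apply/andP; split; nra.
Qed.

(** Along c the strip index of the lift counts half turns. *)
Lemma curve_c_step s s' : 0 <= s -> s <= s' -> s' <= s + 1 / 100 ->
  strip_step (curve_c s) (curve_c s') (half_turns (10 * s)) = half_turns (10 * s').
Proof.
move=> s0 ss' s's; rewrite /strip_step !curve_c_upper //; last lra.
have [->|ne] := eqVneq (half_turns (10 * s)) (half_turns (10 * s')).
  by rewrite eqxx.
have [n [e1 e2 n4 h1 h2]] : exists n, [/\ half_turns (10 * s) = n,
   half_turns (10 * s') = n.+1, (n < 4)%N, 10 * s <= n.+1%:R & n.+1%:R <= 10 * s'].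
  move: ne; rewrite /half_turns.
  case: (leP (10 * s) 1) => a1; case: (leP (10 * s') 1) => b1 //.
  - case: (ltP (10 * s') 2) => b2; last by exfalso; lra.
    by exists 0; split => //; lra.
  - by exfalso; lra.
  case: (ltP (10 * s) 2) => a2; case: (ltP (10 * s') 2) => b2 //.
  - case: (leP (10 * s') 3) => b3; last by exfalso; lra.
    by exists 1; split => //; lra.
  - by exfalso; lra.
  case: (leP (10 * s) 3) => a3; case: (leP (10 * s') 3) => b3 //.
  - case: (ltP (10 * s') 4) => b4; last by exfalso; lra.
    by exists 2; split => //; lra.
  - by exfalso; lra.
  case: (ltP (10 * s) 4) => a4; case: (ltP (10 * s') 4) => b4 //.
  - by exists 3; split => //; lra.
  - by exfalso; lra.
have n5 : n.+1%:R <= 4 :> R by rewrite (ler_nat _ n.+1 4).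
rewrite e1 e2 /= !curve_c_spiral; [|lra|lra].
have hs : `|10 * s - n.+1%:R| <= 1 / 10 by rewrite ler_norml; apply/andP; split; lra.
have hs' : `|10 * s' - n.+1%:R| <= 1 / 10 by rewrite ler_norml; apply/andP; split; lra.
have un : upper (archimedean (10 * s)) != upper (archimedean (10 * s')).
  rewrite -!curve_c_spiral; [|lra|lra].
  by rewrite !curve_c_upper; [|lra|lra]; rewrite e1 e2 /=; case: (odd n).
have := @archimedean_abscissa n.+1 _ n4 hs; have := @archimedean_abscissa n.+1 _ n4 hs'.
rewrite /= /strip_swap; case: ifP => on k' k.
  have /andP[_ ->] := axis_crossing_between un k k'.
  exact: swap_left_even.
have /andP[l _] := axis_crossing_between un k k'.
have n11 : -1 < 1 :> R by lra.
rewrite l (lt_gtF (lt_trans n11 l)).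
by apply: swap_right_odd; apply: negbFE.
Qed.
End SpiralCurve.

(** * Side changes of an arc made of sticks *)

Section Sticks.
Variable R : realType.
Local Notation P3 := 'rV[R]_(2 + 1).
Variables (g : R -> P3) (m : nat) (a b : 'I_m -> P3).
Hypothesis gc : {within `[0, 1], continuous g}.
Hypothesis ginj : {in `[0, 1] &, injective g}.
Hypothesis ab : forall i, a i != b i.
Hypothesis gab : g @` `[0, 1] = \bigcup_i stick (a i) (b i).

Let p i (t : R) : P3 := (1 - t) *: a i + t *: b i.

Lemma stick_point_continuous i : continuous (p i).
Proof.
move=> t; apply: cvgD; apply: cvgZr_tmp; last exact: cvg_id.
by apply: cvgB; [exact: cvg_cst|exact: cvg_id].
Qed.

Lemma stick_point_inj i : injective (p i).
Proof.
move=> t u; rewrite /p => /eqP; rewrite -subr_eq0.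
have -> : (1 - t) *: a i + t *: b i - ((1 - u) *: a i + u *: b i) = (t - u) *: (b i - a i).
  by apply/rowP => j; rewrite !mxE; ring.
by rewrite scaler_eq0 !subr_eq0 [b i == _]eq_sym (negbTE (ab i)) orbF => /eqP.
Qed.

(** The arc is injective on a compact interval, so its inverse is continuous, and a
    continuous injective change of parameter is monotone. *)
Lemma stick_parameter i : exists phi : R -> R,
  [/\ forall t : R, t \in `[0, 1] -> phi t \in `[0, 1] /\ g (phi t) = p i t,
      {within `[0, 1], continuous phi} &
      {in `[0, 1] &, {homo phi : t u / t < u}} \/
      {in `[0, 1] &, {homo phi : t u /~ t < u}}].
Proof.
have ex t : exists u, t \in `[0, 1] -> u \in `[0, 1] /\ g u = p i t.
  have [t01|nt] := boolP (t \in `[0, 1]); last by exists 0 => /negP.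
  have : (g @` `[0, 1]) (p i t) by rewrite gab; exists i => //; exists t.
  by case=> u u01 gu; exists u.
have [phi hphi] := choice ex; exists phi.
have phic : {within `[0, 1], continuous phi}.
  apply/continuous_closedP => C Cc; apply/closed_subspaceP.
  exists (p i @^-1` (g @` (C `&` `[0, 1]))).
    apply: closed_comp; first by move=> *; exact: stick_point_continuous.
    apply: compact_closed; first exact: norm_hausdorff.
    apply: continuous_compact; first by apply: continuous_subspaceW gc => ? [].
    by rewrite setIC; apply: compact_closedI => //; exact: segment_compact.
  apply/seteqP; split=> t [ht t01]; split=> //.
    have [u [Cu u01] gu] := ht; have [v01 gv] := hphi t t01.
    have e : phi t = u by apply: ginj => //; rewrite gv.
    by rewrite -e in Cu.
  by have [v01 gv] := hphi t t01; exists (phi t).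
split=> //; apply: itv_continuous_inj_mono => // t u t01 u01 e.
by apply: (@stick_point_inj i); rewrite -(hphi t t01).2 -(hphi u u01).2 e.
Qed.

Variables (Y : P3 -> R).
Hypothesis Yaff : forall (t : R) (u v : P3), Y ((1 - t) *: u + t *: v) = (1 - t) * Y u + t * Y v.
Hypotheses (Y0 : Y (g 0) = 0) (Y1 : Y (g 1) = 0).

Let B u := 0 <= Y (g u).
Let I i : set R := [set u | u \in `[0, 1] /\ stick (a i) (b i) (g u)].

Lemma on_stick i (phi : R -> R) :
  (forall t : R, t \in `[0, 1] -> phi t \in `[0, 1] /\ g (phi t) = p i t) ->
  I i = phi @` `[0, 1].
Proof.
move=> hphi; apply/seteqP; split=> [u [u01 [t t01 gu]]|u [t t01 <-]].
  by exists t => //; have [v01 gv] := hphi t t01; apply: ginj => //; rewrite gv.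
by have [v01 gv] := hphi t t01; split=> //; exists t.
Qed.

Lemma on_stick_closed i : closed (I i).
Proof.
have [phi [h1 h2 _]] := stick_parameter i.
rewrite (on_stick h1); apply: compact_closed; first exact: norm_hausdorff.
by apply: continuous_compact => //; exact: segment_compact.
Qed.

(** Affine functions of one variable are monotone. *)
Lemma affine_one_change (al be t1 t2 t3 t4 : R) :
  t1 <= t3 -> t1 <= t4 -> t2 <= t3 -> t2 <= t4 ->
  (0 <= (1 - t1) * al + t1 * be) != (0 <= (1 - t2) * al + t2 * be) ->
  (0 <= (1 - t3) * al + t3 * be) = (0 <= (1 - t4) * al + t4 * be).
Proof.
move=> h13 h14 h23 h24.
case: (leP al be) => ab0.
  have le t u : t <= u -> (1 - t) * al + t * be <= (1 - u) * al + u * be by nra.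
  case: (leP 0 ((1 - t1) * al + t1 * be)) => h1.
    by rewrite (le_trans h1 (le _ _ h13)) (le_trans h1 (le _ _ h14)).
  case: (leP 0 ((1 - t2) * al + t2 * be)) => h2 //.
  by rewrite (le_trans h2 (le _ _ h23)) (le_trans h2 (le _ _ h24)).
have le t u : t <= u -> (1 - u) * al + u * be <= (1 - t) * al + t * be by nra.
case: (leP 0 ((1 - t1) * al + t1 * be)) => h1; last first.
  by rewrite !leNgt (le_lt_trans (le _ _ h13) h1) (le_lt_trans (le _ _ h14) h1).
case: (leP 0 ((1 - t2) * al + t2 * be)) => h2 //.
by rewrite !leNgt (le_lt_trans (le _ _ h23) h2) (le_lt_trans (le _ _ h24) h2).
Qed.

(** Along the arc a stick is run through monotonically, possibly with interruptions,
    and an affine function changes sign at most once on it. *)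
Lemma on_stick_one_change i u v u' v' : I i u -> I i v -> I i u' -> I i v' ->
  u <= u' -> u <= v' -> v <= u' -> v <= v' -> B u != B v -> B u' = B v'.
Proof.
have [phi [h1 _ h2]] := stick_parameter i; rewrite (on_stick h1).
move=> [t1 i1 <-] [t2 i2 <-] [t3 i3 <-] [t4 i4 <-].
rewrite /B !(h1 _ _).2 // !Yaff => a13 a14 a23 a24 ne.
case: h2 => mono.
  have le t u0 : t \in `[0, 1] -> u0 \in `[0, 1] -> phi t <= phi u0 -> t <= u0.
    by move=> it iu; apply: contraTT; rewrite -!ltNge; apply: mono.
  by apply: affine_one_change ne; apply: le.
have le t u0 : t \in `[0, 1] -> u0 \in `[0, 1] -> phi t <= phi u0 -> u0 <= t.
  by move=> it iu; apply: contraTT; rewrite -!ltNge; apply: mono.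
apply/eqP; apply: contraNT ne => /affine_one_change ne; apply/eqP.
by apply: ne; apply: le.
Qed.

(** On a stick through an end of the arc the affine function vanishes at that end.
    By monotonicity all the other points of the arc on the stick lie on one side of
    it, where the sign is constant. *)
Lemma on_end_stick i e u v : I i e -> e = 0 \/ e = 1 -> I i u -> I i v ->
  0 < u < 1 -> 0 < v < 1 -> B u = B v.
Proof.
have [phi [h1 _ h2]] := stick_parameter i; rewrite (on_stick h1).
move=> [t0 i0 te] he [t1 i1 <-] [t2 i2 <-] u01 v01.
have Ye : Y (p i t0) = 0 by rewrite -(h1 t0 i0).2 te; case: he => ->.
rewrite /B !(h1 _ _).2 // !Yaff; move: Ye; rewrite Yaff.
move: (Y (a i)) (Y (b i)) => al be e0.
have [k kE] : exists k : R, forall t : R, (1 - t) * al + t * be = (t - t0) * k.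
  by exists (be - al) => t; move/eqP: e0; rewrite -subr_eq0 => /eqP e0; nra.
rewrite !kE.
suff : t0 < t1 /\ t0 < t2 \/ t1 < t0 /\ t2 < t0.
  by case=> -[l1 l2]; case: (ltgtP k 0) => k0; apply/idP/idP; nra.
have [ne1 ne2] : t0 != t1 /\ t0 != t2.
  by split; apply/eqP => e1; move: u01 v01; rewrite -e1 te;
    case: he => ->; rewrite ltxx ?andbF.
case: (ltgtP t0 t1) ne1 => // l1 _; case: (ltgtP t0 t2) ne2 => // l2 _; [by left| | |by right].
- exfalso; case: h2 => mono.
    have := mono _ _ i0 i1 l1; have := mono _ _ i2 i0 l2.
    by rewrite te; move: u01 v01 => /andP[? ?] /andP[? ?]; case: he => ->; lra.
  have := mono _ _ i1 i0 l1; have := mono _ _ i0 i2 l2.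
  by rewrite te; move: u01 v01 => /andP[? ?] /andP[? ?]; case: he => ->; lra.
- exfalso; case: h2 => mono.
    have := mono _ _ i1 i0 l1; have := mono _ _ i0 i2 l2.
    by rewrite te; move: u01 v01 => /andP[? ?] /andP[? ?]; case: he => ->; lra.
  have := mono _ _ i0 i1 l1; have := mono _ _ i2 i0 l2.
  by rewrite te; move: u01 v01 => /andP[? ?] /andP[? ?]; case: he => ->; lra.
Qed.

Lemma sticks_cover u : u \in `[0, 1] -> exists i, I i u.
Proof.
move=> u01; have : (g @` `[0, 1]) (g u) by exists u.
by rewrite gab => -[i _ gi]; exists i.
Qed.

(** Otherwise each stick meets this piece of the arc in one side only, and the two
    sides would split it into two disjoint closed subsets. *)
Lemma sides_change_on_stick c d : 0 <= c -> c <= d -> d <= 1 -> B c != B d ->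
  exists i u v, [/\ I i u, I i v, c <= u <= d, c <= v <= d & B u != B v].
Proof.
move=> c0 cd d1; apply: contraNP => nex.
have cst i u v : I i u -> I i v -> c <= u <= d -> c <= v <= d -> B u = B v.
  by move=> iu iv cu cv; apply/eqP/negPn/negP => ne; apply: nex; exists i, u, v.
pose T (e : bool) := \bigcup_(i in [set i | exists u, [/\ I i u, c <= u <= d & B u = e]]) I i.
have Tc e : closed (T e).
  by apply: closed_bigcup => [|i _]; [exact: finite_finset|exact: on_stick_closed].
have TE e : [set u | c <= u <= d /\ B u = e] = `[c, d] `&` T e.
  apply/seteqP; split=> u /=; rewrite in_itv /=.
    move=> [cu Bu]; split=> //; have [|i iu] := @sticks_cover u.
      by rewrite in_itv /=; move/andP: cu => [? ?]; apply/andP; split; lra.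
    by exists i => //; exists u.
  move=> [cu [i [v [iv cv <-]] iu]]; split=> //; exact: cst iu iv cu cv.
have := @segment_connected R c d; move/(_ [set u | c <= u <= d /\ B u = B c]).
move=> conn; have : [set u | c <= u <= d /\ B u = B c] = [set` `[c, d]].
  apply: conn.
  - by exists c; rewrite /= lexx cd.
  - exists (~` T (~~ B c)); first exact: closed_openC.
    apply/seteqP; split=> u /=; rewrite in_itv /=.
      move=> [cu Bu]; split=> // Tu.
      have : (`[c, d] `&` T (~~ B c)) u by split=> //; rewrite /= in_itv.
      by rewrite -TE => -[_]; rewrite Bu; case: (B c).
    move=> [cu nT]; split=> //; apply/eqP; apply/negPn/negP => ne; apply: nT.
    have : [set u | c <= u <= d /\ B u = ~~ B c] u.
      by split=> //; move: ne; case: (B u) (B c) => [] [].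
    by rewrite TE => -[].
  - by exists (T (B c)) => //; rewrite TE.
move=> E; have : [set u | c <= u <= d /\ B u = B c] d.
  by rewrite E /= in_itv /= lexx cd.
by move=> [_ ->].
Qed.

(** By connectedness such a stick contains the whole arc, and [on_end_stick] applies
    to all of it. *)
Lemma stick_through_both_ends i u v : I i 0 -> I i 1 -> 0 < u < 1 -> 0 < v < 1 ->
  B u = B v.
Proof.
move=> i0 i1 u01 v01.
suff full w : 0 < w < 1 -> I i w.
  by apply: (on_end_stick i0); [left|exact: full|exact: full| |].
move=> w01; move: i0 i1.
have [phi [h1 phic _]] := stick_parameter i; rewrite (on_stick h1).
move=> [t0 i0 e0] [t1 i1 e1].
have conn : connected (phi @` `[0, 1]).
  by apply: connected_continuous_connected => //; exact: segment_connected.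
move/connected_intervalP: conn => itv.
by apply: (itv 0 1) => //; [exists t0|exists t1|apply/andP; split; apply: ltW; case/andP: w01].
Qed.

(** Distinct side changes happen on distinct sticks, none of which passes through an
    end of the arc; the two ends lie on two further sticks. *)
Theorem sticks_ge_side_changes (s : nat -> R) n :
  (forall j, (j <= n)%N -> 0 < s j < 1) -> (forall j, (j < n)%N -> s j <= s j.+1) ->
  let changes := (\sum_(j < n) (B (s j) != B (s j.+1)))%N in
  (0 < changes)%N -> (changes + 2 <= m)%N.
Proof.
move=> s01 smono changes cpos.
(* Each sample interval with a change chooses a stick on which the change happens;
   this choice is injective and avoids the sticks through the ends. *)
pose C := [set j : 'I_n | B (s j) != B (s j.+1)]%SET.
have CE : changes = #|C|.
  by rewrite /changes -sum1_card [RHS]big_mkcond /=; apply: eq_bigr => j _; rewrite inE; case: (_ != _).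
have inI j : (j <= n)%N -> s j \in `[0, 1].
  by move=> /s01 /andP[? ?]; rewrite in_itv /= !ltW.
have ex (j : 'I_n) : exists i, j \in C -> exists u v,
    [/\ I i u, I i v, s j <= u <= s j.+1, s j <= v <= s j.+1 & B u != B v].
  have [jC|nC] := boolP (j \in C); last first.
    have [i _] := @sticks_cover (s 0) (inI 0 isT); by exists i.
  move: jC; rewrite inE => Bj.
  have /andP[s0 _] := s01 j (ltnW (ltn_ord j)).
  have /andP[_ s1] := s01 j.+1 (ltn_ord j).
  have [i [u [v h]]] := sides_change_on_stick (ltW s0) (smono j (ltn_ord j)) (ltW s1) Bj.
  by exists i => _; exists u, v.
have [f hf] := choice ex.
have sle j k : (j <= k)%N -> (k <= n)%N -> s j <= s k.
  elim: k => [|k IH]; first by rewrite leqn0 => /eqP->.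
  rewrite leq_eqVlt => /predU1P[-> //|jk] kn.
  by apply: le_trans (IH jk (ltnW kn)) (smono _ kn).
have finj : {in C &, injective f}.
  have aux (j k : 'I_n) : j \in C -> k \in C -> f j = f k -> (j < k)%N -> False.
    move=> jC kC e jk; have [u [v [iu iv /andP[u1 u2] /andP[v1 v2] ne]]] := hf j jC.
    have [u' [v' [iu' iv' /andP[u1' u2'] /andP[v1' v2'] /eqP]]] := hf k kC.
    have l := sle j.+1 k jk (ltnW (ltn_ord k)).
    rewrite -e in iu' iv'.
    by apply; apply: (on_stick_one_change iu iv iu' iv') ne;
      [apply: le_trans u2 (le_trans l u1')|apply: le_trans u2 (le_trans l v1')
      |apply: le_trans v2 (le_trans l u1')|apply: le_trans v2 (le_trans l v1')].
  move=> j k jC kC e; apply/val_inj/eqP; case: ltngtP => // jk; exfalso.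
    exact: aux jC kC e jk.
  exact: aux kC jC (esym e) jk.
have u01 (j : 'I_n) u : s j <= u <= s j.+1 -> 0 < u < 1.
  have /andP[s0 _] := s01 j (ltnW (ltn_ord j)).
  have /andP[_ s1] := s01 j.+1 (ltn_ord j).
  by move=> /andP[? ?]; apply/andP; split; [apply: lt_le_trans s0 _|apply: le_lt_trans s1].
have [|i0 h0] := @sticks_cover 0; first by rewrite in_itv /= lexx ler01.
have [|i1 h1] := @sticks_cover 1; first by rewrite in_itv /= lexx ler01.
have notend i e (j : 'I_n) : I i e -> e = 0 \/ e = 1 -> j \in C -> f j != i.
  move=> ie he jC; apply/eqP => fj; have [u [v [iu iv hu hv /eqP]]] := hf j jC.
  by apply; rewrite fj in iu iv; apply: (on_end_stick ie he iu iv); [exact: (u01 j _ hu)|exact: (u01 j _ hv)].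
have ne : i0 != i1.
  apply/eqP => e; rewrite -e in h1; move: cpos; rewrite CE card_gt0 => /set0Pn[j jC].
  have [u [v [iu iv hu hv /eqP]]] := hf j jC.
  by apply; apply: (stick_through_both_ends h0 h1); [exact: (u01 j _ hu)|exact: (u01 j _ hv)].
have : (#|f @: C| <= #|~: [set i0; i1]|)%N.
  apply/subset_leq_card/fintype.subsetP => _ /imsetP[j jC ->].
  by rewrite !inE negb_or (notend _ 0) // ?(notend _ 1) //; [right|left].
rewrite card_in_imset // -CE => le.
have := cardsC [set i0; i1]%SET; rewrite cards2 ne card_ord => <- /=.
by rewrite addnC addSn addSn add0n !ltnS.
Qed.
End Sticks.

(** * Homotopies avoiding the endpoints *)

Lemma far_strips (k l : int) (c : nat) : k = 0 \/ k = -1 -> l = 4 \/ l = 5 ->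
  (`|(l - k)%R| <= c)%N -> (4 <= c)%N.
Proof. by case=> ->; case=> -> /=; lia. Qed.

Section Homotopy.
Variable R : realType.
Variable F : R -> R -> 'rV[R]_2.
Hypothesis Fc : continuous (fun z : R * R => F z.1 z.2).
Hypothesis F0 : forall t : R, 0 <= t <= 1 -> F t 0 = plane_point 1 0.
Hypothesis F1 : forall t : R, 0 <= t <= 1 -> F t 1 = plane_point (-1) 0.
Hypothesis Favoid : forall t s : R, 0 <= t <= 1 -> 0 < s < 1 ->
  F t s <> plane_point 1 0 /\ F t s <> plane_point (-1) 0.
Hypothesis Fcurve : forall s : R, 0 <= s <= 1 -> F 0 s = curve_c s.

Lemma homotopy_coord_near (t s e : R) : 0 < e ->
  exists d : R, 0 < d /\ forall t' s' : R, `|t - t'| < d -> `|s - s'| < d ->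
    forall j, `|F t' s' 0 j - F t s 0 j| < e.
Proof.
move=> e0; have /cvg_ballP /(_ e e0) := @Fc (t, s).
move=> /nbhs_ballP[d /= d0 hd]; exists d; split=> // t' s' ht hs j.
have /hd /= [_ h] : ball (t, s) d (t', s') by split.
by rewrite distrC; exact: (h 0 j).
Qed.

Lemma unit_interval_compact : compact [set t : R | 0 <= t <= 1].
Proof.
have -> : [set t : R | 0 <= t <= 1] = [set` `[0, 1]].
  by apply/seteqP; split=> t /=; rewrite in_itv.
exact: segment_compact.
Qed.

(** Compactness of the time interval makes the neighbourhood of the start uniform. *)
Lemma homotopy_near_start : exists e : R, 0 < e /\
  forall t s : R, 0 <= t <= 1 -> `|s| < e -> -1 < F t s 0 0.
Proof.
have /compact_near_coveringP cov := unit_interval_compact.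
have /(_ _) := cov R (nbhs (0 : R)) (fun s t => 0 <= t <= 1 -> -1 < F t s 0 0) _.
case=> [t t01|/= e e0 he].
  have [d [d0 hd]] := @homotopy_coord_near t 0 1 ltr01.
  exists (ball t d, ball (0 : R) d); first by split; exact: nbhsx_ballx.
  move=> [t' s] /= [ht hs] _; have := hd t' s ht hs 0.
  by rewrite F0 // plane_point0 ltr_norml => /andP[? _]; lra.
exists e; split=> // t s t01 hs; apply: (he s) => //=.
by rewrite sub0r normrN.
Qed.

Lemma homotopy_near_end : exists e : R, 0 < e /\
  forall t s : R, 0 <= t <= 1 -> `|1 - s| < e -> F t s 0 0 < 1.
Proof.
have /compact_near_coveringP cov := unit_interval_compact.
have /(_ _) := cov R (nbhs (1 : R)) (fun s t => 0 <= t <= 1 -> F t s 0 0 < 1) _.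
case=> [t t01|/= e e0 he].
  have [d [d0 hd]] := @homotopy_coord_near t 1 1 ltr01.
  exists (ball t d, ball (1 : R) d); first by split; exact: nbhsx_ballx.
  move=> [t' s] /= [ht hs] _; have := hd t' s ht hs 0.
  by rewrite F1 // plane_point0 ltr_norml => /andP[_ ?]; lra.
by exists e; split=> // t s t01 hs; apply: (he s).
Qed.

Definition square_at (t s d : R) := forall t1 t2 s1 s2 : R,
  `|t - t1| < d -> `|t - t2| < d -> `|s - s1| < d -> `|s - s2| < d -> forall k,
  strip_step (F t1 s2) (F t2 s2) (strip_step (F t1 s1) (F t1 s2) k) =
  strip_step (F t2 s1) (F t2 s2) (strip_step (F t1 s1) (F t2 s1) k).

(** Compactness again: the size of the box in [strip_step_square] can be chosen
    uniformly as long as the parameter stays away from the ends of the curve. *)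
Lemma homotopy_squares (e : R) : 0 < e -> exists d : R, 0 < d /\
  forall t s : R, 0 <= t <= 1 -> e <= s <= 1 - e -> square_at t s d.
Proof.
move=> e0.
have K : compact ([set t : R | 0 <= t <= 1] `*` [set` `[e, 1 - e]]).
  by apply: compact_setX; [exact: unit_interval_compact|exact: segment_compact].
have /compact_near_coveringP cov := K.
have /(_ _) := cov R (nbhs (0 : R)) (fun d x => 0 < d -> square_at x.1 x.2 d) _.
case=> [[t s] /= [t01]|/= d d0 hd].
  rewrite in_itv /= => /andP[es se].
  have [|n1 n2] := @Favoid t s t01; first by apply/andP; split; lra.
  have [||r [r0 hr]] := @strip_step_square R (F t s).
  - by apply/eqP => -[e1 e2]; apply: n1; rewrite [F t s]plane_pointE e1 e2.
  - by apply/eqP => -[e1 e2]; apply: n2; rewrite [F t s]plane_pointE e1 e2.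
  have [d [d0 hd]] := @homotopy_coord_near t s r r0.
  have d2 : 0 < d / 2 by rewrite divr_gt0.
  exists (ball (t, s) (d / 2), ball (0 : R) (d / 2)).
    by split; exact: nbhsx_ballx.
  move=> [[t' s'] d'] /= [[/= ht hs]]; rewrite /ball /= sub0r normrN => hd' d'0.
  have d'l : d' < d / 2 by rewrite (le_lt_trans _ hd') // ler_norm.
  rewrite /ball /= in ht hs.
  have tri (a b c : R) : `|a - b| < d / 2 -> `|b - c| < d' -> `|a - c| < d.
    move=> h1 h2; have -> : a - c = (a - b) + (b - c) by ring.
    by apply: le_lt_trans (ler_normD _ _) _; lra.
  move=> t1 t2 s1 s2 ht1 ht2 hs1 hs2 k.
  by apply: hr => j; apply: hd; apply: tri; eauto.
exists (d / 2); rewrite divr_gt0 //; split=> // t s t01 hs.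
apply: (hd (d / 2) _ (t, s)) => /=.
- by rewrite /ball /= sub0r normrN gtr0_norm ?divr_gt0 // ltr_pdivrMr // mulr_natr mulr2n ltrDl.
- by split=> //=; rewrite in_itv.
- by rewrite divr_gt0.
Qed.

(** On a fine grid the index of the strip goes from 0 to 4 along c.  Near the start
    it stays in the two strips that touch 0, near the end in the two strips that
    touch 5 pi, so along the last row it still moves by at least 4. *)
Theorem homotopy_side_changes : exists n (s : nat -> R),
  [/\ forall j, (j <= n)%N -> 0 < s j < 1,
      forall j, (j < n)%N -> s j <= s j.+1
    & (4 <= \sum_(j < n) (upper (F 1 (s j)) != upper (F 1 (s j.+1))))%N].
Proof.
have [e1 [e10 he1]] := homotopy_near_start.
have [e2 [e20 he2]] := homotopy_near_end.
(* The samples run from e to 1 - e, where e is so small that these two columns of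
   the grid lie in the neighbourhoods of the ends, and that c has not completed
   its first half turn at e. *)
pose e := Num.min (Num.min e1 e2 / 2) (1 / 100).
have e0 : 0 < e by rewrite lt_min !divr_gt0 // ?lt_min ?e10.
have ee1 : e < e1.
  rewrite /e gt_min ltr_pdivrMr // gt_min; apply/orP; left; apply/orP; left; lra.
have ee2 : e < e2.
  rewrite /e gt_min ltr_pdivrMr // gt_min; apply/orP; left; apply/orP; right; lra.
have e3 : e <= 1 / 100 by rewrite /e ge_min lexx orbT.
have [d [d0 hd]] := homotopy_squares e0.
(* The mesh is smaller than d, for the squares, and at most 1/100, for [curve_c_step]. *)
pose n := (Num.Def.truncn (d^-1) + 100)%N.
have n100 : 100 <= n%:R :> R by rewrite /n natrD lerDr.
have n0 : 0 < n%:R :> R by lra.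
have nd : n%:R^-1 < d.
  rewrite -[d]invrK ltf_pV2 ?posrE ?invr_gt0 //.
  apply: lt_le_trans (truncnS_gt _) _.
  by rewrite /n ler_nat -addn1 leq_add2l.
have n1 : n%:R^-1 <= 1 / 100 :> R.
  by rewrite div1r lef_pV2 ?posrE.
pose s (j : nat) := e + j%:R * ((1 - 2 * e) / n%:R).
pose t (i : nat) := i%:R / n%:R : R.
have nv0 : 0 < n%:R^-1 :> R by rewrite invr_gt0.
have sS j : s j.+1 = s j + (1 - 2 * e) / n%:R by rewrite /s -natr1; ring.
have tS j : t j.+1 = t j + n%:R^-1 by rewrite /t -natr1; field; lra.
have sn : s n = 1 - e by rewrite /s; field; lra.
have s0 : s 0 = e by rewrite /s mul0r addr0.
have t01 i : (i <= n)%N -> 0 <= t i <= 1.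
  move=> ni; have h : i%:R <= n%:R :> R by rewrite ler_nat.
  by apply/andP; split; [rewrite divr_ge0 // ltW|rewrite ler_pdivrMr // mul1r].
have se j : (j <= n)%N -> e <= s j <= 1 - e.
  move=> nj; have h : j%:R <= n%:R :> R by rewrite ler_nat.
  have f0 : 0 <= (1 - 2 * e) / n%:R by rewrite divr_ge0 ?ltW //; lra.
  rewrite -sn /s lerDl mulr_ge0 //= lerD2l ler_wpM2r //.
have step : 0 <= (1 - 2 * e) / n%:R <= n%:R^-1.
  apply/andP; split; first by rewrite divr_ge0 ?ltW //; lra.
  by rewrite ler_piMl ?ltW //; lra.
have /andP[st0 st1] := step.
pose p i j := F (t i) (s j).
have sq i j : (i < n)%N -> (j < n)%N -> forall l,
    strip_step (p i j.+1) (p i.+1 j.+1) (strip_step (p i j) (p i j.+1) l) =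
    strip_step (p i.+1 j) (p i.+1 j.+1) (strip_step (p i j) (p i.+1 j) l).
  move=> il jl l; apply: (hd (t i) (s j)).
  - exact: t01 (ltnW il).
  - exact: se (ltnW jl).
  - by rewrite subrr normr0.
  - by rewrite tS opprD addNKr normrN gtr0_norm.
  - by rewrite subrr normr0.
  - by rewrite sS opprD addNKr normrN ger0_norm //; lra.
have grid := strip_grid 0 sq.
have t0 : t 0 = 0 by rewrite /t mul0r.
have tn : t n = 1 by rewrite /t mulfV ?gt_eqF.
have row0 j : (j <= n)%N -> strip_row (p 0) 0 j = half_turns (10 * s j).
  elim: j => [|j IH] jn.
    by rewrite /= s0 /half_turns; have -> : 10 * e <= 1 by lra.
  have /andP[a1 a2] := se j (ltnW jn); have /andP[b1 b2] := se j.+1 jn.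
  rewrite /= IH 1?ltnW // /p t0 !Fcurve; [|lra|lra].
  by apply: curve_c_step; rewrite ?sS; lra.
have turns : half_turns (10 * s n) = 4.
  by rewrite sn /half_turns; do 4![case: ifP => [?|_]; first by exfalso; lra].
have start : strip_row (p^~ 0) 0 n = 0 \/ strip_row (p^~ 0) 0 n = -1.
  apply: strip_row_right; last by left.
  by move=> i il; apply: he1; [exact: t01|rewrite s0 gtr0_norm].
have fin : strip_row (p^~ n) 4 n = 4 \/ strip_row (p^~ n) 4 n = 5.
  apply: strip_row_left; last by left.
  move=> i il; apply: he2; first exact: t01.
  by rewrite sn (_ : 1 - (1 - e) = e) ?gtr0_norm //; ring.
exists n, s; split=> [j jn|j jn|].
- by have /andP[? ?] := se j jn; apply/andP; split; lra.
- by rewrite sS lerDl.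
have := strip_row_dist (p n) (strip_row (p^~ 0) 0 n) n.
rewrite -grid row0 // turns /p tn; move: start fin.
exact: far_strips.
Qed.
End Homotopy.

(** * Continuity *)

Lemma continuous_compose (T U V : topologicalType) (f : T -> U) (h : U -> V) :
  continuous f -> continuous h -> continuous (fun x => h (f x)).
Proof. by move=> cf ch x; apply: continuous_comp; [exact: cf|exact: ch]. Qed.

Section Continuity.
Variables (R : realType) (T : topologicalType).
Implicit Types f g : T -> R.

Lemma continuous_cst_fun (a : R) : continuous (fun _ : T => a).
Proof. by move=> x; exact: cvg_cst. Qed.

Lemma continuous_add f g : continuous f -> continuous g ->
  continuous (fun x => f x + g x).
Proof. by move=> cf cg x; apply: cvgD; [exact: cf|exact: cg]. Qed.

Lemma continuous_opp f : continuous f -> continuous (fun x => - f x).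
Proof. by move=> cf x; apply: cvgN; exact: cf. Qed.

Lemma continuous_mul f g : continuous f -> continuous g ->
  continuous (fun x => f x * g x).
Proof. by move=> cf cg x; apply: cvgM; [exact: cf|exact: cg]. Qed.

Lemma continuous_inv f : (forall x, f x != 0) -> continuous f ->
  continuous (fun x => (f x)^-1).
Proof. by move=> f0 cf x; apply: cvgV => //; exact: cf. Qed.

Lemma continuous_maxr f g : continuous f -> continuous g ->
  continuous (fun x => Num.max (f x) (g x)).
Proof. by move=> cf cg x; apply: continuous_max; [exact: cf|exact: cg]. Qed.

Lemma continuous_minr f g : continuous f -> continuous g ->
  continuous (fun x => Num.min (f x) (g x)).
Proof. by move=> cf cg x; apply: continuous_min; [exact: cf|exact: cg]. Qed.

Lemma continuous_coord n (f : T -> 'rV[R]_n) j : continuous f ->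
  continuous (fun x => f x 0 j).
Proof. by move=> cf; exact: (continuous_compose cf (@coord_continuous R 1 n 0 j)). Qed.

Lemma cvg_row n (F : set_system T) (FF : Filter F) (f : T -> 'rV[R]_n) (v : 'rV[R]_n) :
  (forall j, f x 0 j @[x --> F] --> v 0 j) -> f @ F --> v.
Proof.
move=> h; apply/cvg_ballP => e e0.
have : \forall x \near F, forall j, ball (v 0 j) e (f x 0 j).
  by apply: filter_forall => j; have /cvg_ballP := h j; apply.
apply: filterS => x hx; split=> // i j; rewrite [i]ord1; exact: hx.
Qed.

Lemma continuous_row n (f : T -> 'rV[R]_n) :
  (forall j, continuous (fun x => f x 0 j)) -> continuous f.
Proof. by move=> h x; apply: cvg_row => j; exact: h. Qed.

Lemma continuous_plane_point f g : continuous f -> continuous g ->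
  continuous (fun x => plane_point (f x) (g x)).
Proof.
move=> cf cg; apply: continuous_row => -[[|[|//]] i].
  have -> : (fun x => plane_point (f x) (g x) 0 (Ordinal i)) = f.
    by apply/funext => x; rewrite mxE.
  exact: cf.
have -> : (fun x => plane_point (f x) (g x) 0 (Ordinal i)) = g.
  by apply/funext => x; rewrite mxE.
exact: cg.
Qed.

Lemma continuous_within_comp (U V : topologicalType) (A : set U) (f : U -> V)
    (h : T -> U) : {within A, continuous f} -> continuous h -> (forall x, A (h x)) ->
  continuous (fun x => f (h x)).
Proof.
move=> /subspace_continuousP cf ch hA x.
apply: cvg_comp (cf (h x) (hA x)) => W /=; rewrite /within /= nbhs_simpl => nW.
have := ch x _ nW; rewrite nbhs_simpl /=; apply: filterS => y hy; exact: hy (hA y).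
Qed.
End Continuity.

Lemma continuous_pair_fun (T U V : topologicalType) (f : T -> U) (h : T -> V) :
  continuous f -> continuous h -> continuous (fun x => (f x, h x)).
Proof. by move=> cf ch x; apply: cvg_pair; [exact: cf|exact: ch]. Qed.

Ltac ctn_step :=
  lazymatch goal with
  | |- continuous (fun x => @?f x + @?g x) => apply: continuous_add
  | |- continuous (fun x => @?f x * @?g x) => apply: continuous_mul
  | |- continuous (fun x => - (@?f x)) => apply: continuous_opp
  | |- continuous (fun x => Num.max (@?f x) (@?g x)) => apply: continuous_maxr
  | |- continuous (fun x => Num.min (@?f x) (@?g x)) => apply: continuous_minr
  | |- continuous (Num.max ?a) => change (continuous (fun x => Num.max a x))
  | |- continuous (Num.min ?a) => change (continuous (fun x => Num.min a x))
  | |- continuous ( +%R ?a) => change (continuous (fun x => a + x))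
  | |- continuous ( *%R ?a) => change (continuous (fun x => a * x))
  | |- continuous fst => move=> ?; apply: cvg_fst
  | |- continuous snd => move=> ?; apply: cvg_snd
  | |- continuous id => move=> ?; apply: cvg_id
  | |- continuous (fun x => x.1) => move=> ?; apply: cvg_fst
  | |- continuous (fun x => x.2) => move=> ?; apply: cvg_snd
  | |- continuous (fun x => x) => move=> ?; apply: cvg_id
  | |- continuous (fun x => fun_of_matrix (@?h x) ?i ?j) => apply: continuous_coord; try assumption
  | |- continuous (fun x => ?a) => exact: continuous_cst_fun
  | |- continuous _ => first [assumption | exact: opp_continuous]
  end.
Ltac ctn := repeat ctn_step.

Section Clamp.
Variable R : realType.
Definition clamp (t : R) : R := Num.max 0 (Num.min 1 t).
Lemma clamp01 (t : R) : 0 <= clamp t <= 1.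
Proof. by rewrite /clamp le_max lexx ge_max ler01 ge_min lexx. Qed.
Lemma clamp_id (t : R) : 0 <= t <= 1 -> clamp t = t.
Proof. by move=> /andP[t0 t1]; rewrite /clamp min_r // max_r. Qed.
Lemma clamp_continuous : continuous clamp.
Proof. by rewrite /clamp; ctn. Qed.
End Clamp.

Section PLContinuous.
Variable R : realType.

Lemma continuous_mulmx_coord m n (A : 'M[R]_(m, n)) j :
  continuous (fun x : 'rV[R]_m => (x *m A) 0 j).
Proof.
have -> : (fun x : 'rV[R]_m => (x *m A) 0 j) = (fun x => \sum_i x 0 i * A i j).
  by apply/funext => x; rewrite mxE.
apply: continuous_big => [|i _]; first exact: add_continuous.
by apply: continuous_mul; [exact: coord_continuous|exact: continuous_cst_fun].
Qed.

(** Near x only the closed pieces that contain x matter, and on those the map is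
    affine. *)
Lemma PL_on_continuous m n (D : set 'rV[R]_m) (f : 'rV[R]_m -> 'rV[R]_n) :
  PL_on D f -> {within D, continuous f}.
Proof.
move=> PLf; apply/subspace_continuousP => x Dx.
have [k [P [Ppoly cover Paff]]] := PLf x Dx.
apply/cvg_ballP => e e0; rewrite near_withinE.
have : \forall y \near x, forall i, D y -> P i y -> ball (f x) e (f y).
  apply: (@filter_forall _ _ (fun i y => D y -> P i y -> ball (f x) e (f y)) (nbhs x) (nbhs_filter x)) => i; have [A [b fE]] := Paff i.
  have [Px|nPx] := pselect (P i x).
    have cA : continuous (fun y : 'rV[R]_m => y *m A + b).
      apply: continuous_row => j; under eq_fun do rewrite mxE.
      by apply: continuous_add; [exact: continuous_mulmx_coord|exact: continuous_cst_fun].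
    have /cvg_ballP /(_ e e0) := cA x; apply: filterS => y hy Dy Py.
    by rewrite (fE x) // (fE y).
  have [l [C [d PE]]] := Ppoly i; rewrite PE in nPx.
  move/existsNP: nPx => [j /negP]; rewrite -ltNge => lt.
  have := @continuous_mulmx_coord _ _ C j x.
  move=> /cvgr_gt /(_ _ lt).
  apply: filterS => y hy Dy; rewrite PE => /(_ j); rewrite leNgt /=.
  by move: hy => /= ->.
apply: filterS2 cover => y cy hy Dy.
by have [i Py] := cy Dy; exact: hy Py.
Qed.
End PLContinuous.

(** * At least six sticks *)

Section Frame.
Variable R : realType.
Implicit Types p q z : 'rV[R]_2.

(** Encoded with a sign so that both cases share one affine formula. *)
Definition flip (b : bool) z : 'rV[R]_2 := plane_point (z 0 0) ((-1) ^+ b * z 0 1).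

Lemma flipK b : involutive (flip b).
Proof.
move=> z; rewrite [RHS]plane_pointE /flip plane_point0 plane_point1.
by rewrite mulrA -expr2 sqrr_sign mul1r.
Qed.

Definition dist2 p q : R :=
  (p 0 0 - q 0 0) * (p 0 0 - q 0 0) + (p 0 1 - q 0 1) * (p 0 1 - q 0 1).

Lemma dist2_neq0 p q : p != q -> dist2 p q != 0.
Proof.
apply: contra; rewrite /dist2 -!expr2 paddr_eq0 ?sqr_ge0 // !sqrf_eq0 !subr_eq0.
by move=> /andP[/eqP e0 /eqP e1]; rewrite [p]plane_pointE [q]plane_pointE e0 e1.
Qed.

(** In complex notation this is the map z |-> (2 z - p - q) / (p - q), the
    similarity that sends p to 1 and q to -1. *)
Definition frame p q z : 'rV[R]_2 :=
  plane_point (((2 * z 0 0 - p 0 0 - q 0 0) * (p 0 0 - q 0 0) +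
                (2 * z 0 1 - p 0 1 - q 0 1) * (p 0 1 - q 0 1)) / dist2 p q)
              (((2 * z 0 1 - p 0 1 - q 0 1) * (p 0 0 - q 0 0) -
                (2 * z 0 0 - p 0 0 - q 0 0) * (p 0 1 - q 0 1)) / dist2 p q).

Lemma frame_tail p q : p != q -> frame p q p = plane_point 1 0.
Proof.
move=> /dist2_neq0 d0; rewrite /frame; congr plane_point; last by move: d0; rewrite /dist2 => d0; field.
by apply: (mulIf d0); rewrite mul1r divfK // /dist2; ring.
Qed.

Lemma frame_head p q : p != q -> frame p q q = plane_point (-1) 0.
Proof.
move=> /dist2_neq0 d0; rewrite /frame; congr plane_point; last by move: d0; rewrite /dist2 => d0; field.
by apply: (mulIf d0); rewrite divfK // /dist2; ring.
Qed.

Lemma frame_inj p q : p != q -> injective (frame p q).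
Proof.
move=> /dist2_neq0 d0 z w /plane_point_inj[/(mulIf (invr_neq0 d0)) e0 /(mulIf (invr_neq0 d0)) e1].
rewrite [z]plane_pointE [w]plane_pointE.
set a := p 0 0 - q 0 0 in e0 e1; set b := p 0 1 - q 0 1 in e0 e1.
have [E0 E1] := (congr1 ( *%R a) e0, congr1 ( *%R b) e1).
have [E2 E3] := (congr1 ( *%R b) e0, congr1 ( *%R a) e1).
by congr plane_point; apply: (mulIf d0); rewrite /dist2 -/a -/b; lra.
Qed.

Lemma frame_std z : frame (plane_point 1 0) (plane_point (-1) 0) z = z.
Proof.
rewrite [RHS]plane_pointE /frame /dist2 !plane_point0 !plane_point1.
by congr plane_point; field.
Qed.

Lemma frame_affine p q b (t : R) z w :
  frame p q (flip b ((1 - t) *: z + t *: w)) 0 1 =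
  (1 - t) * frame p q (flip b z) 0 1 + t * frame p q (flip b w) 0 1.
Proof. by rewrite /frame /flip !(plane_point0, plane_point1) !mxE; ring. Qed.

Lemma continuous_frame (T : topologicalType) (p q z : T -> 'rV[R]_2) :
  (forall x, p x != q x) -> continuous p -> continuous q -> continuous z ->
  continuous (fun x => frame (p x) (q x) (z x)).
Proof.
move=> pq cp cq cz.
have dc : continuous (fun x => (dist2 (p x) (q x))^-1).
  apply: continuous_inv => [x|]; first exact: dist2_neq0.
  by rewrite /dist2; ctn.
rewrite /frame; apply: continuous_plane_point; apply: continuous_mul => //; ctn.
Qed.
End Frame.

Lemma curve_c0 (R : realType) : curve_c 0 = plane_point 1 0 :> 'rV[R]_2.
Proof.
rewrite curve_c_spiral; last lra.
by rewrite /archimedean !mulr0 cos0 sin0 addr0 mulr1 mulr0.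
Qed.

Lemma curve_c1 (R : realType) : curve_c 1 = plane_point (-1) 0 :> 'rV[R]_2.
Proof. by rewrite curve_c_final; [congr plane_point; ring|lra]. Qed.

Section Lower.
Variable R : realType.
Variables (p1 p2 : 'rV[R]_2).

Lemma plane_proj_continuous : continuous (@plane_proj R).
Proof.
apply: continuous_row => j; rewrite /plane_proj; under eq_fun do rewrite mxE.
exact: coord_continuous.
Qed.

(** The two parametrisations have the same image, and in the piecewise linear one
    only the ends lie on the rails. *)
Lemma rail_arc_rails (r : set 'rV[R]_(2 + 1)) g : p1 != p2 -> rail_arc p1 p2 r ->
  {in `[0, 1] &, injective g} -> r = g @` `[0, 1] ->
  rail p1 (g 0) /\ rail p2 (g 1) ->
  forall s : R, 0 < s < 1 -> plane_proj (g s) <> p1 /\ plane_proj (g s) <> p2.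
Proof.
move=> p12 [k [_ _ rk [k0 k1] kin]] ginj rg [g0 g1] s s01.
have i0 : (0 : R) \in `[0, 1] by rewrite in_itv /= lexx ler01.
have i1 : (1 : R) \in `[0, 1] by rewrite in_itv /= lexx ler01.
have sI : s \in `[0, 1] by rewrite in_itv /= !ltW; case/andP: s01.
have uniq x y (p : 'rV[R]_2) : r x -> r y -> (p = p1 \/ p = p2) ->
    plane_proj x = p -> plane_proj y = p -> x = y.
  have aux z : r z -> (plane_proj z = p1 -> z = k 0) /\ (plane_proj z = p2 -> z = k 1).
    rewrite rk => -[u]; rewrite /= in_itv /= => /andP[u0 u1] <-.
    have [->|un0] := eqVneq u 0; first by split=> //; rewrite k0 => /eqP; rewrite (negbTE p12).
    have [->|un1] := eqVneq u 1; first by split=> //; rewrite k1 => /esym /eqP; rewrite (negbTE p12).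
    have [|n1 n2] := kin u; last by split=> /[dup] ?.
    by rewrite lt_neqAle eq_sym un0 u0 lt_neqAle un1 u1.
  by move=> /aux[ax1 ax2] /aux[ay1 ay2] [] -> ex ey;
    [rewrite ax1 // ay1|rewrite ax2 // ay2].
have rg_ u : u \in `[0, 1] -> r (g u) by move=> iu; rewrite rg; exists u.
split=> e.
  have := uniq _ _ _ (rg_ s sI) (rg_ 0 i0) (or_introl erefl) e g0.
  by move/(ginj s 0 sI i0) => s0; move: s01; rewrite s0 ltxx.
have := uniq _ _ _ (rg_ s sI) (rg_ 1 i1) (or_intror erefl) e g1.
by move/(ginj s 1 sI i1) => s0; move: s01; rewrite s0 ltxx andbF.
Qed.

Definition rev (b : bool) (s : R) := if b then 1 - s else s.

(** The rail isotopy read forwards and the planar isotopy read backwards give one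
    homotopy, from the curve of the diagram to the projection of the arc.  Both
    isotopies consist of bijections and the first one preserves the rails, so that
    interior points never meet the ends. *)
Lemma class_sticks_ge6 (D : diagram R) (b1 b2 : bool) r m : p1 != p2 ->
  (forall s : R, 0 <= s <= 1 -> flip b1 (curve D (rev b2 s)) = curve_c s) ->
  rail_arc_class p1 p2 D r -> union_of_sticks m r -> (6 <= m)%N.
Proof.
move=> p12 hD [_ [r0 [arc0 [g [K [[gc ginj rg grail] isoK Kg _]]]] [H [isoH Hrail Hr]]]].
move=> [a [b [ab rab]]].
have [K0 [K' [Kc _ KK]]] := isoK; have [H0 [H' [Hc _ HH]]] := isoH.
have gin := rail_arc_rails p12 arc0 ginj rg grail.
have revc : continuous (rev b2).
  by rewrite /rev; case: (b2) => /=; ctn.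
have rev01 (s : R) : 0 <= s <= 1 -> 0 <= rev b2 s <= 1.
  by rewrite /rev; case: (b2) => // /andP[? ?]; apply/andP; split; lra.
have revK : involutive (rev b2).
  by rewrite /rev => s; case: (b2) => //; ring.
(* Times and parameters are clamped to [0,1], which makes all maps globally
   continuous. *)
pose X (t s : R) := H (clamp t) (g (clamp (rev b2 s))).
pose f (t s : R) := flip b1 (K (1 - clamp t) (plane_proj (X t s))).
pose F (t s : R) := frame (f t 0) (f t 1) (f t s).
have K01 (t : R) : 0 <= 1 - clamp t <= 1.
  by have /andP[? ?] := clamp01 t; apply/andP; split; lra.
have Hinj (t : R) : injective (H (clamp t)).
  by apply: can_inj; exact: (HH _ (clamp01 t)).1.
have Kinj (t : R) : injective (K (1 - clamp t)).
  by apply: can_inj; exact: (KK _ (K01 t)).1.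
have finj (t : R) : forall z w, flip b1 (K (1 - clamp t) z) = flip b1 (K (1 - clamp t) w) -> z = w.
  by move=> z w /(can_inj (flipK b1)) /Kinj.
have Xrail (t : R) (p : 'rV[R]_2) x : p = p1 \/ p = p2 ->
    plane_proj (H (clamp t) x) = p <-> plane_proj x = p.
  have [h1 h2] := Hrail _ (clamp01 t).
  have aux q : H (clamp t) @` rail q = rail q -> plane_proj (H (clamp t) x) = q <-> plane_proj x = q.
    move=> hq; split=> e.
      have : rail q (H (clamp t) x) by [].
      by rewrite -hq => -[y yq /Hinj <-].
    have : (H (clamp t) @` rail q) (H (clamp t) x) by exists x.
    by rewrite hq.
  by case=> ->; apply: aux.
have f01 (t : R) : f t 0 != f t 1.
  apply/eqP => /finj; rewrite /X.
  have -> : clamp (rev b2 0) = rev b2 0 by apply/clamp_id/rev01; rewrite lexx ler01.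
  have -> : clamp (rev b2 1) = rev b2 1 by apply/clamp_id/rev01; rewrite lexx ler01.
  case: grail => g0 g1.
  have e1 : plane_proj (H (clamp t) (g 0)) = p1 by apply/Xrail; [left|].
  have e2 : plane_proj (H (clamp t) (g 1)) = p2 by apply/Xrail; [right|].
  rewrite /rev; case: (b2); rewrite ?subr0 ?subrr e1 e2 => e.
    by move: p12; rewrite e eqxx.
  by move: p12; rewrite e eqxx.
have clampc : continuous (fun z : R * R => clamp z.1).
  by apply: continuous_compose; [ctn|exact: clamp_continuous].
have Xc : continuous (fun z : R * R => X z.1 z.2).
  pose row (z : R * R) : 'rV[R]_(2 + 1 + 1) :=
    row_mx (g (clamp (rev b2 z.2))) (clamp z.1)%:M.
  have -> : (fun z : R * R => X z.1 z.2) = fun z => H (rsubmx (row z) 0 0) (lsubmx (row z)).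
    by apply/funext => z; rewrite /row row_mxKr row_mxKl mxE eqxx.
  apply: (continuous_within_comp (PL_on_continuous Hc)); last first.
    by move=> z; rewrite /= /row row_mxKr mxE eqxx; exact: clamp01.
  apply: continuous_row => j; rewrite /row; under eq_fun do rewrite mxE.
  case: (fintype.split j) => k.
    apply: continuous_coord; apply: (continuous_within_comp gc).
      apply: continuous_compose; last exact: clamp_continuous.
      by apply: continuous_compose; [ctn|exact: revc].
    by move=> z; rewrite /= in_itv; exact: clamp01.
  have e : (fun z : R * R => ((clamp z.1)%:M : 'M[R]_1) 0 k) = (fun z => clamp z.1).
    by apply/funext => z; rewrite [k]ord1 mxE eqxx.
  rewrite [X in continuous X]e.
  exact: clampc.
have fc : continuous (fun z : R * R => f z.1 z.2).
  rewrite /f.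
  have c1 : continuous (fun z : R * R => K (1 - clamp z.1) (plane_proj (X z.1 z.2))).
    pose h (z : R * R) := (1 - clamp z.1, plane_proj (X z.1 z.2)).
    have -> : (fun z : R * R => K (1 - clamp z.1) (plane_proj (X z.1 z.2))) =
      (fun z => K (h z).1 (h z).2) by [].
    apply: (continuous_within_comp Kc); last by move=> z; exact: K01.
    apply: continuous_pair_fun; first by ctn.
    exact: (continuous_compose Xc plane_proj_continuous).
  apply: continuous_plane_point; first exact: continuous_coord.
  by apply: continuous_mul; [exact: continuous_cst_fun|exact: continuous_coord].
have fce (e : R) : continuous (fun z : R * R => f z.1 e).
  have hc : continuous (fun z : R * R => (z.1, e)).
    by apply: continuous_pair_fun; [ctn|move=> z; exact: cvg_cst].
  exact: (continuous_compose hc fc).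
have f01' (z : R * R) : f z.1 0 != f z.1 1 by exact: f01.
have Fc : continuous (fun z : R * R => F z.1 z.2).
  exact: (continuous_frame f01' (fce 0) (fce 1) fc).
have i0 : 0 <= (0 : R) <= 1 by rewrite lexx ler01.
have i1 : 0 <= (1 : R) <= 1 by rewrite lexx ler01.
have fcurve (s : R) : 0 <= s <= 1 -> f 0 s = curve_c s.
  move=> s01; rewrite /f /X !clamp_id //; last exact: rev01.
  by rewrite subr0 H0 Kg ?hD //; exact: rev01.
have [n [s [s01 smono changes]]] : exists n (s : nat -> R),
  [/\ forall j, (j <= n)%N -> 0 < s j < 1,
      forall j, (j < n)%N -> s j <= s j.+1
    & (4 <= \sum_(j < n) (upper (F 1%R (s j)) != upper (F 1%R (s j.+1))))%N].
  apply: homotopy_side_changes.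
  - exact: Fc.
  - by move=> t _; exact: frame_tail.
  - by move=> t _; exact: frame_head.
  - move=> t s t01 s01; rewrite -(frame_tail (f01 t)) -(frame_head (f01 t)).
    have rs : 0 < rev b2 s < 1.
      by rewrite /rev; case: (b2) => //; move/andP: s01 => [? ?]; apply/andP; split; lra.
    have [n1 n2] := gin _ rs.
    have rs' : clamp (rev b2 s) = rev b2 s.
      by apply: clamp_id; move/andP: rs => [? ?]; rewrite !ltW.
    have far (e : R) : rev b2 e = 0 \/ rev b2 e = 1 -> f t s <> f t e.
      move=> he /finj; rewrite /X rs'.
      case: he => ->; rewrite ?(clamp_id i0) ?(clamp_id i1).
        rewrite (iffRL (Xrail t p1 (g 0) (or_introl erefl)) grail.1).
        by move/(Xrail t p1 _ (or_introl erefl)).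
      rewrite (iffRL (Xrail t p2 (g 1) (or_intror erefl)) grail.2).
      by move/(Xrail t p2 _ (or_intror erefl)).
    split; move=> /(frame_inj (f01 t)); apply: far; rewrite /rev; case: (b2);
      rewrite ?subr0 ?subrr; by [left|right].
  - by move=> s s01; rewrite /F !fcurve // curve_c0 curve_c1 frame_std.
pose Y x := frame (f 1 0) (f 1 1) (flip b1 (plane_proj x)) 0 1.
have YF (u : R) : Y (X 1 u) = F 1 u 0 1.
  have f1E : f 1 u = flip b1 (plane_proj (X 1 u)) by rewrite /f (clamp_id i1) subrr K0.
  by rewrite /Y /F f1E.
have X1E (u : R) : u \in `[0, 1] -> X 1 u = H 1 (g (rev b2 u)).
  by rewrite in_itv /= => u01; rewrite /X !clamp_id //; exact: rev01.
have revI (u : R) : u \in `[0, 1] -> rev b2 u \in `[0, 1].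
  by rewrite !in_itv /=; exact: rev01.
have X1c : {within `[0, 1], continuous (X 1)}.
  apply: continuous_subspaceT.
  have hc : continuous (fun u : R => ((1 : R), u)).
    by apply: continuous_pair_fun; ctn.
  exact: (continuous_compose hc Xc).
have X1inj : {in `[0, 1] &, injective (X 1)}.
  move=> u v iu iv; rewrite !X1E //.
  have -> : H 1 = H (clamp 1) by rewrite (clamp_id i1).
  by move=> /Hinj /ginj e; apply: (can_inj revK); apply: e; exact: revI.
have X1r : X 1 @` `[0, 1] = \bigcup_i stick (a i) (b i).
  rewrite -rab -Hr rg; apply/seteqP; split=> _ [u iu <-].
    rewrite X1E //; exists (g (rev b2 u)) => //.
    by exists (rev b2 u) => //; exact: revI.
  case: iu => v iv <-; exists (rev b2 v); first exact: revI.
  by rewrite X1E ?revK //; exact: revI.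
have side : (\sum_(j < n) ((0 <= Y (X 1 (s j)))%R != (0 <= Y (X 1 (s j.+1)))%R))%N =
    (\sum_(j < n) (upper (F 1%R (s j)) != upper (F 1%R (s j.+1))))%N.
  by apply: eq_bigr => j _; rewrite !YF.
have Yaff (t : R) (u v : 'rV[R]_(2 + 1)) :
    Y ((1 - t) *: u + t *: v) = (1 - t) * Y u + t * Y v.
  rewrite /Y; have -> : plane_proj ((1 - t) *: u + t *: v) =
      (1 - t) *: plane_proj u + t *: plane_proj v.
    by apply/rowP => j; rewrite !mxE.
  by rewrite frame_affine.
have Y0 : Y (X 1 0) = 0 by rewrite YF /F frame_tail ?plane_point1.
have Y1 : Y (X 1 1) = 0 by rewrite YF /F frame_head ?plane_point1.
have := @sticks_ge_side_changes R (X 1) m a b X1c X1inj ab X1r Y Yaff Y0 Y1 s n s01 smono.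
rewrite /= side => ge.
apply: leq_trans (ge (leq_trans (isT : (0 < 4)%N) changes)).
exact: (leq_add changes (leqnn 2)).
Qed.
End Lower.

(** * Ambient isotopies of the plane *)

Section Isotopy.
Variable R : realType.
Local Notation P := 'rV[R]_2.
Implicit Types K L : P -> P.

Definition jointly_continuous (H : R -> P -> P) :=
  continuous (fun z : R * P => H z.1 z.2).

(** An end of an ambient isotopy.  Times range over the whole line, so that
    continuity is not relative to a subspace and compositions are immediate. *)
Definition deformation K : Prop := exists H G : R -> P -> P,
  [/\ jointly_continuous H, jointly_continuous G, forall x, H 0 x = x,
      forall x, H 1 x = K x & forall t : R, cancel (H t) (G t) /\ cancel (G t) (H t)].

Lemma deformation_comp K L : deformation K -> deformation L -> deformation (K \o L).
Proof.
move=> [H [G [Hc Gc H0 H1 HG]]] [H' [G' [Hc' Gc' H0' H1' HG']]].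
exists (fun t x => H t (H' t x)), (fun t x => G' t (G t x)).
have c1 : continuous (fun z : R * P => z.1) by ctn.
split=> [|| x | x | t]; first 2 last.
- by rewrite /= H0' H0.
- by rewrite /= H1' H1.
- have [h1 h2] := HG t; have [h1' h2'] := HG' t.
  by split=> x; [rewrite h1 h1'|rewrite h2' h2].
- exact: (continuous_compose (continuous_pair_fun c1 Hc') Hc).
- exact: (continuous_compose (continuous_pair_fun c1 Gc) Gc').
Qed.

Lemma deformation_inv K L : cancel K L -> cancel L K -> deformation K -> deformation L.
Proof.
move=> KL LK [H [G [Hc Gc H0 H1 HG]]]; exists G, H; split=> // [x|x|t].
- by rewrite -[x in LHS]H0 (HG 0).1.
- by rewrite -[x in LHS]LK -H1 (HG 1).1.
- by have [? ?] := HG t.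
Qed.

Lemma deformation_ambient K : deformation K -> exists H,
  ambient_isotopy (@continuous_track R 2) H /\ forall x, H 1 x = K x.
Proof.
move=> [H [G [Hc Gc H0 H1 HG]]]; exists H; split=> //; split=> //.
by exists G; split=> [||t _] //; exact: continuous_subspaceT.
Qed.

Definition shear_x (f : R -> R) (z : P) : P := plane_point (z 0 0 + f (z 0 1)) (z 0 1).
Definition shear_y (f : R -> R) (z : P) : P := plane_point (z 0 0) (z 0 1 + f (z 0 0)).

Lemma shear_xK f : cancel (shear_x f) (shear_x (fun y => - f y)).
Proof.
by move=> z; rewrite [RHS]plane_pointE /shear_x !(plane_point0, plane_point1) addrK.
Qed.

Lemma shear_yK f : cancel (shear_y f) (shear_y (fun y => - f y)).
Proof.
by move=> z; rewrite [RHS]plane_pointE /shear_y !(plane_point0, plane_point1) addrK.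
Qed.

Lemma shear_x_continuous (f : R -> R) : continuous f ->
  jointly_continuous (fun t => shear_x (fun y => t * f y)).
Proof.
move=> fc; have c2 : continuous (fun z : R * P => z.2) by ctn.
rewrite /jointly_continuous /shear_x; apply: continuous_plane_point; ctn.
have c21 : continuous (fun z : R * P => z.2 0 1) by ctn.
exact: (continuous_compose c21 fc).
Qed.

Lemma shear_y_continuous (f : R -> R) : continuous f ->
  jointly_continuous (fun t => shear_y (fun y => t * f y)).
Proof.
move=> fc; have c2 : continuous (fun z : R * P => z.2) by ctn.
rewrite /jointly_continuous /shear_y; apply: continuous_plane_point; ctn.
have c20 : continuous (fun z : R * P => z.2 0 0) by ctn.
exact: (continuous_compose c20 fc).
Qed.

Lemma deformation_shear_x (f : R -> R) : continuous f -> deformation (shear_x f).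
Proof.
move=> fc; have fcN : continuous (fun y => - f y) by exact: continuous_opp.
exists (fun t => shear_x (fun y => t * f y)), (fun t => shear_x (fun y => t * - f y)).
split.
- exact: shear_x_continuous.
- exact: shear_x_continuous.
- by move=> x; rewrite [RHS]plane_pointE /shear_x mul0r addr0.
- by move=> x; rewrite /shear_x mul1r.
- move=> t; have e : (fun y => t * - f y) = fun y => - (t * f y) by apply/funext => y; rewrite mulrN.
  split; first by rewrite e; exact: shear_xK.
  have -> : (fun y => t * f y) = fun y => - (t * - f y) by apply/funext => y; rewrite mulrN opprK.
  exact: shear_xK.
Qed.

Lemma deformation_shear_y (f : R -> R) : continuous f -> deformation (shear_y f).
Proof.
move=> fc; have fcN : continuous (fun y => - f y) by exact: continuous_opp.
exists (fun t => shear_y (fun y => t * f y)), (fun t => shear_y (fun y => t * - f y)).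
split.
- exact: shear_y_continuous.
- exact: shear_y_continuous.
- by move=> x; rewrite [RHS]plane_pointE /shear_y mul0r addr0.
- by move=> x; rewrite /shear_y mul1r.
- move=> t; have e : (fun y => t * - f y) = fun y => - (t * f y) by apply/funext => y; rewrite mulrN.
  split; first by rewrite e; exact: shear_yK.
  have -> : (fun y => t * f y) = fun y => - (t * - f y) by apply/funext => y; rewrite mulrN opprK.
  exact: shear_yK.
Qed.
End Isotopy.

(** * Piecewise linear maps of the half-line *)

Section PLMap.
Variable R : realType.
Implicit Types (k r : R) (l : seq (R * R)).

(** The homeomorphism of the half-line that maps consecutive pieces of lengths p
    onto pieces of lengths q, for (p, q) in l, and has slope k afterwards. *)
Fixpoint pl k l r : R :=
  if l is (p, q) :: l' then q / p * Num.min r p + pl k l' (Num.max (r - p) 0) else k * r.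

Definition swap_pieces l := [seq (pq.2, pq.1) | pq <- l].

Definition positive_pieces l := all (fun pq : R * R => (0 < pq.1) && (0 < pq.2)) l.

Lemma positive_cons p q l : positive_pieces ((p, q) :: l) =
  (0 < p) && (0 < q) && positive_pieces l.
Proof. by []. Qed.

Lemma pl0 k l : positive_pieces l -> pl k l 0 = 0.
Proof.
elim: l => [|[p q] l IH] /=; first by rewrite mulr0.
move=> /andP[/andP[p0 q0] /IH e].
by rewrite sub0r max_r ?oppr_le0 ?ltW // e min_l ?ltW // mulr0 addr0.
Qed.

Lemma pl_first k p q l r : positive_pieces ((p, q) :: l) -> r <= p ->
  pl k ((p, q) :: l) r = q / p * r.
Proof.
move=> /= /andP[_ pl_] rp; rewrite min_l // max_r ?subr_le0 // pl0 // addr0 //.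
Qed.

Lemma pl_next k p q l r : positive_pieces ((p, q) :: l) -> p <= r ->
  pl k ((p, q) :: l) r = q + pl k l (r - p).
Proof.
move=> /= /andP[/andP[p0 _] _] pr; rewrite min_r // max_l ?subr_ge0 // divfK ?gt_eqF //.
Qed.

Lemma pl_ge0 k l r : 0 < k -> positive_pieces l -> 0 <= r -> 0 <= pl k l r.
Proof.
move=> k0; elim: l r => [|[p q] l IH] r; first by move=> _ r0; rewrite /= mulr_ge0 // ltW.
move=> h r0; have /= /andP[/andP[p0 q0] hl] := h.
apply: addr_ge0; first by rewrite mulr_ge0 ?divr_ge0 ?le_min ?r0 //= ltW.
by apply: IH => //; rewrite le_max lexx orbT.
Qed.

Lemma positive_swap l : positive_pieces l -> positive_pieces (swap_pieces l).
Proof. by rewrite /positive_pieces all_map; apply: sub_all => -[p q] /= /andP[-> ->]. Qed.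

Lemma swapK l : swap_pieces (swap_pieces l) = l.
Proof. by rewrite /swap_pieces -map_comp map_id_in // => -[]. Qed.

(** Exchanging the lengths p and q and inverting the last slope gives the inverse. *)
Lemma plK k l r : 0 < k -> positive_pieces l -> 0 <= r ->
  pl k^-1 (swap_pieces l) (pl k l r) = r.
Proof.
move=> k0; elim: l r => [|[p q] l IH] r; first by move=> _ _; rewrite /= mulKf ?gt_eqF.
have sE : swap_pieces ((p, q) :: l) = (q, p) :: swap_pieces l by [].
move=> h r0; have h' := positive_swap h; rewrite sE in h' *.
move: (h); rewrite positive_cons => /andP[/andP[p0 q0] hl].
have [rp|pr] := leP r p.
  have le : q / p * r <= q by rewrite mulrAC ler_pdivrMr // ler_pM2l.
  rewrite (pl_first k h rp) (pl_first _ h' le).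
  by field; rewrite !gt_eqF.
have rp0 : 0 <= r - p by rewrite subr_ge0 ltW.
have ge : q <= q + pl k l (r - p) by rewrite lerDl pl_ge0.
rewrite (pl_next k h (ltW pr)) (pl_next _ h' ge).
by rewrite addrAC subrr add0r IH // addrC subrK.
Qed.

Lemma pl_le k l r r' : 0 < k -> positive_pieces l -> r <= r' -> pl k l r <= pl k l r'.
Proof.
move=> k0; elim: l r r' => [|[p q] l IH] r r'; first by move=> _ /=; rewrite ler_pM2l.
move=> /= /andP[/andP[p0 q0] hl] rr; apply: lerD.
  by rewrite ler_pM2l ?divr_gt0 // le_min ge_min rr /= ge_min lexx orbT.
by apply: IH => //; rewrite ge_max !le_max lexx orbT andbT lerB // ?lexx.
Qed.

(** In terms of minima and maxima the formula stays continuous when the lengths of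
    the pieces vary. *)
Lemma continuous_pl (T : topologicalType) (k : T -> R) (l : T -> seq (R * R)) (r : T -> R)
    (n : nat) (p q : nat -> T -> R) :
  (forall x, l x = [seq (p i x, q i x) | i <- iota 0 n]) ->
  (forall i x, (i < n)%N -> p i x != 0) ->
  (forall i, (i < n)%N -> continuous (p i)) -> (forall i, (i < n)%N -> continuous (q i)) ->
  continuous k -> continuous r -> continuous (fun x => pl (k x) (l x) (r x)).
Proof.
move=> lE p0 pc qc kc rc.
have -> : (fun x => pl (k x) (l x) (r x)) =
  (fun x => pl (k x) [seq (p i x, q i x) | i <- iota 0 n] (r x)).
  by apply/funext => x; rewrite lE.
have : {subset iota 0 n <= [pred i | (i < n)%N]} by move=> i; rewrite mem_iota.
elim: (iota 0 n) r rc {lE} => [|i s IH] r rc hs /=; first exact: continuous_mul.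
have hi : (i < n)%N by apply: hs; rewrite mem_head.
apply: continuous_add.
  apply: continuous_mul; last by apply: continuous_minr => //; exact: pc.
  by apply: continuous_mul; [exact: qc|apply: continuous_inv => [x|]; [exact: p0|exact: pc]].
apply: (IH (fun x => Num.max (r x - p i x) 0)).
  apply: continuous_maxr; last exact: continuous_cst_fun.
  by apply: continuous_add => //; apply: continuous_opp; exact: pc.
by move=> m hm; apply: hs; rewrite inE hm orbT.
Qed.
End PLMap.

Section PLMerge.
Variable R : realType.
Implicit Types (k r : R) (l : seq (R * R)).

(** Adjacent pieces of equal slope form one piece; likewise a last piece of the
    final slope can be dropped, by [pl_absorb]. *)
Lemma pl_merge k p q p' q' l r : positive_pieces [:: (p, q), (p', q') & l] ->
  q * p' = q' * p -> 0 <= r ->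
  pl k [:: (p, q), (p', q') & l] r = pl k ((p + p', q + q') :: l) r.
Proof.
move=> h e r0; move: (h); rewrite !positive_cons => /andP[/andP[p0 q0] /andP[/andP[p0' q0'] hl]].
have h' : positive_pieces ((p', q') :: l) by rewrite positive_cons p0' q0'.
have h2 : positive_pieces ((p + p', q + q') :: l) by rewrite positive_cons !addr_gt0.
have n1 : p != 0 by rewrite gt_eqF.
have n2 : p' != 0 by rewrite gt_eqF.
have n3 : p + p' != 0 by rewrite gt_eqF ?addr_gt0.
have e1 : q / p = (q + q') / (p + p').
  by apply/eqP; rewrite eqr_div // mulrDr mulrDl e.
have e2 : q' / p' = (q + q') / (p + p').
  by apply/eqP; rewrite eqr_div // mulrDr mulrDl e.
have [rp|pr] := leP r p.
  have rpp : r <= p + p' by lra.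
  by rewrite (pl_first k h rp) (pl_first k h2 rpp) e1.
rewrite (pl_next k h (ltW pr)).
have [rp'|pr'] := leP r (p + p').
  have rpp : r - p <= p' by lra.
  rewrite (pl_first k h' rpp) (pl_first k h2 rp') -e1 e2 -e1.
  by field.
have rpp : p' <= r - p by lra.
rewrite (pl_next k h' rpp) (pl_next k h2 (ltW pr')).
by rewrite addrA; congr (_ + pl _ _ _); ring.
Qed.

Lemma pl_absorb k p q r : 0 < p -> q = k * p -> 0 <= r -> pl k [:: (p, q)] r = k * r.
Proof.
move=> p0 -> r0; rewrite /= mulfK ?gt_eqF // -mulrDr; congr (_ * _).
case: (leP r p) => rp; first by rewrite max_r ?subr_le0 // addr0.
by rewrite max_l ?subr_ge0 ?ltW //; ring.
Qed.

Lemma pl_congr k p q l l' r : (forall u, 0 <= u -> pl k l u = pl k l' u) ->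
  pl k ((p, q) :: l) r = pl k ((p, q) :: l') r.
Proof. by move=> h /=; rewrite h // le_max lexx orbT. Qed.
End PLMerge.

(** * Polar coordinates and radial maps *)

Section Glue.
Variables (R : realType) (T : topologicalType).

Lemma continuous_glue (y a b : T -> R) : continuous y -> continuous a -> continuous b ->
  (forall x, y x = 0 -> a x = b x) -> continuous (fun x => if 0 <= y x then a x else b x).
Proof.
move=> yc ac bc ab; apply/continuous_subspace_setT.
have -> : setT = [set x | 0 <= y x] `|` [set x | y x <= 0].
  by apply/seteqP; split=> x _ //=; case: (leP 0 (y x)) => h; [left|right; exact: ltW].
have cA : closed [set x | 0 <= y x].
  by apply: (@closed_comp _ _ y [set u | 0 <= u]) => [x _|]; [exact: yc|exact: closed_ge].
have cB : closed [set x | y x <= 0].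
  by apply: (@closed_comp _ _ y [set u | u <= 0]) => [x _|]; [exact: yc|exact: closed_le].
apply: withinU_continuous => //.
  apply: (@subspace_eq_continuous _ _ _ a); last exact: continuous_subspaceT.
  by move=> x; rewrite inE /from_subspace /= => ->.
apply: (@subspace_eq_continuous _ _ _ b); last exact: continuous_subspaceT.
move=> x; rewrite inE /from_subspace /= => y0; case: ifPn => // y1.
by rewrite ab //; apply/eqP; rewrite eq_le y0 y1.
Qed.

End Glue.

Section Angle.
Variable R : realType.
Local Notation P := 'rV[R]_2.
Implicit Types (z : P) (r v t c : R) (b : bool) (f : bool -> R -> R -> R).

Lemma continuous_acos_on : {within `[(-1), (1 : R)], continuous (@acos R)}.
Proof.
have := @segment_can_ge_continuous R 0 pi cos acos (pi_ge0 R).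
rewrite cos0 cospi; apply; last by exact: cosK.
by apply: continuous_subspaceT => x; exact: continuous_cos.
Qed.

Definition rad (z : P) : R := Num.sqrt (z 0 0 * z 0 0 + z 0 1 * z 0 1).

(** On the disk of this radius the radial maps are the identity, which avoids the
    singularity of polar coordinates; the radius is smaller than every [target]. *)
Definition core : R := 1 / 10.
Definition crad (z : P) : R := Num.max core (rad z).

(** In units of pi, and without orientation: the half-plane supplies the sign.  Using
    [crad] in place of the radius makes it continuous at the origin. *)
Definition ang (z : P) : R := acos (z 0 0 / crad z) / pi.

Lemma rad_ge0 z : 0 <= rad z. Proof. exact: sqrtr_ge0. Qed.

Lemma rad_sqr z : rad z * rad z = z 0 0 * z 0 0 + z 0 1 * z 0 1.
Proof. by rewrite -expr2 sqr_sqrtr // -!expr2 addr_ge0 ?sqr_ge0. Qed.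

Lemma radZ c z : 0 <= c -> rad (c *: z) = c * rad z.
Proof.
move=> c0; rewrite /rad !mxE.
have -> : c * z 0 0 * (c * z 0 0) + c * z 0 1 * (c * z 0 1) =
  c ^+ 2 * (z 0 0 * z 0 0 + z 0 1 * z 0 1) by ring.
by rewrite sqrtrM ?sqr_ge0 // sqrtr_sqr ger0_norm.
Qed.

Lemma core_gt0 : 0 < core. Proof. by rewrite /core; lra. Qed.

Lemma crad_gt0 z : 0 < crad z.
Proof. by rewrite lt_max core_gt0. Qed.

Lemma crad_neq0 z : crad z != 0.
Proof. by rewrite gt_eqF // crad_gt0. Qed.

Lemma abscissa_crad z : -1 <= z 0 0 / crad z <= 1.
Proof.
have c0 := crad_gt0 z.
rewrite ler_pdivlMr // ler_pdivrMr // mulN1r mul1r -ler_norml.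
apply: le_trans (_ : rad z <= _); last by rewrite le_max lexx orbT.
rewrite -(@ler_pXn2r _ 2) ?nnegrE ?rad_ge0 //.
by rewrite real_normK ?num_real // [leRHS]expr2 rad_sqr -!expr2 lerDl sqr_ge0.
Qed.

Lemma ang01 z : 0 <= ang z <= 1.
Proof.
have p0 := pi_gt0 R; have h := abscissa_crad z.
by rewrite /ang divr_ge0 ?acos_ge0 ?pi_ge0 //= ler_pdivrMr // mul1r acos_lepi.
Qed.

Lemma cos_ang z : cos (pi * ang z) = z 0 0 / crad z.
Proof.
rewrite /ang mulrCA mulfV ?gt_eqF ?pi_gt0 // mulr1 acosK // in_itv /=.
exact: abscissa_crad.
Qed.

Lemma sin_ang z : core <= rad z -> sin (pi * ang z) = `|z 0 1| / rad z.
Proof.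
move=> h; have r0 : 0 < rad z := lt_le_trans core_gt0 h.
have s0 : 0 <= sin (pi * ang z).
  apply: sin_ge0_pi; have p0 := pi_gt0 R; have /andP[? ?] := ang01 z.
  by apply/andP; split; nra.
apply/eqP; rewrite -(@eqrXn2 _ 2) ?divr_ge0 ?rad_ge0 //; apply/eqP.
rewrite sin2cos2 cos_ang /crad max_r // !expr_div_n real_normK ?num_real //.
have e : rad z ^+ 2 = z 0 0 ^+ 2 + z 0 1 ^+ 2 by rewrite !expr2 rad_sqr.
have n0 : rad z ^+ 2 != 0 by rewrite expf_neq0 // gt_eqF.
by apply: (mulIf n0); rewrite mulrBl !divfK // mul1r e; ring.
Qed.

Lemma polar z : core <= rad z ->
  z = rad z *: plane_point (cos (pi * ang z))
        (if 0 <= z 0 1 then sin (pi * ang z) else - sin (pi * ang z)).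
Proof.
move=> h; have r0 : 0 < rad z := lt_le_trans core_gt0 h.
rewrite cos_ang sin_ang // /crad max_r //; apply/rowP => i; rewrite !mxE.
case: i => [[|[|//]] i] /=.
  by rewrite mulrCA mulfV ?gt_eqF // mulr1; congr (z _ _); apply/val_inj.
have -> : Ordinal i = 1 by apply/val_inj.
case: ifPn => y0; first by rewrite ger0_norm // mulrCA mulfV ?gt_eqF // mulr1.
by rewrite ler0_norm ?ltW ?ltNge // -mulNr opprK mulrCA mulfV ?gt_eqF // mulr1.
Qed.

Lemma rad_polar (c t : R) b : 0 <= c ->
  rad (c *: plane_point (cos t) (if b then sin t else - sin t)) = c.
Proof.
move=> c0; rewrite radZ // /rad plane_point0 plane_point1.
have -> : cos t * cos t + (if b then sin t else - sin t) * (if b then sin t else - sin t) = 1.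
  by rewrite -(cos2Dsin2 t); case: b; ring.
by rewrite sqrtr1 mulr1.
Qed.

Lemma ang_polar (c v : R) b : core <= c -> 0 <= v <= 1 ->
  ang (c *: plane_point (cos (pi * v)) (if b then sin (pi * v) else - sin (pi * v))) = v.
Proof.
move=> hc v01; have c0 : 0 < c := lt_le_trans core_gt0 hc.
rewrite /ang /crad rad_polar ?(ltW c0) // max_r // mxE plane_point0 [c * _]mulrC mulfK ?gt_eqF //.
have p0 := pi_gt0 R.
rewrite cosK; first by rewrite [pi * _]mulrC mulfK ?gt_eqF.
by rewrite in_itv /=; move/andP: v01 => [? ?]; apply/andP; split; nra.
Qed.

Lemma continuous_rad : continuous rad.
Proof.
have c : continuous (fun z : P => z) by ctn.
have h : continuous (fun z : P => z 0 0 * z 0 0 + z 0 1 * z 0 1) by ctn.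
exact: (continuous_compose h (@sqrt_continuous R)).
Qed.

Lemma continuous_crad : continuous crad.
Proof. by rewrite /crad; have c := continuous_rad; ctn. Qed.

Lemma continuous_ang : continuous ang.
Proof.
have c : continuous (fun z : P => z) by ctn.
apply: continuous_mul; last exact: continuous_cst_fun.
have h : continuous (fun z : P => z 0 0 / crad z).
  apply: continuous_mul; first by ctn.
  by apply: continuous_inv; [exact: crad_neq0|exact: continuous_crad].
apply: (continuous_within_comp continuous_acos_on h) => z.
by rewrite /= in_itv; exact: abscissa_crad.
Qed.

(** The profile f gives, for each half-plane and each angle, the new distance to the
    core as a function of the old one. *)
Definition radial (f : bool -> R -> R -> R) (z : P) : P :=
  ((core + f (0 <= z 0 1)%R (ang z) (Num.max (rad z - core) 0)) / crad z) *: z.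

Definition radial_profile (f : bool -> R -> R -> R) :=
  forall b v, 0 <= v <= 1 -> f b v 0 = 0 /\ forall r, 0 <= r -> 0 <= f b v r.

Lemma radial_core f z : radial_profile f -> rad z <= core -> radial f z = z.
Proof.
move=> hf h; rewrite /radial max_r ?subr_le0 // (hf _ _ (ang01 z)).1 addr0.
by rewrite /crad max_l // mulfV ?gt_eqF ?core_gt0 // scale1r.
Qed.

(** On the axis the profile of the upper half-plane is used, whence the condition on
    the angle for the lower one. *)
Lemma radial_polar f (r v : R) b : core <= r -> 0 <= v <= 1 ->
  (b = false -> 0 < v < 1) ->
  radial f (r *: plane_point (cos (pi * v)) (if b then sin (pi * v) else - sin (pi * v))) =
  (core + f b v (r - core)) *:
     plane_point (cos (pi * v)) (if b then sin (pi * v) else - sin (pi * v)).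
Proof.
move=> hr v01 hb; have r0 : 0 < r := lt_le_trans core_gt0 hr.
rewrite /radial ang_polar // /crad rad_polar ?(ltW r0) // max_l ?subr_ge0 // max_r //.
rewrite scalerA divfK ?gt_eqF //; congr ((_ + f _ _ _) *: _).
rewrite mxE plane_point1 pmulr_rge0 //.
have p0 := pi_gt0 R; move: v01 hb => /andP[v0 v1].
case: b => [_|/(_ erefl) /andP[v0' v1']]; first by apply: sin_ge0_pi; apply/andP; split; nra.
rewrite oppr_ge0 leNgt sin_gt0_pi //; apply/andP; split; nra.
Qed.

Lemma radialK f f' : radial_profile f -> radial_profile f' ->
  (forall b v r, 0 <= v <= 1 -> 0 <= r -> f' b v (f b v r) = r) ->
  cancel (radial f) (radial f').
Proof.
move=> hf hf' ff' z; have [h|h] := leP (rad z) core.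
  by rewrite (radial_core hf h) (radial_core hf' h).
pose c := (core + f (0 <= z 0 1) (ang z) (rad z - core)) / rad z.
have rz : 0 < rad z := lt_trans core_gt0 h.
have f0 : 0 <= f (0 <= z 0 1) (ang z) (rad z - core).
  by apply: (hf _ _ (ang01 z)).2; rewrite subr_ge0 ltW.
have c0 : 0 < c by rewrite divr_gt0 // ltr_pwDl // core_gt0.
have crz : crad z = rad z by rewrite /crad max_r // ltW.
have mz : Num.max (rad z - core) 0 = rad z - core by rewrite max_l // subr_ge0 ltW.
have E : radial f z = c *: z by rewrite /radial mz crz.
have rE : rad (c *: z) = core + f (0 <= z 0 1) (ang z) (rad z - core).
  by rewrite radZ ?(ltW c0) // /c divfK ?gt_eqF.
have aE : ang (c *: z) = ang z.
  rewrite /ang crz /crad max_r; last by rewrite rE lerDl.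
  by rewrite radZ ?(ltW c0) // mxE -mulf_div mulfV ?gt_eqF // mul1r.
have bE : (0 <= (c *: z) 0 1) = (0 <= z 0 1) by rewrite mxE pmulr_rge0.
have crE : crad (c *: z) = rad (c *: z) by rewrite /crad max_r // rE lerDl.
have r1 : rad (c *: z) != 0 by rewrite radZ ?(ltW c0) // mulf_neq0 ?gt_eqF.
rewrite E /radial aE bE crE max_l; last by rewrite rE addrAC subrr add0r.
have -> : rad (c *: z) - core = f (0 <= z 0 1) (ang z) (rad z - core).
  by rewrite rE addrAC subrr add0r.
rewrite ff' ?ang01 ?subr_ge0 ?(ltW h) // addrC subrK scalerA -[RHS]scale1r; congr (_ *: _).
by rewrite mulrAC [rad z * c]mulrC -radZ ?(ltW c0) // mulfV.
Qed.

(** The half-planes are glued along the axis, where the angle is 0 or pi: only there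
    do the two profiles have to agree. *)
Lemma continuous_radial (T : topologicalType) (f : T -> bool -> R -> R -> R) (z : T -> P) :
  (forall b, continuous (fun x => f x b (ang (z x)) (Num.max (rad (z x) - core) 0))) ->
  continuous z -> (forall x, radial_profile (f x)) ->
  (forall x v r, v = 0 \/ v = 1 -> 0 <= r -> f x true v r = f x false v r) ->
  continuous (fun x => radial (f x) (z x)).
Proof.
move=> fc zc fp ff; have cc := continuous_compose zc continuous_crad.
apply: continuous_row => j.
have -> : (fun x => radial (f x) (z x) 0 j) = (fun x =>
   (core + (if 0 <= z x 0 1 then f x true (ang (z x)) (Num.max (rad (z x) - core) 0)
     else f x false (ang (z x)) (Num.max (rad (z x) - core) 0))) / crad (z x) * z x 0 j).
  by apply/funext => x; rewrite /radial mxE; case: ifP.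
apply: continuous_mul; last by ctn.
apply: continuous_mul; last by apply: continuous_inv => // x; exact: crad_neq0.
apply: continuous_add; first exact: continuous_cst_fun.
apply: (@continuous_glue R T (fun x => z x 0 1)); [by ctn|exact: fc|exact: fc|] => x z0.
have [h|h] := leP (rad (z x)) core.
  by rewrite max_r ?subr_le0 // !(fp x _ _ (ang01 (z x))).1.
apply: ff; last by rewrite le_max lexx orbT.
have rz : rad (z x) = `|z x 0 0|.
  by rewrite /rad z0 mulr0 addr0 -expr2 sqrtr_sqr.
have n0 : 0 < `|z x 0 0| by rewrite -rz (lt_trans core_gt0).
rewrite /ang /crad max_r ?(ltW h) // rz.
case: (ltrgt0P (z x 0 0)) n0 => [p _|p _|->]; last by rewrite ltxx.
  by left; rewrite mulfV ?gt_eqF // acos1 mul0r.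
by right; rewrite invrN mulrN mulfV ?lt_eqF // acosN1 mulfV // gt_eqF // pi_gt0.
Qed.
End Angle.

(** * The polygonal spiral through its gauges *)

Section Gauges.
Variable R : realType.
Local Notation P := 'rV[R]_2.
Implicit Types (z : P) (x y r t v : R).

(** A composition of two shears.  It fixes the positive axis, turns the negative axis
    into the upward half-axis, and so maps the upper half-plane onto a quadrant. *)
Definition fold z : P :=
  plane_point (Num.max (z 0 0) 0 + z 0 1) (z 0 1 + Num.max (- z 0 0) 0).

Lemma foldE z : fold z = shear_x id (shear_y (fun x => Num.max (- x) 0) z).
Proof.
rewrite /fold /shear_x /shear_y !(plane_point0, plane_point1).
congr plane_point; rewrite addrCA addrC; congr (_ + _).
by case: (leP (z 0 0) 0) => h; [rewrite max_l|rewrite max_r]; lra.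
Qed.

Lemma deformation_fold : deformation fold.
Proof.
have -> : fold = shear_x id \o shear_y (fun x => Num.max (- x) 0).
  by apply/funext => z; rewrite foldE.
apply: deformation_comp; first by apply: deformation_shear_x; ctn.
by apply: deformation_shear_y; ctn.
Qed.

Lemma fold_inj : injective fold.
Proof.
move=> z w; rewrite !foldE => /(can_inj (@shear_xK R id)).
exact: (can_inj (@shear_yK R _)).
Qed.

Lemma foldZ r z : 0 <= r -> fold (r *: z) = r *: fold z.
Proof.
move=> r0; rewrite /fold; apply/rowP => i; rewrite !mxE.
have e0 : Num.max (r * z 0 0) 0 = r * Num.max (z 0 0) 0 by rewrite maxr_pMr // mulr0.
have e1 : Num.max (- (r * z 0 0)) 0 = r * Num.max (- z 0 0) 0.
  by rewrite maxr_pMr // mulr0 mulrN.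
by case: i => [[|[|//]] i] /=; rewrite ?e0 ?e1 mulrDr.
Qed.

(** The edges of the polygonal spiral that cross the first quadrant lie on the lines
    where these linear forms equal 1: through (1,0) and (0,2), through (3,0) and
    (0,60), through (10,0) and (0,2000).  Numerals are unary, so large ones are
    written as products. *)
Definition upper_gauge (j : nat) z : R :=
  match j with
  | 0 => z 0 0 + z 0 1 / 2
  | 1 => z 0 0 / 3 + z 0 1 / 60
  | _ => z 0 0 / 10 + z 0 1 / (20 * 100)
  end.

(** These forms equal 1 on the edges from (-1,4) to (6,-60) and from (-3,120) to
    (20,-2000). *)
Definition chord (j : nat) z : R :=
  if j is 0 then - (16 / 9) * z 0 0 - 7 / 36 * z 0 1
  else - (53 / 90) * z 0 0 - 23 / (60 * 60) * z 0 1.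

(** Outside the first quadrant a turn of the spiral is made of the end of an edge
    that leaves the quadrant, of a chord, and of the beginning of the next edge; it
    is the level set 1 of the maximum of the three forms.  The minima with 0 keep
    the continued edges from interfering on the wrong side of the quadrant. *)
Definition lower_gauge (j : nat) z : R :=
  Num.max (chord j z)
   (Num.max (upper_gauge j (plane_point (Num.min (z 0 0) 0) (z 0 1)))
            (upper_gauge j.+1 (plane_point (z 0 0) (Num.min (z 0 1) 0)))).

Lemma upper_gauge_order z : 0 <= z 0 0 -> 0 <= z 0 1 -> z != 0 ->
  [/\ 0 < upper_gauge 2 z, upper_gauge 2 z < upper_gauge 1 z
    & upper_gauge 1 z < upper_gauge 0 z].
Proof.
move=> x0 y0 z0; have : 0 < z 0 0 \/ 0 < z 0 1.
  move: x0 y0; rewrite !le_eqVlt => /predU1P[x0|->]; last by left.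
  move=> /predU1P[y0|->]; last by right.
  case/eqP: z0; rewrite [z]plane_pointE -x0 -y0; apply/rowP => i; rewrite !mxE.
  by case: i => [[|[|//]] i].
by rewrite /upper_gauge => h; case: h => h; split; lra.
Qed.

(** At every point of the three quadrants each form of the outer turn is smaller
    than one of the forms of the inner turn. *)
Lemma lower_gauge_order z : z 0 0 <= 0 \/ z 0 1 <= 0 -> z != 0 ->
  0 < lower_gauge 1 z /\ lower_gauge 1 z < lower_gauge 0 z.
Proof.
move=> h z0; have {z0} : z 0 0 <> 0 \/ z 0 1 <> 0.
  have [x0|/eqP x0] := eqVneq (z 0 0) 0; last by left.
  right=> y0; case/eqP: z0; rewrite [z]plane_pointE x0 y0; apply/rowP => i; rewrite !mxE.
  by case: i => [[|[|//]] i].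
rewrite /lower_gauge /chord /upper_gauge !(plane_point0, plane_point1).
move: h; move: (z 0 0) (z 0 1) => x y h n0.
rewrite !gt_max !lt_max.
case: (leP x 0) h => x0 h; case: (leP y 0) h => y0 h //=; last by exfalso; lra.
- have {n0} n0 : x < 0 \/ y < 0 by case: n0 => n0; [left|right]; lra.
  split; first by apply/orP; left; case: n0 => n0; lra.
  apply/and3P; split; apply/orP; left; case: n0 => n0; lra.
- split.
    have [c|c] := ltP 0 (- (53 / 90) * x - 23 / (60 * 60) * y) => //=.
    by apply/orP; left; lra.
  apply/and3P; split.
  + have [c|c] := ltP (- (53 / 90) * x - 23 / (60 * 60) * y) (- (16 / 9) * x - 7 / 36 * y) => //=.
    by apply/orP; left; lra.
  + have [c|c] := ltP (x / 3 + y / 60) (- (16 / 9) * x - 7 / 36 * y) => //=.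
    by apply/orP; left; lra.
  + have [c|c] := ltP (x / 10 + 0 / (20 * 100)) (- (16 / 9) * x - 7 / 36 * y) => //=.
    by apply/orP; left; lra.
- split.
    have [c|c] := ltP 0 (- (53 / 90) * x - 23 / (60 * 60) * y) => //=.
    by apply/orP; right; lra.
  apply/and3P; split.
  + have [c|c] := ltP (- (53 / 90) * x - 23 / (60 * 60) * y) (- (16 / 9) * x - 7 / 36 * y) => //=.
    by apply/orP; right; lra.
  + have [c|c] := ltP (0 / 3 + y / 60) (- (16 / 9) * x - 7 / 36 * y) => //=.
    by apply/orP; right; lra.
  + have [c|c] := ltP (x / 10 + y / (20 * 100)) (- (16 / 9) * x - 7 / 36 * y) => //=.
    by apply/orP; right; lra.
Qed.

Lemma gauge_bound z : `|z 0 0| <= 2 -> `|z 0 1| <= 2 ->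
  upper_gauge 0 z < 10 /\ lower_gauge 0 z < 10.
Proof.
rewrite !ler_norml => /andP[x0 x1] /andP[y0 y1].
rewrite /lower_gauge /chord /upper_gauge !(plane_point0, plane_point1) !gt_max.
split; first lra.
apply/and3P; split; first by lra.
  by case: (leP (z 0 0) 0) => h; lra.
by case: (leP (z 0 1) 0) => h; lra.
Qed.

End Gauges.

(** * Radial profiles *)

Section Profiles.
Variable R : realType.
Local Notation P := 'rV[R]_2.
Implicit Types (z : P) (x y r t v : R) (b : bool) (j : nat).

Definition unit_vector b v : P :=
  plane_point (cos (pi * v)) (if b then sin (pi * v) else - sin (pi * v)).

Lemma unit_vector_neq0 b v : fold (unit_vector b v) != 0.
Proof.
apply/eqP => e.
have : fold (unit_vector b v) = fold (0 *: unit_vector b v).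
  by rewrite foldZ // scale0r.
move/fold_inj; rewrite scale0r => {}e.
have := cos2Dsin2 (pi * v); have e0 := plane_point0 (cos (pi * v)) (if b then sin (pi * v) else - sin (pi * v)).
have e1 := plane_point1 (cos (pi * v)) (if b then sin (pi * v) else - sin (pi * v)).
move: e0 e1; rewrite -/(unit_vector b v) e !mxE => <-; case: b {e} => e1.
  by rewrite -e1 expr0n /= add0r => /esym/eqP; rewrite oner_eq0.
have -> : sin (pi * v) = 0 by lra.
by rewrite expr0n /= add0r => /esym/eqP; rewrite oner_eq0.
Qed.

Lemma sin_pi_ge0 v : 0 <= v <= 1 -> 0 <= sin (pi * v).
Proof.
move=> /andP[v0 v1]; have p0 := pi_gt0 R.
by apply: sin_ge0_pi; apply/andP; split; nra.
Qed.

Lemma unit_vector_bound b v : 0 <= v <= 1 ->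
  `|fold (unit_vector b v) 0 0| <= 2 /\ `|fold (unit_vector b v) 0 1| <= 2.
Proof.
move=> _; rewrite /fold !(plane_point0, plane_point1).
have := cos_max (pi * v); have := sin_max (pi * v).
move: (cos _) (sin _) => c s; rewrite !ler_norml => /andP[s0 s1] /andP[c0 c1].
by case: (leP c 0) => h; [rewrite max_l ?oppr_ge0 //|rewrite max_r ?oppr_le0 ?(ltW h) //];
  case: b; split; apply/andP; split; lra.
Qed.

Lemma unit_vector_upper v : 0 <= v <= 1 ->
  0 <= fold (unit_vector true v) 0 0 /\ 0 <= fold (unit_vector true v) 0 1.
Proof.
move=> /sin_pi_ge0 s0; rewrite /fold !(plane_point0, plane_point1).
by split; apply: addr_ge0 => //; rewrite le_max lexx ?orbT.
Qed.

Lemma unit_vector_lower v : 0 <= v <= 1 ->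
  fold (unit_vector false v) 0 0 <= 0 \/ fold (unit_vector false v) 0 1 <= 0.
Proof.
move=> /sin_pi_ge0 s0; rewrite /fold !(plane_point0, plane_point1).
by case: (leP (cos (pi * v)) 0) => h; [left|right; rewrite max_r ?oppr_le0 ?(ltW h) //]; lra.
Qed.

(** The distance at which a ray in the folded plane should meet the polygon: gauges
    are homogeneous of degree 1. *)
Definition target b j v : R :=
  (if b then upper_gauge j (fold (unit_vector true v))
   else lower_gauge j (fold (unit_vector false v)))^-1.

Lemma gauge_pos b j v : 0 <= v <= 1 -> (j <= (if b then 2 else 1))%N ->
  0 < (if b then upper_gauge j (fold (unit_vector true v))
       else lower_gauge j (fold (unit_vector false v))).
Proof.
move=> v01; case: b.
  have [x0 y0] := unit_vector_upper v01.
  have [g2 g1 g0] := upper_gauge_order x0 y0 (unit_vector_neq0 true v).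
  by case: j => [|[|[|//]]] _ //; lra.
have [g1 g0] := lower_gauge_order (unit_vector_lower v01) (unit_vector_neq0 false v).
by case: j => [|[|//]] _ //; lra.
Qed.

Lemma target_order b v : 0 <= v <= 1 ->
  [/\ core R < target b 0 v, target b 0 v < target b 1 v
    & b -> target b 1 v < target b 2 v].
Proof.
move=> v01; have [x2 y2] := unit_vector_bound b v01.
have [b1 b2] := gauge_bound x2 y2.
have inv10 y : 0 < y -> y < 10 -> core R < y^-1.
  by move=> y0 y1; rewrite /core div1r ltf_pV2 ?posrE.
rewrite /target; case: b x2 y2 b1 b2 => x2 y2 b1 b2.
  have g0 := @gauge_pos true 0 v v01 isT.
  have g1 := @gauge_pos true 1 v v01 isT.
  have g2 := @gauge_pos true 2 v v01 isT.
  have [x0 y0] := unit_vector_upper v01.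
  have [_ l1 l0] := upper_gauge_order x0 y0 (unit_vector_neq0 true v).
  split; first exact: inv10.
    by rewrite ltf_pV2 ?posrE.
  by move=> _; rewrite ltf_pV2 ?posrE.
have g0 := @gauge_pos false 0 v v01 isT.
have g1 := @gauge_pos false 1 v v01 isT.
have [_ l0] := lower_gauge_order (unit_vector_lower v01) (unit_vector_neq0 false v).
split=> //; first exact: inv10.
by rewrite ltf_pV2 ?posrE.
Qed.

(** The spiral meets the ray at the distances [first_radius b v + 2 * j]. *)
Definition first_radius b v : R := if b then 1 + v else 3 - v.

Definition mix t x y : R := (1 - clamp t) * x + clamp t * y.

Lemma mix_gt0 t x y : 0 < x -> 0 < y -> 0 < mix t x y.
Proof.
rewrite /mix; have := clamp01 t; move: (clamp t) => c /andP[c0 c1] x0 y0.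
have [->|cn] := eqVneq c 0; first by rewrite subr0 mul1r mul0r addr0.
have c2 : 0 < c by rewrite lt_neqAle eq_sym cn c0.
by rewrite ltr_wpDl ?mulr_gt0 // mulr_ge0 ?(ltW x0) // subr_ge0.
Qed.

(** At time 1 the value 970 = (2000 - 60) / 2 continues the last piece of the upper
    profile on the negative axis, since the lower profile has one piece less. *)
Definition slope t : R := mix t 1 (10 * 97).

Definition source_piece b (i : nat) v : R := if i is 0 then first_radius b v - core R else 2.
Definition target_piece b (i : nat) v : R :=
  if i is i'.+1 then target b i v - target b i' v else target b 0 v - core R.

(** The pieces between consecutive turns of the spiral, deformed linearly from the
    identity at time 0 to the polygon at time 1. *)
Definition pieces t b v : seq (R * R) :=
  [seq (source_piece b i v, mix t (source_piece b i v) (target_piece b i v))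
  | i <- iota 0 (if b then 3 else 2)].

Lemma source_piece_gt0 b i v : 0 <= v <= 1 -> 0 < source_piece b i v.
Proof.
by move=> /andP[? ?]; case: i => [|i] //=; rewrite /first_radius /core; case: b; lra.
Qed.

Lemma target_piece_gt0 b i v : 0 <= v <= 1 -> (i < (if b then 3 else 2))%N ->
  0 < target_piece b i v.
Proof.
move=> v01; have [t0 t1 t2] := target_order b v01.
case: b t0 t1 t2 => t0 t1 t2; case: i => [|[|[|//]]] //= _; rewrite subr_gt0 //.
exact: t2.
Qed.

Lemma pieces_pos t b v : 0 <= v <= 1 -> positive_pieces (pieces t b v).
Proof.
move=> v01; rewrite /positive_pieces /pieces all_map; apply/allP => i.
rewrite mem_iota add0n => /= ib.
by rewrite source_piece_gt0 // mix_gt0 ?source_piece_gt0 ?target_piece_gt0.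
Qed.

Lemma slope_gt0 t : 0 < slope t. Proof. by apply: mix_gt0; lra. Qed.

Definition profile t b v r := pl (slope t) (pieces t b v) r.
Definition coprofile t b v r := pl (slope t)^-1 (swap_pieces (pieces t b v)) r.

Lemma profileP t : radial_profile (profile t).
Proof.
move=> b v v01; split; first by rewrite /profile pl0 // pieces_pos.
by move=> r r0; rewrite /profile pl_ge0 ?slope_gt0 ?pieces_pos.
Qed.

Lemma coprofileP t : radial_profile (coprofile t).
Proof.
move=> b v v01; split; first by rewrite /coprofile pl0 // positive_swap // pieces_pos.
by move=> r r0; rewrite /coprofile pl_ge0 ?invr_gt0 ?slope_gt0 // positive_swap // pieces_pos.
Qed.

Lemma profileK t b v r : 0 <= v <= 1 -> 0 <= r -> coprofile t b v (profile t b v r) = r.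
Proof. by move=> v01 r0; rewrite /coprofile plK ?slope_gt0 ?pieces_pos. Qed.

Lemma coprofileK t b v r : 0 <= v <= 1 -> 0 <= r -> profile t b v (coprofile t b v r) = r.
Proof.
move=> v01 r0; rewrite /profile -{1}[slope t]invrK -[pieces _ _ _]swapK.
by rewrite plK ?invr_gt0 ?slope_gt0 // positive_swap // pieces_pos.
Qed.

Lemma fold_plane_point x y : fold (plane_point x y) =
  plane_point (Num.max x 0 + y) (y + Num.max (- x) 0).
Proof. by rewrite /fold plane_point0 plane_point1. Qed.

Lemma fold_unit_vector0 b : fold (unit_vector b 0) = plane_point 1 0.
Proof.
have -> : unit_vector b 0 = plane_point 1 0.
  by rewrite /unit_vector mulr0 cos0 sin0 oppr0 if_same.
rewrite fold_plane_point (max_l ler01) max_r ?oppr_le0 ?ler01 //.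
by rewrite !addr0.
Qed.

Lemma fold_unit_vector1 b : fold (unit_vector b 1) = plane_point 0 1.
Proof.
have -> : unit_vector b 1 = plane_point (-1) 0.
  by rewrite /unit_vector mulr1 cospi sinpi oppr0 if_same.
rewrite fold_plane_point opprK (max_l ler01) max_r ?oppr_le0 ?ler01 //.
by rewrite !add0r.
Qed.

Lemma inv_flip x y : x = y^-1 -> x^-1 = y.
Proof. by move=> ->; rewrite invrK. Qed.

Lemma target0 b j : (j <= (if b then 2 else 1))%N ->
  target b j 0 = if b then nth 0 [:: 1; 3; 10] j else nth 0 [:: 3; 10] j.
Proof.
rewrite /target !fold_unit_vector0 /lower_gauge /upper_gauge /chord.
rewrite !(plane_point0, plane_point1) (min_r ler01) minxx.
case: b; case: j => [|[|[|j]]] // _; apply: inv_flip.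
- by rewrite /=; lra.
- by rewrite /=; lra.
- by rewrite /=; lra.
- by rewrite max_r ?max_r /=; lra.
- by rewrite max_r ?max_r /=; lra.
Qed.

Lemma target1 b j : (j <= (if b then 2 else 1))%N ->
  target b j 1 = nth 0 [:: 2; 60; (20 * 100)] j.
Proof.
rewrite /target !fold_unit_vector1 /lower_gauge /upper_gauge /chord.
rewrite !(plane_point0, plane_point1) (min_r ler01) minxx.
case: b; case: j => [|[|[|j]]] // _; apply: inv_flip.
- by rewrite /=; lra.
- by rewrite /=; lra.
- by rewrite /=; lra.
- by rewrite max_r ?max_l /=; lra.
- by rewrite max_r ?max_l /=; lra.
Qed.

Lemma upper_piecesE t v : pieces t true v =
  [:: (first_radius true v - core R, mix t (first_radius true v - core R) (target true 0 v - core R));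
      (2, mix t 2 (target true 1 v - target true 0 v));
      (2, mix t 2 (target true 2 v - target true 1 v))].
Proof. by []. Qed.

Lemma lower_piecesE t v : pieces t false v =
  [:: (first_radius false v - core R, mix t (first_radius false v - core R) (target false 0 v - core R));
      (2, mix t 2 (target false 1 v - target false 0 v))].
Proof. by []. Qed.

(** On the positive axis the first two upper pieces merge into the first lower one;
    on the negative axis the third upper piece continues with the final slope. *)
Lemma profile_glue t v r : v = 0 \/ v = 1 -> 0 <= r ->
  profile t true v r = profile t false v r.
Proof.
move=> hv r0.
have v01 : 0 <= v <= 1 by case: hv => ->; rewrite lexx ler01.
have := pieces_pos t true v01; have := pieces_pos t false v01.
rewrite /profile upper_piecesE lower_piecesE.
case: hv => ->.
  have -> : target true 0 0 = 1 by rewrite target0.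
  have -> : target true 1 0 = 3 by rewrite target0.
  have -> : target true 2 0 = 10 by rewrite target0.
  have -> : target false 0 0 = 3 by rewrite target0.
  have -> : target false 1 0 = 10 by rewrite target0.
  move=> p1 p2.
  rewrite (pl_merge _ p2 _ r0); last by rewrite /first_radius /core /mix; lra.
  by congr (pl _ [:: (_, _); (_, _)] _); rewrite /first_radius /core /mix; lra.
have -> : target true 0 1 = 2 by rewrite target1.
have -> : target true 1 1 = 60 by rewrite target1.
have -> : target true 2 1 = (20 * 100) by rewrite target1.
have -> : target false 0 1 = 2 by rewrite target1.
have -> : target false 1 1 = 60 by rewrite target1.
move=> p1 p2.
have -> : first_radius true 1 = first_radius false 1 by rewrite /first_radius; lra.
apply: pl_congr => u u0; apply: pl_congr => w w0.
have two : 0 < 2 :> R by rewrite ltr0n.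
by rewrite pl_absorb // /slope /mix; lra.
Qed.
End Profiles.

(** * Straightening the curve *)

Section Straightening.
Variable R : realType.
Local Notation P := 'rV[R]_2.
Implicit Types (r t : R) (b : bool) (j : nat).

Lemma continuous_fold (T : topologicalType) (z : T -> P) : continuous z ->
  continuous (fun x => fold (z x)).
Proof. by move=> zc; rewrite /fold; apply: continuous_plane_point; ctn. Qed.

Lemma continuous_unit_vector (T : topologicalType) b (v : T -> R) : continuous v ->
  continuous (fun x => unit_vector b (v x)).
Proof.
move=> vc; have c1 : continuous (fun x => pi * v x) by ctn.
have cc := continuous_compose c1 (@continuous_cos R).
have cs := continuous_compose c1 (@continuous_sin R).
by rewrite /unit_vector; case: b; apply: continuous_plane_point => //; exact: continuous_opp.
Qed.

Lemma continuous_upper_gauge (T : topologicalType) j (z : T -> P) : continuous z ->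
  continuous (fun x => upper_gauge j (z x)).
Proof. by move=> zc; rewrite /upper_gauge; case: j => [|[|j]]; ctn. Qed.

Lemma continuous_lower_gauge (T : topologicalType) j (z : T -> P) : continuous z ->
  continuous (fun x => lower_gauge j (z x)).
Proof.
move=> zc; rewrite /lower_gauge; apply: continuous_maxr.
  by rewrite /chord; case: j => [|j]; ctn.
by apply: continuous_maxr; apply: continuous_upper_gauge; apply: continuous_plane_point; ctn.
Qed.

Lemma continuous_target (T : topologicalType) b j (v : T -> R) :
  (j <= (if b then 2 else 1))%N -> (forall x, 0 <= v x <= 1) -> continuous v ->
  continuous (fun x => target b j (v x)).
Proof.
move=> jb v01 vc; rewrite /target; have c := continuous_fold (@continuous_unit_vector T b v vc).
apply: continuous_inv => [x|].
  by have := gauge_pos (v01 x) jb; case: (b) => h; rewrite gt_eqF.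
by case: b jb c => jb c; [exact: continuous_upper_gauge|exact: continuous_lower_gauge].
Qed.

Lemma continuous_source_piece (T : topologicalType) b i (v : T -> R) : continuous v ->
  continuous (fun x => source_piece b i (v x)).
Proof.
by move=> vc; rewrite /source_piece /first_radius; case: i => [|i]; case: b; ctn.
Qed.

Lemma continuous_target_piece (T : topologicalType) b i (v : T -> R) :
  (i < (if b then 3 else 2))%N -> (forall x, 0 <= v x <= 1) -> continuous v ->
  continuous (fun x => target_piece b i (v x)).
Proof.
move=> ib v01 vc; rewrite /target_piece; case: i ib => [|i] ib.
  apply: continuous_add; last exact: continuous_cst_fun.
  by apply: continuous_target.
apply: continuous_add; last apply: continuous_opp; apply: continuous_target => //.
  by move: ib; case: (b).
by move: ib; case: (b); case: (i) => [|[|]].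
Qed.

Lemma continuous_mix (T : topologicalType) (t x y : T -> R) : continuous t ->
  continuous x -> continuous y -> continuous (fun w => mix (t w) (x w) (y w)).
Proof.
move=> tc xc yc; have cc := continuous_compose tc (@clamp_continuous R).
by rewrite /mix; ctn.
Qed.

Let tc : continuous (fun x : R * P => x.1). Proof. by ctn. Qed.
Let zc : continuous (fun x : R * P => x.2). Proof. by ctn. Qed.
Let ac : continuous (fun x : R * P => ang x.2).
Proof. exact: (continuous_compose zc (@continuous_ang R)). Qed.
Let a01 (x : R * P) : 0 <= ang x.2 <= 1. Proof. exact: ang01. Qed.
Let rc : continuous (fun x : R * P => Num.max (rad x.2 - core R) 0).
Proof.
have c := continuous_compose zc (@continuous_rad R).
by apply: continuous_maxr; [apply: continuous_add => //|]; exact: continuous_cst_fun.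
Qed.
Let sc : continuous (fun x : R * P => slope x.1).
Proof. by apply: continuous_mix => //; exact: continuous_cst_fun. Qed.

Let piece_mix_continuous b i : (i < (if b then 3 else 2))%N ->
  continuous (fun x : R * P =>
    mix x.1 (source_piece b i (ang x.2)) (target_piece b i (ang x.2))).
Proof.
move=> ib; apply: continuous_mix => //; first exact: continuous_source_piece.
exact: continuous_target_piece.
Qed.

Lemma continuous_profile b :
  continuous (fun x : R * P => profile x.1 b (ang x.2) (Num.max (rad x.2 - core R) 0)).
Proof.
apply: (@continuous_pl R _ (fun x => slope x.1) (fun x : R * P => pieces x.1 b (ang x.2))
  (fun x : R * P => Num.max (rad x.2 - core R) 0) (if b then 3 else 2)
  (fun i x => source_piece b i (ang x.2))
  (fun i x => mix x.1 (source_piece b i (ang x.2)) (target_piece b i (ang x.2)))) => //.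
- by move=> i x _; rewrite gt_eqF // source_piece_gt0.
- by move=> i _; exact: continuous_source_piece.
- exact: piece_mix_continuous.
Qed.

Lemma continuous_coprofile b :
  continuous (fun x : R * P => coprofile x.1 b (ang x.2) (Num.max (rad x.2 - core R) 0)).
Proof.
apply: (@continuous_pl R _ (fun x => (slope x.1)^-1)
  (fun x : R * P => swap_pieces (pieces x.1 b (ang x.2)))
  (fun x : R * P => Num.max (rad x.2 - core R) 0) (if b then 3 else 2)
  (fun i x => mix x.1 (source_piece b i (ang x.2)) (target_piece b i (ang x.2)))
  (fun i x => source_piece b i (ang x.2))) => //.
- by move=> x; rewrite /swap_pieces /pieces -map_comp.
- by move=> i x ib; rewrite gt_eqF // mix_gt0 ?source_piece_gt0 ?target_piece_gt0.
- exact: piece_mix_continuous.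
- by move=> i _; exact: continuous_source_piece.
- by apply: continuous_inv => // x; rewrite gt_eqF // slope_gt0.
Qed.

Lemma coprofile_glue t (v : R) r : v = 0 \/ v = 1 -> 0 <= r ->
  coprofile t true v r = coprofile t false v r.
Proof.
move=> hv r0; have v01 : 0 <= v <= 1 by case: hv => ->; rewrite lexx ler01.
have c0 : 0 <= coprofile t true v r by apply: (coprofileP t _ v01).2.
by rewrite -(@profileK _ t false v (coprofile t true v r)) // -profile_glue // coprofileK.
Qed.

Lemma mix0 (x y : R) : mix 0 x y = x.
Proof. by rewrite /mix clamp_id ?lexx ?ler01 // subr0 mul1r mul0r addr0. Qed.

Lemma mix1 (x y : R) : mix 1 x y = y.
Proof. by rewrite /mix clamp_id ?lexx ?ler01 // subrr mul1r mul0r add0r. Qed.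

Lemma pl_same (l : seq R) r : all (fun p => 0 < p) l -> 0 <= r ->
  pl 1 [seq (p, p) | p <- l] r = r.
Proof.
elim: l r => [|p l IH] r /=; first by rewrite mul1r.
move=> /andP[p0 hl] r0; rewrite IH ?le_max ?lexx ?orbT //.
rewrite mulfV ?gt_eqF // mul1r; case: (leP r p) => rp.
  by rewrite max_r ?subr_le0 // addr0.
by rewrite max_l ?subr_ge0 ?(ltW rp) //; ring.
Qed.

Lemma profile_start b (v : R) r : 0 <= v <= 1 -> 0 <= r -> profile 0 b v r = r.
Proof.
move=> v01 r0; rewrite /profile /slope mix0.
have -> : pieces 0 b v = [seq (p, p) | p <- [seq source_piece b i v | i <- iota 0 (if b then 3 else 2)]].
  by rewrite /pieces -map_comp; apply: eq_map => i /=; rewrite mix0.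
by apply: pl_same => //; rewrite all_map; apply/allP => i _ /=; exact: source_piece_gt0.
Qed.

Lemma radial_id (f : bool -> R -> R -> R) (z : P) :
  (forall b (v r : R), 0 <= v <= 1 -> 0 <= r -> f b v r = r) -> radial f z = z.
Proof.
move=> fid; rewrite /radial fid ?ang01 ?le_max ?lexx ?orbT //.
have -> : core R + Num.max (rad z - core R) 0 = crad z.
  by rewrite /crad; case: (leP (core R) (rad z)) => h; [rewrite max_l ?subr_ge0 //; ring|rewrite max_r ?subr_le0 ?(ltW h) // addr0].
by rewrite mulfV ?crad_neq0 // scale1r.
Qed.

(** The inverse of a radial map is radial, with inverse profile. *)
Lemma deformation_radial : deformation (radial (profile 1) : P -> P).
Proof.
exists (fun t => radial (profile t)), (fun t => radial (coprofile t)); split.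
- apply: (@continuous_radial R _ (fun x : R * P => profile x.1) (fun x => x.2)) => //.
  + exact: continuous_profile.
  + by move=> x; exact: profileP.
  + by move=> x v r; exact: profile_glue.
- apply: (@continuous_radial R _ (fun x : R * P => coprofile x.1) (fun x => x.2)) => //.
  + exact: continuous_coprofile.
  + by move=> x; exact: coprofileP.
  + by move=> x v r; exact: coprofile_glue.
- by move=> z; apply: radial_id => b v r v01 r0; exact: profile_start.
- by [].
- move=> t; split; apply: radialK; try exact: profileP; try exact: coprofileP.
    by move=> b v r; exact: profileK.
  by move=> b v r; exact: coprofileK.
Qed.

Definition straighten (z : P) : P := fold (radial (profile 1) z).

Lemma deformation_straighten : deformation straighten.
Proof. exact: (deformation_comp (@deformation_fold R) deformation_radial). Qed.

(** At time 1 the nodes of the profile are the crossings of the ray with the spiral. *)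
Lemma profile_node b j (v : R) : 0 <= v <= 1 -> (j <= (if b then 2 else 1))%N ->
  profile 1 b v (first_radius b v + 2 * j%:R - core R) = target b j v - core R.
Proof.
move=> v01 jb; have pp := pieces_pos 1 b v01.
have sp0 : 0 < source_piece b 0 v by exact: source_piece_gt0.
have two : 0 < 2 :> R by rewrite ltr0n.
rewrite /profile; case: b jb pp sp0 => jb; rewrite ?upper_piecesE ?lower_piecesE !mix1 => pp sp0.
  move: (pp); rewrite positive_cons => /andP[_ pp1]; move: (pp1); rewrite positive_cons => /andP[_ pp2].
  case: j jb => [|[|[|j]]] // _.
  - rewrite mulr0 addr0 (pl_first _ pp) //.
    by rewrite divfK // gt_eqF.
  - rewrite (pl_next _ pp); last by rewrite /=; lra.
    rewrite (_ : _ - (_ - _) = 2); last by ring.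
    by rewrite (pl_first _ pp1) // divfK ?gt_eqF //; ring.
  - rewrite (pl_next _ pp); last by rewrite /=; lra.
    rewrite (_ : _ - (_ - _) = 4); last by ring.
    rewrite (pl_next _ pp1); last by lra.
    rewrite (_ : 4 - 2 = 2); last by ring.
    by rewrite (pl_first _ pp2) // divfK ?gt_eqF //; ring.
move: (pp); rewrite positive_cons => /andP[_ pp1].
case: j jb => [|[|j]] // _.
- rewrite mulr0 addr0 (pl_first _ pp) //.
  by rewrite divfK // gt_eqF.
- rewrite (pl_next _ pp); last by rewrite /=; lra.
  rewrite (_ : _ - (_ - _) = 2); last by ring.
  by rewrite (pl_first _ pp1) // divfK ?gt_eqF //; ring.
Qed.
End Straightening.

(** * The straightened spiral *)

Section Arcs.
Variable R : realType.
Local Notation P := 'rV[R]_2.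
Implicit Types (z w : P) (r s t v : R) (b : bool) (j : nat).

Lemma scale_coord r z i : (r *: z) 0 i = r * z 0 i.
Proof. by rewrite mxE. Qed.

Lemma archimedean_upper_half j v : archimedean (v + (j.*2)%:R) =
  (first_radius true v + 2 * j%:R) *: unit_vector true v.
Proof.
rewrite /archimedean cos_pi_nat sin_pi_nat -signr_odd odd_double expr0 !mul1r.
have -> : 1 + (v + (j.*2)%:R) = first_radius true v + 2 * j%:R.
  by rewrite /first_radius -muln2 natrM; ring.
by apply/rowP => i; rewrite !mxE; case: i => [[|[|//]] i].
Qed.

Lemma archimedean_lower_half j v : archimedean (2 - v + (j.*2)%:R) =
  (first_radius false v + 2 * j%:R) *: unit_vector false v.
Proof.
have -> : 2 - v + (j.*2)%:R = - v + (j.+1.*2)%:R.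
  by rewrite doubleS -[(j.*2).+2]addn2 natrD; ring.
rewrite /archimedean cos_pi_nat sin_pi_nat -signr_odd odd_double expr0 !mul1r.
have -> : 1 + (- v + (j.+1.*2)%:R) = first_radius false v + 2 * j%:R.
  by rewrite /first_radius -muln2 natrM -[j.+1]addn1 natrD; ring.
rewrite mulrN cosN sinN.
by apply/rowP => i; rewrite !mxE; case: i => [[|[|//]] i].
Qed.

Lemma first_radius_ge_core b v j : 0 <= v <= 1 -> core R <= first_radius b v + 2 * j%:R.
Proof.
move=> /andP[v0 v1]; have j0 : 0 <= j%:R :> R by rewrite ler0n.
by rewrite /core /first_radius; case: b; lra.
Qed.

Lemma target_gt0 b v j : 0 <= v <= 1 -> (j <= (if b then 2 else 1))%N -> 0 < target b j v.
Proof. by move=> v01 jb; rewrite invr_gt0 gauge_pos. Qed.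

Lemma straighten_unit b v j : 0 <= v <= 1 -> (b = false -> 0 < v < 1) ->
  (j <= (if b then 2 else 1))%N ->
  straighten ((first_radius b v + 2 * j%:R) *: unit_vector b v) =
  target b j v *: fold (unit_vector b v).
Proof.
move=> v01 hb jb; rewrite /straighten /unit_vector radial_polar ?first_radius_ge_core //.
rewrite -/(unit_vector b v) profile_node // addrC subrK foldZ // ltW //.
exact: target_gt0.
Qed.

Lemma upper_gaugeZ j r z : upper_gauge j (r *: z) = r * upper_gauge j z.
Proof. by rewrite /upper_gauge !mxE; case: j => [|[|j]]; ring. Qed.

Lemma chordZ j r z : chord j (r *: z) = r * chord j z.
Proof. by rewrite /chord !mxE; case: j => [|j]; ring. Qed.

Lemma lower_gaugeZ j r z : 0 <= r -> lower_gauge j (r *: z) = r * lower_gauge j z.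
Proof.
move=> r0; rewrite /lower_gauge chordZ !maxr_pMr // -!upper_gaugeZ.
have e0 : plane_point (Num.min ((r *: z) 0 0) 0) ((r *: z) 0 1) =
  r *: plane_point (Num.min (z 0 0) 0) (z 0 1).
  apply/rowP => i; rewrite !mxE; case: i => [[|[|//]] i] //=.
  by rewrite minr_pMr // mulr0.
have e1 : plane_point ((r *: z) 0 0) (Num.min ((r *: z) 0 1) 0) =
  r *: plane_point (z 0 0) (Num.min (z 0 1) 0).
  apply/rowP => i; rewrite !mxE; case: i => [[|[|//]] i] //=.
  by rewrite minr_pMr // mulr0.
by rewrite e0 e1.
Qed.

(** The preimage of z under [fold] is written in polar coordinates; [fold] is
    homogeneous. *)
Lemma fold_polar z : z != 0 -> exists r v, [/\ 0 < r, 0 <= v <= 1 &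
  z = r *: fold (unit_vector ((0 <= z 0 0) && (0 <= z 0 1)) v)].
Proof.
move=> z0.
pose w := plane_point (z 0 0 - z 0 1) (Num.min (z 0 0) (z 0 1)).
have fw : fold w = z.
  rewrite [RHS]plane_pointE /w fold_plane_point.
  have mx (x y : R) : x <= y -> Num.max (x - y) 0 = 0 /\ Num.max (- (x - y)) 0 = y - x.
    by move=> xy; split; [rewrite max_r // subr_le0|rewrite opprB max_l // subr_ge0].
  have mx' (x y : R) : y < x -> Num.max (x - y) 0 = x - y /\ Num.max (- (x - y)) 0 = 0.
    by move=> /ltW xy; split; [rewrite max_l // subr_ge0|rewrite opprB max_r // subr_le0].
  by congr plane_point; case: (leP (z 0 0) (z 0 1)) => h;
    [have [-> _] := mx _ _ h|have [-> _] := mx' _ _ h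
    |have [_ ->] := mx _ _ h|have [_ ->] := mx' _ _ h]; ring.
have rw0 : 0 < rad w.
  rewrite lt_neqAle rad_ge0 andbT eq_sym; apply: contra z0 => /eqP r0.
  have := rad_sqr w; rewrite r0 mulr0 => /esym/eqP.
  rewrite -!expr2 paddr_eq0 ?sqr_ge0 // !sqrf_eq0 => /andP[/eqP w0 /eqP w1].
  rewrite -fw [w]plane_pointE w0 w1 fold_plane_point oppr0 maxxx addr0.
  by apply/eqP/rowP => i; rewrite !mxE; case: i => [[|[|//]] i].
have i0 : 0 < (rad w)^-1 by rewrite invr_gt0.
pose w1 := (rad w)^-1 *: w.
have r1 : rad w1 = 1 by rewrite radZ ?(ltW i0) // mulVf ?gt_eqF.
exists (rad w), (ang w1); split=> //; first exact: ang01.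
have hc : core R <= rad w1 by rewrite r1 /core; lra.
have E : w1 = unit_vector (0 <= w1 0 1) (ang w1).
  by have := polar hc; rewrite r1 scale1r.
have bE : (0 <= w1 0 1) = (0 <= z 0 0) && (0 <= z 0 1).
  by rewrite mxE pmulr_rge0 // plane_point1 le_min.
rewrite -bE -E -foldZ ?(ltW rw0) //.
by rewrite /w1 scalerA mulfV ?gt_eqF // scale1r fw.
Qed.

Definition image_c s : P := straighten (curve_c s).

Definition upper_arc j z := [/\ 0 <= z 0 0, 0 <= z 0 1 & upper_gauge j z = 1].
Definition lower_arc j z := (z 0 0 < 0 \/ z 0 1 < 0) /\ lower_gauge j z = 1.

Lemma image_c_spiral s : s <= 1 / 2 -> image_c s = straighten (archimedean (10 * s)).
Proof. by move=> h; rewrite /image_c curve_c_spiral. Qed.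

Lemma image_c_upper j v : (j <= 2)%N -> 0 <= v <= 1 ->
  image_c ((v + (j.*2)%:R) / 10) = target true j v *: fold (unit_vector true v).
Proof.
move=> j2 v01; have jr : (j.*2)%:R <= 4 :> R by rewrite (ler_nat _ _ 4) (leq_double j 2).
rewrite image_c_spiral; last by move/andP: v01 => [? ?]; lra.
rewrite mulrC divfK ?archimedean_upper_half ?straighten_unit //.
Qed.

Lemma image_c_lower j v : (j <= 1)%N -> 0 < v < 1 ->
  image_c ((2 - v + (j.*2)%:R) / 10) = target false j v *: fold (unit_vector false v).
Proof.
move=> j2 v01; have jr : (j.*2)%:R <= 2 :> R by rewrite (ler_nat _ _ 2) (leq_double j 1).
have v01' : 0 <= v <= 1 by move/andP: v01 => [? ?]; rewrite !ltW.
rewrite image_c_spiral; last by move/andP: v01 => [? ?]; lra.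
rewrite mulrC divfK ?archimedean_lower_half ?straighten_unit //.
Qed.

(** Along the ray at angle v the spiral is moved to distance [target], which is
    exactly where the gauge equals 1; every point of the quadrant is on such a ray. *)
Lemma upper_arcP j z : (j <= 2)%N -> upper_arc j z <->
  exists2 v, 0 <= v <= 1 & z = image_c ((v + (j.*2)%:R) / 10).
Proof.
move=> j2; split=> [[x0 y0 g1]|[v v01 ->]].
  have z0 : z != 0.
    apply/eqP => e; move: g1; rewrite e -(scale0r z) upper_gaugeZ mul0r => /esym/eqP.
    by rewrite oner_eq0.
  have [r [v [r0 v01 E]]] := fold_polar z0; exists v => //.
  rewrite x0 y0 /= in E; rewrite image_c_upper // {1}E; congr (_ *: _).
  move: g1; rewrite {1}E upper_gaugeZ => g1; rewrite /target.
  by apply: (mulIf (_ : upper_gauge j (fold (unit_vector true v)) != 0));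
    rewrite ?g1 ?mulVf // gt_eqF // (@gauge_pos _ true).
rewrite image_c_upper //; have t0 := @target_gt0 true v j v01 j2.
have [x0 y0] := unit_vector_upper v01.
split; [by rewrite mxE mulr_ge0 // ltW|by rewrite mxE mulr_ge0 // ltW|].
by rewrite upper_gaugeZ mulVf // gt_eqF // (@gauge_pos _ true).
Qed.

Lemma lower_arcP j z : (j <= 1)%N -> lower_arc j z <->
  exists2 v, 0 < v < 1 & z = image_c ((2 - v + (j.*2)%:R) / 10).
Proof.
move=> j1; split=> [[n0 g1]|[v v01 ->]].
  have z0 : z != 0.
    apply/eqP => e; move: g1; rewrite e -(scale0r z) lower_gaugeZ // mul0r => /esym/eqP.
    by rewrite oner_eq0.
  have [r [v [r0 v01 E]]] := fold_polar z0.
  have bF : (0 <= z 0 0) && (0 <= z 0 1) = false.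
    by apply/negbTE; rewrite negb_and -!ltNge; apply/orP.
  rewrite bF in E.
  have v01' : 0 < v < 1.
    have n v' : v = v' -> fold (unit_vector false v') 0 0 >= 0 ->
        fold (unit_vector false v') 0 1 >= 0 -> False.
      move=> e h0 h1; move: bF; rewrite E e !scale_coord !pmulr_rge0 //.
      by rewrite h0 h1.
    rewrite !lt_neqAle eq_sym; move/andP: v01 => [-> ->]; rewrite !andbT.
    apply/andP; split; apply/eqP => e.
      by apply: (n _ e); rewrite fold_unit_vector0 !(plane_point0, plane_point1) ?ler01.
    by apply: (n _ e); rewrite fold_unit_vector1 !(plane_point0, plane_point1) ?ler01.
  exists v => //; rewrite image_c_lower // {1}E; congr (_ *: _).
  move: g1; rewrite {1}E lower_gaugeZ ?(ltW r0) // => g1; rewrite /target.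
  by apply: (mulIf (_ : lower_gauge j (fold (unit_vector false v)) != 0));
    rewrite ?g1 ?mulVf // gt_eqF // (@gauge_pos _ false).
have v01' : 0 <= v <= 1 by move/andP: v01 => [? ?]; rewrite !ltW.
rewrite image_c_lower //; have t0 := @target_gt0 false v j v01' j1.
split; last first.
  by rewrite lower_gaugeZ ?(ltW t0) // mulVf // gt_eqF // (@gauge_pos _ false).
rewrite !scale_coord !pmulr_rlt0 // /unit_vector fold_plane_point !(plane_point0, plane_point1).
have p0 := pi_gt0 R.
have s0 : 0 < sin (pi * v).
  by move/andP: v01 => [? ?]; apply: sin_gt0_pi; apply/andP; split; nra.
by case: (leP (cos (pi * v)) 0) => h; [left|right; rewrite max_r ?oppr_le0 ?(ltW h) //]; lra.
Qed.
End Arcs.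

(** * A lift of the straightened curve *)

Section SpacePoint.
Variable R : realType.
Local Notation P3 := 'rV[R]_(2 + 1).

Definition space_point (z : 'rV[R]_2) (h : R) : P3 := row_mx z h%:M.

Lemma proj_space_point z h : plane_proj (space_point z h) = z.
Proof. exact: row_mxKl. Qed.

Lemma height_space_point z h : height (space_point z h) = h.
Proof. by rewrite /height /space_point row_mxKr mxE eqxx. Qed.

Lemma space_pointE (p : P3) : p = space_point (plane_proj p) (height p).
Proof.
rewrite -[LHS]hsubmxK; congr row_mx.
by apply/rowP => i; rewrite [i]ord1 [RHS]mxE eqxx.
Qed.

Lemma space_point_inj z w h k : space_point z h = space_point w k -> z = w /\ h = k.
Proof.
move=> e; split; first by rewrite -(proj_space_point z h) e proj_space_point.
by rewrite -(height_space_point z h) e height_space_point.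
Qed.

Lemma affine_space_point (x y h x' y' h' t : R) :
  (1 - t) *: space_point (plane_point x y) h + t *: space_point (plane_point x' y') h' =
  space_point (plane_point ((1 - t) * x + t * x') ((1 - t) * y + t * y'))
    ((1 - t) * h + t * h').
Proof.
rewrite /space_point !scale_row_mx add_row_mx; congr row_mx.
  by apply/rowP => i; rewrite !mxE; case: i => [[|[|//]] i].
by apply/rowP => i; rewrite [i]ord1 !mxE !eqxx !mulr1n.
Qed.

Lemma stick_space_pointP (x y h x' y' h' u v w : R) :
  stick (space_point (plane_point x y) h) (space_point (plane_point x' y') h')
    (space_point (plane_point u v) w) <->
  exists2 t, 0 <= t <= 1 &
    [/\ u = (1 - t) * x + t * x', v = (1 - t) * y + t * y' & w = (1 - t) * h + t * h'].
Proof.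
split=> [[t t01]|[t t01 [-> -> ->]]]; last by exists t; rewrite ?affine_space_point //= in_itv.
move: t01; rewrite /= in_itv /= affine_space_point => t01 /space_point_inj[/plane_point_inj[<- <-] <-].
by exists t.
Qed.
End SpacePoint.

Section Polygon.
Variables (R : realType) (e0 e6 : R).
Local Notation P := 'rV[R]_2.
Implicit Types (z : P) (s t v : R).

(** The form 4 x + y decreases to 0 along the first edge, up to the vertex (-1,4), and
    is not positive along the second edge. *)
Definition bump z : R := Num.max 0 (4 * z 0 0 + z 0 1).

(** The first term tilts the first edge, the second one the last edge.  The
    truncation at 3/20, in the middle of the second half turn and beyond the vertex
    (-1,4), keeps [bump] from acting on the later turns, and the spiral ends at 1/2. *)
Definition lift_height s : R :=
  e0 * bump (image_c (Num.min s (3 / 20))) + e6 * ((20 * 100) - image_c (Num.max s (1 / 2)) 0 1).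

Definition spiral_lift s := space_point (image_c s) (lift_height s).

(** The position on the upward half-axis of the image of the point at distance r on
    the negative axis. *)
Definition axis (r : R) : R := core R + profile 1 true 1 (r - core R).

Lemma straighten_axis (r : R) : 1 <= r -> straighten (plane_point (- r) 0) = plane_point 0 (axis r).
Proof.
move=> r1; have r0 : 0 <= r by lra.
have hc : core R <= r by rewrite /core; lra.
have -> : plane_point (- r) 0 = r *: unit_vector true 1.
  by rewrite /unit_vector mulr1 cospi sinpi; apply/rowP => i; rewrite !mxE;
    case: i => [[|[|//]] i] /=; ring.
rewrite /straighten (@radial_polar R (profile 1) r 1 true) ?lexx ?ler01 // -/(unit_vector true 1).
have a0 : 0 <= axis r.
  rewrite /axis addr_ge0 ?(ltW (core_gt0 R)) //.
  by apply: (profileP 1 true _).2; rewrite ?lexx ?ler01 ?subr_ge0.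
rewrite foldZ // fold_unit_vector1.
by apply/rowP => i; rewrite !mxE; case: i => [[|[|//]] i] /=; rewrite /axis; ring.
Qed.

Let one01 : 0 <= (1 : R) <= 1. Proof. by rewrite lexx ler01. Qed.

Lemma axis_node j : (j <= 2)%N -> axis (2 + 2 * j%:R) = target true j 1.
Proof.
move=> j2; rewrite /axis.
have -> : 2 + 2 * j%:R - core R = first_radius true 1 + 2 * j%:R - core R :> R.
  by rewrite /first_radius; ring.
by rewrite profile_node // addrC subrK.
Qed.

Lemma axis1 : axis 1 = 1.
Proof.
rewrite /axis /profile upper_piecesE (pl_first _ _ _).
- have -> : first_radius true 1 = 2 :> R by rewrite /first_radius; ring.
  have n0 : 2 - core R != 0 by rewrite gt_eqF // /core; lra.
  by rewrite mix1 target1 // [nth _ _ _]/= divff // mul1r; ring.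
- exact: (pieces_pos 1 true one01).
- by rewrite /first_radius /core; lra.
Qed.

Lemma axis2 : axis 2 = 2.
Proof. by have := @axis_node 0 isT; rewrite mulr0 addr0 target1. Qed.

Lemma axis4 : axis 4 = 60.
Proof.
have -> : 4 = 2 + 2 * 1%:R :> R by lra.
by rewrite axis_node // target1.
Qed.

Lemma axis6 : axis 6 = (20 * 100).
Proof.
have -> : 6 = 2 + 2 * 2%:R :> R by lra.
by rewrite axis_node // target1.
Qed.

Lemma axis_le (r r' : R) : r <= r' -> axis r <= axis r'.
Proof.
by move=> rr; rewrite /axis lerD2l; apply: pl_le; rewrite ?slope_gt0 ?pieces_pos // lerD2r.
Qed.

(** The inverse profile gives the preimage. *)
Lemma axis_surj y : 1 <= y <= (20 * 100) -> exists2 r, 1 <= r <= 6 & axis r = y.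
Proof.
move=> /andP[y1 y2].
have c1 : core R < 1 by rewrite /core; lra.
exists (core R + coprofile 1 true 1 (y - core R)); last first.
  by rewrite /axis addrAC subrr add0r coprofileK //; lra.
have inv (r : R) : 1 <= r -> core R + coprofile 1 true 1 (axis r - core R) = r.
  by move=> r1; rewrite /axis addrAC subrr add0r profileK ?subr_ge0 //; lra.
have mono (u w : R) : u <= w -> coprofile 1 true 1 u <= coprofile 1 true 1 w.
  move=> uw; apply: pl_le => //; first by rewrite invr_gt0 slope_gt0.
  by rewrite positive_swap // pieces_pos.
have i1 := inv 1 (lexx _); have i6 : core R + coprofile 1 true 1 (axis 6 - core R) = 6.
  by apply: inv; lra.
rewrite axis1 in i1; rewrite axis6 in i6.
have l1 := mono (1 - core R) (y - core R) (lerB y1 (lexx _)).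
have l6 := mono (y - core R) ((20 * 100) - core R) (lerB y2 (lexx _)).
apply/andP; split.
  by rewrite -[leLHS]i1 lerD2l.
by rewrite -[leRHS]i6 lerD2l.
Qed.

Lemma image_c_final s : 1 / 2 <= s -> s <= 1 -> image_c s = plane_point 0 (axis (11 - 10 * s)).
Proof.
move=> s0 s1; have e : 10 * s - 11 = - (11 - 10 * s) by ring.
have r1 : 1 <= 11 - 10 * s by lra.
by rewrite /image_c curve_c_final // e straighten_axis.
Qed.

Lemma image_c_half : image_c (1 / 2) = plane_point 0 (20 * 100) :> P.
Proof.
have h : 1 / 2 <= (1 : R) by lra.
have e : 11 - 10 * (1 / 2) = 6 :> R by lra.
by rewrite image_c_final // e axis6.
Qed.

Lemma lift_height_spiral s : s <= 1 / 2 -> lift_height s = e0 * bump (image_c (Num.min s (3 / 20))).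
Proof.
by move=> h; rewrite /lift_height (max_r h) image_c_half plane_point1 subrr mulr0 addr0.
Qed.

Let double1 : 1.*2 = 2. Proof. by []. Qed.
Let double2 : 2.*2 = 4. Proof. by []. Qed.
Let doubleE := (double0, double1, double2).

Lemma bump_turn : bump (image_c (3 / 20)) = 0.
Proof.
have h : 0 < (1 / 2 : R) < 1 by apply/andP; split; lra.
have h' : 0 <= (1 / 2 : R) <= 1 by apply/andP; split; lra.
have -> : 3 / 20 = (2 - 1 / 2 + (0.*2)%:R) / 10 :> R by rewrite doubleE; lra.
rewrite image_c_lower //.
have uE : unit_vector false (1 / 2) = plane_point 0 (-1) :> P.
  have e : pi * (1 / 2) = pi / 2 :> R by field.
  by rewrite /unit_vector e cos_pihalf sin_pihalf.
have t0 := @target_gt0 R false (1 / 2) 0 h' isT.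
rewrite uE fold_plane_point maxxx oppr0 maxxx add0r addr0 /bump !scale_coord.
rewrite plane_point0 plane_point1; move: t0; move: (target _ _ _) => c c0.
by rewrite max_l //; lra.
Qed.

Lemma lift_height_late s : 3 / 20 <= s -> s <= 1 / 2 -> lift_height s = 0.
Proof.
by move=> h h'; rewrite lift_height_spiral // (min_r h) bump_turn mulr0.
Qed.

Lemma lift_height_upper0 v : 0 <= v <= 1 ->
  lift_height ((v + (0.*2)%:R) / 10) = e0 * bump (image_c ((v + (0.*2)%:R) / 10)).
Proof.
move=> /andP[v0 v1]; have h : (v + (0.*2)%:R) / 10 <= 3 / 20 by rewrite doubleE; lra.
by rewrite lift_height_spiral ?(min_l h) // doubleE; lra.
Qed.

Lemma fold_lower_sign v : 0 < v < 1 ->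
  let z := fold (unit_vector false v : P) in (z 0 0 <= z 0 1) = (1 / 2 <= v).
Proof.
move=> /andP[v0 v1] /=; have p0 := pi_gt0 R.
rewrite /unit_vector fold_plane_point plane_point0 plane_point1.
have [h|h] := leP (1 / 2) v.
  have c0 : cos (pi * v) <= 0.
    have -> : v = (v - 1) + 1 by ring.
    by rewrite cos_pi_shift oppr_le0 cos_ge0_pihalf //; apply/andP; split; nra.
  by rewrite (max_r c0) max_l ?oppr_ge0 //; apply/idP; lra.
have c0 : 0 < cos (pi * v) by apply: cos_gt0_pihalf; apply/andP; split; nra.
by rewrite (max_l (ltW c0)) max_r ?oppr_le0 ?(ltW c0) //; apply/negbTE; rewrite -ltNge; lra.
Qed.

(** On the first lower turn the diagonal separates the end of the first edge from
    the beginning of the third edge, where 4 x + y is positive again. *)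
Definition bump_left z : R := if z 0 0 <= z 0 1 then bump z else 0.

Lemma lift_height_lower0 v : 0 < v < 1 ->
  lift_height ((2 - v + (0.*2)%:R) / 10) = e0 * bump_left (image_c ((2 - v + (0.*2)%:R) / 10)).
Proof.
move=> v01; have v01' : 0 <= v <= 1 by case/andP: v01 => ? ?; rewrite !ltW.
have t0 := @target_gt0 R false v 0 v01' isT.
have sg : (image_c ((2 - v + (0.*2)%:R) / 10) 0 0 <= image_c ((2 - v + (0.*2)%:R) / 10) 0 1) = (1 / 2 <= v).
  by rewrite image_c_lower // !scale_coord ler_pM2l // fold_lower_sign.
rewrite /bump_left sg; case/andP: v01 => v0 v1; have [h|h] := leP (1 / 2) v.
  have hs : (2 - v + (0.*2)%:R) / 10 <= 3 / 20 by rewrite doubleE; lra.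
  by rewrite lift_height_spiral ?(min_l hs) // doubleE; lra.
by rewrite lift_height_late ?mulr0 // doubleE; lra.
Qed.

Lemma lift_height_final s : 1 / 2 <= s -> s <= 1 ->
  lift_height s = e6 * ((20 * 100) - axis (11 - 10 * s)).
Proof.
move=> h h1; have h' : 3 / 20 <= s by lra.
by rewrite /lift_height (min_r h') bump_turn mulr0 add0r (max_l h) image_c_final // plane_point1.
Qed.

(** A description of the lift free of its parametrisation, to be compared with edges. *)
Definition on_arcs z (h : R) : Prop :=
  (upper_arc 0 z /\ h = e0 * bump z) \/
  (lower_arc 0 z /\ h = e0 * bump_left z) \/
  (upper_arc 1 z /\ h = 0) \/
  (lower_arc 1 z /\ h = 0) \/
  (upper_arc 2 z /\ h = 0) \/
  (z 0 0 = 0 /\ 1 <= z 0 1 <= (20 * 100) /\ h = e6 * ((20 * 100) - z 0 1)).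

Lemma lift_on_arcs s : 0 <= s <= 1 -> on_arcs (image_c s) (lift_height s).
Proof.
move=> /andP[s0 s1]; rewrite /on_arcs.
have [h|h] := leP s (1 / 2); last first.
  do 5 right; rewrite image_c_final ?(ltW h) // plane_point0 plane_point1; split=> //.
  have a1 := axis_le (_ : 1 <= 11 - 10 * s); have a2 := axis_le (_ : 11 - 10 * s <= 6).
  rewrite axis1 in a1; rewrite axis6 in a2; split; last by rewrite lift_height_final // ltW.
  by apply/andP; split; [apply: a1|apply: a2]; lra.
have [c1|c1] := leP s (1 / 10).
  have e : s = (10 * s + (0.*2)%:R) / 10 by rewrite doubleE; lra.
  have v01 : 0 <= 10 * s <= 1 by apply/andP; split; lra.
  by left; rewrite e lift_height_upper0 //; split=> //; apply/upper_arcP => //; exists (10 * s).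
have [c2|c2] := ltP s (2 / 10).
  have e : s = (2 - (2 - 10 * s) + (0.*2)%:R) / 10 by rewrite doubleE; lra.
  have v01 : 0 < 2 - 10 * s < 1 by apply/andP; split; lra.
  by right; left; rewrite e lift_height_lower0 //; split=> //; apply/lower_arcP => //; exists (2 - 10 * s).
right; right; rewrite lift_height_late //; last lra.
have [c3|c3] := leP s (3 / 10).
  left; split=> //; apply/upper_arcP => //; exists (10 * s - 2).
    by apply/andP; split; lra.
  by congr image_c; rewrite doubleE; lra.
have [c4|c4] := ltP s (4 / 10).
  right; left; split=> //; apply/lower_arcP => //; exists (4 - 10 * s).
    by apply/andP; split; lra.
  by congr image_c; rewrite doubleE; lra.
right; right; left; split=> //; apply/upper_arcP => //; exists (10 * s - 4).
  by apply/andP; split; lra.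
by congr image_c; rewrite doubleE; lra.
Qed.

Lemma on_arcs_lift z h : on_arcs z h -> exists2 s, 0 <= s <= 1 & z = image_c s /\ h = lift_height s.
Proof.
rewrite /on_arcs => -[|[|[|[|[|]]]]].
- case=> /upper_arcP-/(_ isT)[v v01 ->] ->; exists ((v + (0.*2)%:R) / 10).
    by case/andP: v01 => ? ?; rewrite doubleE; apply/andP; split; lra.
  by rewrite lift_height_upper0.
- case=> /lower_arcP-/(_ isT)[v v01 ->] ->; exists ((2 - v + (0.*2)%:R) / 10).
    by case/andP: v01 => ? ?; rewrite doubleE; apply/andP; split; lra.
  by rewrite lift_height_lower0.
- case=> /upper_arcP-/(_ isT)[v /andP[v0 v1] ->] ->; exists ((v + (1.*2)%:R) / 10).
    by rewrite doubleE; apply/andP; split; lra.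
  by rewrite lift_height_late // doubleE; lra.
- case=> /lower_arcP-/(_ isT)[v /andP[v0 v1] ->] ->; exists ((2 - v + (1.*2)%:R) / 10).
    by rewrite doubleE; apply/andP; split; lra.
  by rewrite lift_height_late // doubleE; lra.
- case=> /upper_arcP-/(_ isT)[v /andP[v0 v1] ->] ->; exists ((v + (2.*2)%:R) / 10).
    by rewrite doubleE; apply/andP; split; lra.
  by rewrite lift_height_late // doubleE; lra.
- case=> z0 [z1 ->]; have [r /andP[r1 r6] ar] := axis_surj z1.
  exists ((11 - r) / 10); first by apply/andP; split; lra.
  have h1 : 1 / 2 <= (11 - r) / 10 by lra.
  have h2 : (11 - r) / 10 <= 1 by lra.
  have e : 11 - 10 * ((11 - r) / 10) = r by lra.
  rewrite lift_height_final // image_c_final // e ar; split=> //.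
  by rewrite {1}[z]plane_pointE z0.
Qed.
End Polygon.

(** * The six edges of the lift *)

Section SixEdges.
Variables (R : realType) (e0 e6 : R).
Local Notation P := 'rV[R]_2.
Implicit Types (x y h t : R).

(** The heights are those of [lift_height]: [bump] is 4 at the first vertex, and
    the last edge descends from ordinate 2000 to ordinate 1. *)
Definition vertex (i : nat) : 'rV[R]_(2 + 1) :=
  match i with
  | 0 => space_point (plane_point 1 0) (4 * e0)
  | 1 => space_point (plane_point (-1) 4) 0
  | 2 => space_point (plane_point 6 (-60)) 0
  | 3 => space_point (plane_point (-3) 120) 0
  | 4 => space_point (plane_point 20 (-(20 * 100))) 0
  | 5 => space_point (plane_point 0 (20 * 100)) 0
  | _ => space_point (plane_point 0 1) ((20 * 100 - 1) * e6)
  end.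

Definition on_sticks (p : 'rV[R]_(2 + 1)) : Prop :=
  exists2 i, (i < 6)%N & stick (vertex i) (vertex i.+1) p.

Lemma max3_eq1 (a b c : R) : Num.max a (Num.max b c) = 1 <->
  [/\ a <= 1, b <= 1, c <= 1 & a = 1 \/ b = 1 \/ c = 1].
Proof.
split=> [E|[a1 b1 c1 E]].
  split; rewrite -?E ?le_max ?lexx ?orbT //.
  by move: E; case: (leP b c) => bc; case: leP => ac; tauto.
by case: E => [|[|]] E; case: (leP b c) => bc; case: leP => ac; lra.
Qed.

Lemma upper_arcE j x y : upper_arc j (plane_point x y) <->
  [/\ 0 <= x, 0 <= y & match j with 0 => x + y / 2 | 1 => x / 3 + y / 60 | _ => x / 10 + y / (20 * 100) end = 1].
Proof. by rewrite /upper_arc /upper_gauge !(plane_point0, plane_point1). Qed.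

Lemma lower_arc0E x y : lower_arc 0 (plane_point x y) <->
  (x < 0 \/ y < 0) /\ [/\ - (16 / 9) * x - 7 / 36 * y <= 1, Num.min x 0 + y / 2 <= 1,
    x / 3 + Num.min y 0 / 60 <= 1 &
    - (16 / 9) * x - 7 / 36 * y = 1 \/ Num.min x 0 + y / 2 = 1 \/ x / 3 + Num.min y 0 / 60 = 1].
Proof.
rewrite /lower_arc /lower_gauge /chord /upper_gauge !(plane_point0, plane_point1).
by rewrite max3_eq1.
Qed.

Lemma lower_arc1E x y : lower_arc 1 (plane_point x y) <->
  (x < 0 \/ y < 0) /\ [/\ - (53 / 90) * x - 23 / (60 * 60) * y <= 1, Num.min x 0 / 3 + y / 60 <= 1,
    x / 10 + Num.min y 0 / (20 * 100) <= 1 &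
    - (53 / 90) * x - 23 / (60 * 60) * y = 1 \/ Num.min x 0 / 3 + y / 60 = 1 \/
    x / 10 + Num.min y 0 / (20 * 100) = 1].
Proof.
rewrite /lower_arc /lower_gauge /chord /upper_gauge !(plane_point0, plane_point1).
by rewrite max3_eq1.
Qed.

Lemma bumpE x y : bump (plane_point x y) = Num.max 0 (4 * x + y).
Proof. by rewrite /bump plane_point0 plane_point1. Qed.

Lemma bump_leftE x y : bump_left (plane_point x y) = if x <= y then Num.max 0 (4 * x + y) else 0.
Proof. by rewrite /bump_left bumpE plane_point0 plane_point1. Qed.

Let point_on_edge (i : nat) x y h : (i < 6)%N ->
  stick (vertex i) (vertex i.+1) (space_point (plane_point x y) h) ->
  on_sticks (space_point (plane_point x y) h).
Proof. by move=> i6 hs; exists i. Qed.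

Let ine t : 0 <= t -> t <= 1 -> 0 <= t <= 1. Proof. by move=> -> ->. Qed.

(** A point of a lower turn lies on the edge whose form is the maximal one; the two
    other inequalities bound its position on that edge. *)
Lemma arcs_on_sticks x y h : on_arcs e0 e6 (plane_point x y) h ->
  on_sticks (space_point (plane_point x y) h).
Proof.
rewrite /on_arcs !upper_arcE lower_arc0E lower_arc1E bumpE bump_leftE.
rewrite plane_point0 plane_point1.
case=> [[[x0 y0 g1] ->]|[[[n0 [g1 g2 g3 gE]] ->]|[[[x0 y0 g1] ->]|[[[n0 [g1 g2 g3 gE]] ->]|[[[x0 y0 g1] ->]|[-> [/andP[y0 y1] ->]]]]]]].
- have xE : x = 1 - y / 2 by lra.
  apply: (@point_on_edge 0) => //; apply/stick_space_pointP; exists (y / 4); first by apply: ine; lra.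
  by rewrite max_r; [split; rewrite ?xE; lra|lra].
- case: gE => [gE|[gE|gE]].
  + have yE : y = - (36 + 64 * x) / 7 by lra.
    have x1 : -1 <= x.
      by move: g2; case: (leP x 0) => hx; [lra|lra].
    have x6 : x <= 6.
      have [hx|hx] := leP x 0; first by lra.
      by case: n0 => n0; [lra|move: g3; rewrite (min_l (ltW n0)); lra].
    have -> : (if x <= y then Num.max 0 (4 * x + y) else 0) = 0.
      by case: ifP => // _; rewrite max_l //; lra.
    rewrite mulr0; apply: (@point_on_edge 1) => //; apply/stick_space_pointP.
    by exists ((x + 1) / 7); [apply: ine; lra|split; lra].
  + have x0 : x < 0 by case: n0 => // n0; move: gE; case: (leP x 0) => hx; lra.
    rewrite (min_l (ltW x0)) in gE; have xE : x = 1 - y / 2 by lra.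
    have y4 : y <= 4 by lra.
    have -> : x <= y by lra.
    apply: (@point_on_edge 0) => //; apply/stick_space_pointP; exists (y / 4); first by apply: ine; lra.
    by rewrite max_r; [split; rewrite ?xE; lra|lra].
  + have x3 : 3 <= x by move: gE; case: (leP y 0) => hy; lra.
    have y0 : y < 0 by case: n0 => // n0; lra.
    rewrite (min_l (ltW y0)) in gE.
    have -> : x <= y = false by apply/negbTE; rewrite -ltNge; lra.
    rewrite mulr0; apply: (@point_on_edge 2) => //; apply/stick_space_pointP.
    by exists ((6 - x) / 9); [apply: ine; lra|split; lra].
- apply: (@point_on_edge 2) => //; apply/stick_space_pointP.
  by exists ((6 - x) / 9); [apply: ine; lra|split; lra].
- case: gE => [gE|[gE|gE]].
  + apply: (@point_on_edge 3) => //; apply/stick_space_pointP.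
    have yE : y = - ((60 * 60) + (40 * 53) * x) / 23 by lra.
    have x1 : -3 <= x by move: g2; case: (leP x 0) => hx; lra.
    have x20 : x <= 20.
      have [hx|hx] := leP x 0; first by lra.
      by case: n0 => n0; [lra|move: g3; rewrite (min_l (ltW n0)); lra].
    by exists ((x + 3) / 23); [apply: ine; lra|split; lra].
  + have x0 : x < 0 by case: n0 => // n0; move: gE; case: (leP x 0) => hx; lra.
    rewrite (min_l (ltW x0)) in gE.
    apply: (@point_on_edge 2) => //; apply/stick_space_pointP.
    by exists ((6 - x) / 9); [apply: ine; lra|split; lra].
  + have x3 : 3 <= x by move: gE; case: (leP y 0) => hy; lra.
    have y0 : y < 0 by case: n0 => // n0; lra.
    rewrite (min_l (ltW y0)) in gE.
    apply: (@point_on_edge 4) => //; apply/stick_space_pointP.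
    by exists ((20 - x) / 20); [apply: ine; lra|split; lra].
- apply: (@point_on_edge 4) => //; apply/stick_space_pointP.
  by exists ((20 - x) / 20); [apply: ine; lra|split; lra].
- apply: (@point_on_edge 5) => //; apply/stick_space_pointP.
  by exists (((20 * 100) - y) / 1999); [apply: ine; lra|split; lra].
Qed.

Lemma sticks_on_arcs x y h : on_sticks (space_point (plane_point x y) h) ->
  on_arcs e0 e6 (plane_point x y) h.
Proof.
rewrite /on_arcs !upper_arcE lower_arc0E lower_arc1E bumpE bump_leftE.
rewrite plane_point0 plane_point1.
case=> -[|[|[|[|[|[|//]]]]]] _ /stick_space_pointP[t /andP[t0 t1] [xE yE hE]].
- have [c|c] := leP t (1 / 2).
    by left; rewrite max_r; [split; [split; lra|rewrite hE xE yE; ring]|lra].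
  right; left; split.
    split; first by left; lra.
    by split; [lra|rewrite min_l; lra|case: (leP y 0) => hy; lra|right; left; rewrite min_l; lra].
  have -> : x <= y by lra.
  by rewrite max_r; [rewrite hE xE yE; ring|lra].
- right; left; split.
    split; first by have [?|?] := ltP x 0; [left|right; lra].
    split; [lra| | |left; lra].
      by case: (leP x 0) => hx; lra.
    by case: (leP y 0) => hy; lra.
  have -> : (if x <= y then Num.max 0 (4 * x + y) else 0) = 0.
    by case: ifP => // _; rewrite max_l //; lra.
  by rewrite mulr0 hE; ring.
- have [c|c] := ltP t (1 / 3).
    right; left; split.
      split; first by right; lra.
      split; [lra| | |right; right; rewrite min_l; lra].
        by case: (leP x 0) => hx; lra.
      by case: (leP y 0) => hy; lra.
    have -> : x <= y = false by apply/negbTE; rewrite -ltNge; lra.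
    by rewrite mulr0 hE; ring.
  have [c'|c'] := leP t (2 / 3).
    by right; right; left; split; [split; lra|rewrite hE; ring].
  do 3 right; left; split; last by rewrite hE; ring.
  split; first by left; lra.
  split; [lra| | |right; left; rewrite min_l; lra].
    by case: (leP x 0) => hx; lra.
  by case: (leP y 0) => hy; lra.
- do 3 right; left; split; last by rewrite hE; ring.
  split; first by have [?|?] := ltP x 0; [left|right; lra].
  split; [lra| | |left; lra].
    by case: (leP x 0) => hx; lra.
  by case: (leP y 0) => hy; lra.
- have [c|c] := ltP t (1 / 2).
    do 3 right; left; split; last by rewrite hE; ring.
    split; first by right; lra.
    split; [lra| | |right; right; rewrite min_l; lra].
      by case: (leP x 0) => hx; lra.
    by case: (leP y 0) => hy; lra.
  by do 4 right; left; split; [split; lra|rewrite hE; ring].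
- by do 5 right; split; [lra|split; [apply/andP; split; lra|rewrite hE yE; lra]].
Qed.
End SixEdges.

(** * Polygonal paths *)

Section PolygonalPath.
Variables (R : realType) (V : nat -> 'rV[R]_(2 + 1)).
Implicit Types (x u s : R) (i m : nat).

Lemma clamp_ge1 x : 1 <= x -> clamp x = 1.
Proof. by move=> x1; rewrite /clamp (min_l x1) max_r // ler01. Qed.

Lemma clamp_le0 x : x <= 0 -> clamp x = 0.
Proof. by move=> x0; rewrite /clamp max_l // ge_min x0 orbT. Qed.

(** Unit speed along the edges: the vertex V i is reached at time i. *)
Fixpoint polyline m x : 'rV[R]_(2 + 1) :=
  if m is m'.+1 then polyline m' x + clamp (x - m'%:R) *: (V m - V m') else V 0.

Definition edge_point i u := (1 - u) *: V i + u *: V i.+1.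

Lemma polyline_end m x : m%:R <= x -> polyline m x = V m.
Proof.
elim: m => [//|m IH] mx; rewrite /= IH; last by apply: le_trans mx; rewrite ler_nat.
by rewrite clamp_ge1 ?scale1r ?subrKC // lerBrDr addrC natr1.
Qed.

Lemma polyline_edge m i u : (i < m)%N -> 0 <= u <= 1 -> polyline m (i%:R + u) = edge_point i u.
Proof.
move=> + u01; elim: m => [//|m IH]; rewrite ltnS leq_eqVlt => /predU1P[->|im] /=.
  rewrite polyline_end; last by rewrite lerDl; case/andP: u01.
  have -> : m%:R + u - m%:R = u by ring.
  by rewrite clamp_id // /edge_point scalerBl scale1r scalerBr addrAC addrA.
rewrite IH // clamp_le0 ?scale0r ?addr0 //.
have : i.+1%:R <= m%:R :> R by rewrite ler_nat.
by rewrite -natr1; case/andP: u01 => ? ?; lra.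
Qed.

Lemma edge_of m x : (0 < m)%N -> 0 <= x <= m%:R ->
  exists i : 'I_m, exists2 u, 0 <= u <= 1 & x = i%:R + u.
Proof.
elim: m => [//|[|m] IH] _ /andP[x0 xm].
  by exists ord0, x; [rewrite x0|rewrite add0r].
have [h|h] := leP x m.+1%:R.
  have [|i [u u01 ->]] := IH isT; first by rewrite x0.
  by exists (widen_ord (leqnSn _) i), u.
exists ord_max, (x - m.+1%:R); last by rewrite /= addrC subrK.
by move: xm; rewrite -[m.+2%:R]natr1 => xm; apply/andP; split; lra.
Qed.

Variables (n : nat) (n0 : (0 < n)%N).

Lemma polyline01 s : s \in `[0, 1] -> exists i : 'I_n, exists2 u, 0 <= u <= 1 &
  n%:R * s = i%:R + u /\ polyline n (n%:R * s) = edge_point i u.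
Proof.
rewrite in_itv /= => /andP[s0 s1].
have [|i [u u01 e]] := @edge_of n (n%:R * s) n0.
  by rewrite mulr_ge0 //= ler_piMr.
by exists i, u => //; rewrite e polyline_edge.
Qed.

Lemma polyline_PL : PL_curve (fun s => polyline n (n%:R * s)).
Proof.
move=> x0 /= _.
pose P (i : 'I_n) : set 'rV[R]_1 := [set y | i%:R <= n%:R * y 0 0 <= i%:R + 1].
exists n, P; split.
- move=> i; exists 2%N, (\row_j [:: - n%:R; n%:R]`_j), (\row_j [:: - i%:R; i%:R + 1]`_j).
  have mxE' (y : 'rV[R]_1) (M : 'M[R]_(1, 2)) j : (y *m M) 0 j = y 0 0 * M 0 j.
    by rewrite mxE big_ord1.
  apply/seteqP; split=> y /=.
    move=> /andP[y0 y1] j; rewrite mxE' !mxE; case: j => [[|[|//]] j] /=.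
      by rewrite mulrN lerN2 mulrC.
    by rewrite mulrC.
  move=> h; have := h ord0; have := h (fintype.lift ord0 ord0); rewrite !mxE' !mxE /=.
  by move=> h1 h0; rewrite /P /= mulrC h1 -lerN2 -mulrN h0.
- apply: (@filterE _ (nbhs x0) (nbhs_filter x0)) => y /= y01.
  have [|i [u u01 e]] := @edge_of n (n%:R * y 0 0) n0.
    by case/andP: y01 => y0 y1; rewrite mulr_ge0 //= ler_piMr.
  by exists i; rewrite /P /= e; case/andP: u01 => ? ?; apply/andP; split; lra.
- move=> i; exists (n%:R *: (V i.+1 - V i)), (V i - i%:R *: (V i.+1 - V i)) => y _ /= /andP[y0 y1].
  have u01 : 0 <= n%:R * y 0 0 - i%:R <= 1 by apply/andP; split; lra.
  have -> : n%:R * y 0 0 = i%:R + (n%:R * y 0 0 - i%:R) by ring.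
  rewrite polyline_edge // /edge_point [y in RHS]mx11_scalar mul_scalar_mx scalerA mulrC.
  by apply/rowP => j; rewrite !mxE; ring.
Qed.

Lemma polyline_image : (fun s => polyline n (n%:R * s)) @` `[0, 1] =
  \bigcup_(i : 'I_n) stick (V i) (V i.+1).
Proof.
have nn0 : n%:R != 0 :> R by rewrite pnatr_eq0 -lt0n.
apply/seteqP; split=> [_ [s s01 <-]|p [i _ [u]]].
  have [i [u u01 [_ ->]]] := polyline01 s01.
  by exists i => //; exists u => //=; rewrite in_itv.
rewrite /= in_itv /= => u01 <-; exists ((i%:R + u) / n%:R).
  rewrite /= in_itv /= ler_pdivlMr ?ltr0n // mul0r ler_pdivrMr ?ltr0n // mul1r.
  case/andP: u01 => u0 u1; rewrite addr_ge0 //=.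
  have : i.+1%:R <= n%:R :> R by rewrite ler_nat.
  by rewrite -natr1; lra.
by rewrite mulrC divfK // polyline_edge.
Qed.

(** A polygonal path is simple as soon as its edges meet only where consecutive
    ones share an endpoint. *)
Lemma polyline_inj :
  (forall (i j : nat) u w, (i <= j)%N -> (j < n)%N -> 0 <= u <= 1 -> 0 <= w <= 1 ->
     edge_point i u = edge_point j w -> i%:R + u = j%:R + w) ->
  {in `[0, 1] &, injective (fun s => polyline n (n%:R * s))}.
Proof.
move=> h s s' /polyline01[i [u u01 [e ->]]] /polyline01[j [w w01 [e' ->]]] E.
have nn0 : n%:R != 0 :> R by rewrite pnatr_eq0 -lt0n.
apply: (mulfI nn0); rewrite e e'; have [ij|/ltnW ij] := leqP i j; first exact: h.
by apply/esym/h.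
Qed.
End PolygonalPath.

(** * The model rail arc *)

Section ModelArc.
Variables (R : realType) (e0 e6 : R).
Hypotheses (e06 : 2 * e0 != (20 * 100 - 2) * e6) (e6n0 : e6 != 0).

(** In the plane non-consecutive edges are disjoint, except that the last one crosses
    the first one at (0,2) and the third one at (0,60); the heights differ there. *)
Lemma edges_meet (i j : nat) (u w : R) : (i <= j)%N -> (j < 6)%N ->
  0 <= u <= 1 -> 0 <= w <= 1 ->
  edge_point (vertex e0 e6) i u = edge_point (vertex e0 e6) j w -> i%:R + u = j%:R + w.
Proof.
move=> ij j6 /andP[u0 u1] /andP[w0 w1].
case: i ij => [|[|[|[|[|[|i]]]]]]; case: j j6 => [|[|[|[|[|[|j]]]]]] // _ _;
  rewrite /edge_point /= !affine_space_point =>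
  /space_point_inj[/plane_point_inj[ex ey] eh].
all: try (clear eh; lra).
- exfalso; have uE : u = 1 / 2 by lra.
  move: eh; rewrite uE => eh; case/eqP: e06.
  have wE : w * (20 * 100 - 1) = 20 * 100 - 2 by lra.
  have : w * ((20 * 100 - 1) * e6) = (20 * 100 - 2) * e6 by rewrite mulrA wE.
  lra.
- exfalso; have uE : u = 2 / 3 by lra.
  move: eh; rewrite uE => eh; case/eqP: e6n0.
  have wE : w * (20 * 100 - 1) = 20 * 97 by lra.
  have : w * ((20 * 100 - 1) * e6) = 20 * 97 * e6 by rewrite mulrA wE.
  lra.
Qed.

Definition model_arc : set 'rV[R]_(2 + 1) :=
  \bigcup_(i : 'I_6) stick (vertex e0 e6 i) (vertex e0 e6 i.+1).

Lemma edge_rail1 i u : (i < 6)%N -> 0 <= u <= 1 ->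
  plane_proj (edge_point (vertex e0 e6) i u) = plane_point 1 0 -> i%:R + u = 0.
Proof.
move=> i6 /andP[u0 u1].
case: i i6 => [|[|[|[|[|[|i]]]]]] // _;
  rewrite /edge_point /= affine_space_point proj_space_point => /plane_point_inj[ex ey]; lra.
Qed.

Lemma edge_rail2 i u : (i < 6)%N -> 0 <= u <= 1 ->
  plane_proj (edge_point (vertex e0 e6) i u) = plane_point 0 1 -> i%:R + u = 6.
Proof.
move=> i6 /andP[u0 u1].
case: i i6 => [|[|[|[|[|[|i]]]]]] // _;
  rewrite /edge_point /= affine_space_point proj_space_point => /plane_point_inj[ex ey]; lra.
Qed.

(** The vertical lines over the first and the last vertex are met nowhere else. *)
Lemma model_rail_arc : rail_arc (plane_point 1 0) (plane_point 0 1) model_arc.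
Proof.
pose k (s : R) := polyline (vertex e0 e6) 6 (6%:R * s).
have at_edge (s : R) : 0 <= s <= 1 -> exists i : 'I_6, exists2 u, 0 <= u <= 1 &
    6%:R * s = i%:R + u /\ k s = edge_point (vertex e0 e6) i u.
  by move=> s01; apply: polyline01.
exists k; split.
- exact: polyline_PL.
- by apply: polyline_inj => // i j u w; exact: edges_meet.
- by rewrite [RHS]polyline_image.
- have i0 : 0 <= (0 : R) <= 1 by rewrite lexx ler01.
  split; rewrite /rail /= /k ?mulr0 ?mulr1.
    have := @polyline_edge R (vertex e0 e6) 6 0 0 isT i0.
    by rewrite addr0 /edge_point subr0 scale1r scale0r addr0 => ->; rewrite proj_space_point.
  by rewrite polyline_end // proj_space_point.
- move=> s /andP[s0 s1]; have [|i [u u01 [e ->]]] := at_edge s; first by rewrite !ltW.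
  split=> h; [have := edge_rail1 (ltn_ord i) u01 h|have := edge_rail2 (ltn_ord i) u01 h]; lra.
Qed.

Lemma vertex_neq i : (i < 6)%N -> vertex e0 e6 i != vertex e0 e6 i.+1.
Proof.
by case: i => [|[|[|[|[|[|i]]]]]] // _; apply/eqP => /space_point_inj[/plane_point_inj[ex ey] _]; lra.
Qed.

Lemma model_arc_sticks : union_of_sticks 6 model_arc.
Proof.
exists (fun i => vertex e0 e6 i), (fun i => vertex e0 e6 i.+1); split=> // i.
exact: vertex_neq.
Qed.

Lemma model_arc_lift : model_arc = spiral_lift e0 e6 @` `[0, 1].
Proof.
have sE p : model_arc p <-> on_sticks e0 e6 p.
  split=> [[i _ h]|[i i6 h]]; first by exists i.
  by exists (Ordinal i6).
have E p : p = space_point (plane_point (plane_proj p 0 0) (plane_proj p 0 1)) (height p).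
  by rewrite -plane_pointE -space_pointE.
apply/seteqP; split=> p.
  move/sE; rewrite [p]E => /sticks_on_arcs/on_arcs_lift[s s01 [-> ->]].
  by exists s; rewrite /= ?in_itv.
move=> [s]; rewrite /= in_itv /= => s01 <-; apply/sE; rewrite /spiral_lift [image_c s]plane_pointE.
by apply: arcs_on_sticks; rewrite -plane_pointE; exact: lift_on_arcs.
Qed.
End ModelArc.

(** * Double points and crossings *)

Section DoublePoints.
Variable R : realType.
Implicit Types (s u v : R).

Lemma continuous_curve_c : continuous (@curve_c R).
Proof.
have -> : @curve_c R = fun s => archimedean (10 * Num.min s (1 / 2)) +
    plane_point (10 * Num.max s (1 / 2) - 5) 0.
  apply/funext => s; have [h|/ltW h] := leP s (1 / 2).
    rewrite curve_c_spiral //; set z := archimedean _.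
    have -> : plane_point (10 * (1 / 2) - 5) 0 = 0 :> 'rV[R]_2.
      by apply/rowP => i; rewrite !mxE; case: i => [[|[|//]] i] /=; lra.
    by rewrite addr0.
  have hh : 1 / 2 <= 1 / 2 :> R by [].
  rewrite -curve_c_spiral // !curve_c_final //.
  by apply/rowP => i; rewrite !mxE; case: i => [[|[|//]] i] /=; lra.
have c1 : continuous (fun s : R => archimedean (10 * Num.min s (1 / 2))).
  apply: continuous_plane_point; apply: continuous_mul; [by ctn| |by ctn|].
    by apply: (@continuous_compose _ _ _ _ cos); [ctn|exact: continuous_cos].
  by apply: (@continuous_compose _ _ _ _ sin); [ctn|exact: continuous_sin].
have c2 : continuous (fun s : R => plane_point (10 * Num.max s (1 / 2) - 5) 0).
  by apply: continuous_plane_point; ctn.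
by move=> s; apply: cvgD; [exact: c1|exact: c2].
Qed.

Lemma archimedean_norm v : archimedean v 0 0 * archimedean v 0 0 +
  archimedean v 0 1 * archimedean v 0 1 = (1 + v) * (1 + v).
Proof.
rewrite plane_point0 plane_point1; have := cos2Dsin2 (pi * v); rewrite !expr2.
by move: (cos _) (sin _) => c d e; rewrite -[RHS]mulr1 -e; ring.
Qed.

Lemma cos_pi_eq v u : 0 <= v <= 1 -> 0 <= u <= 1 -> cos (pi * v) = cos (pi * u) -> v = u.
Proof.
move=> /andP[v0 v1] /andP[u0 u1] e; have p0 := pi_gt0 R.
apply: (mulfI (lt0r_neq0 p0)); apply: cos_inj e; rewrite in_itv /=; apply/andP; split; nra.
Qed.

Lemma cos_pi_eqN1 v : 0 <= v < 5 -> cos (pi * v) = -1 -> v = 1 \/ v = 3.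
Proof.
move=> /andP[v0 v5] e.
have half (n : nat) : n%:R <= v < n%:R + 1 -> odd n /\ v = n%:R.
  move=> /andP[n0 n1]; have vE : v = (v - n%:R) + n%:R by ring.
  have w01 : 0 <= v - n%:R <= 1 by apply/andP; split; lra.
  move: e; rewrite vE cos_pi_nat -signr_odd; case: (odd n) => /= e.
    have e1 : cos (pi * (v - n%:R)) = cos (pi * 0) by rewrite mulr0 cos0; lra.
    by have := cos_pi_eq w01 _ e1; rewrite lexx ler01 => /(_ isT); lra.
  have e1 : cos (pi * (v - n%:R)) = cos (pi * 1) by rewrite mulr1 cospi; lra.
  by have := cos_pi_eq w01 _ e1; rewrite lexx ler01 => /(_ isT); lra.
have [h1|h1] := ltP v 1; first by have [|//] := half 0%N; apply/andP; split; lra.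
have [h2|h2] := ltP v 2; first by left; have [|//] := half 1%N; apply/andP; split; lra.
have [h3|h3] := ltP v 3; first by have [|//] := half 2%N; apply/andP; split; lra.
have [h4|h4] := ltP v 4; first by right; have [|//] := half 3%N; apply/andP; split; lra.
by have [|//] := half 4%N; apply/andP; split; lra.
Qed.

(** At a double point the distances to the origin agree, so the points lie on
    different pieces of the curve, and the spiral is on the negative axis, which it
    meets after an odd number of half turns. *)
Lemma curve_c_double s s' : 0 <= s -> s < s' -> s' <= 1 -> curve_c s = curve_c s' ->
  (s = 1 / 10 /\ s' = 9 / 10) \/ (s = 3 / 10 /\ s' = 7 / 10).
Proof.
move=> s0 ss s1; have [h'|h'] := leP s' (1 / 2).
  have h : s <= 1 / 2 by lra.
  rewrite !curve_c_spiral // => e; exfalso.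
  by have := archimedean_norm (10 * s); rewrite e archimedean_norm; nra.
have [h|h] := leP s (1 / 2); last first.
  by rewrite !curve_c_final ?(ltW h) ?(ltW h') // => /plane_point_inj[e _]; exfalso; lra.
rewrite curve_c_spiral // curve_c_final ?(ltW h') // => e.
have := archimedean_norm (10 * s); rewrite e !(plane_point0, plane_point1) => r.
have r' : 1 + 10 * s = 11 - 10 * s'.
  have : (1 + 10 * s - (11 - 10 * s')) * (1 + 10 * s + (11 - 10 * s')) = 0 by nra.
  by move/eqP; rewrite mulf_eq0 => /orP[] /eqP; lra.
move: e => /plane_point_inj[e _].
have c : cos (pi * (10 * s)) = -1.
  by apply: (@mulfI _ (1 + 10 * s)); [rewrite gt_eqF //; lra|rewrite e; lra].
have [|v1|v3] := @cos_pi_eqN1 (10 * s) _ c; first by apply/andP; split; lra.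
  by left; lra.
by right; lra.
Qed.
End DoublePoints.

Section Lift.
Variables (R : realType) (e0 e6 : R).
Local Notation P := 'rV[R]_2.

Lemma deformation_continuous (K : P -> P) : deformation K -> continuous K.
Proof.
move=> [H [_ [Hc _ _ H1 _]]].
have -> : K = fun z => H 1 z by apply/funext.
have c : continuous (fun z : P => ((1 : R), z)).
  by apply: continuous_pair_fun; ctn.
exact: (continuous_compose c Hc).
Qed.

Lemma continuous_space_point (T : topologicalType) (z : T -> P) (h : T -> R) :
  continuous z -> continuous h -> continuous (fun x => space_point (z x) (h x)).
Proof.
move=> zc hc; apply: continuous_row => j; rewrite /space_point; under eq_fun do rewrite mxE.
case: (fintype.split j) => k; first exact: continuous_coord.
have e : (fun x => ((h x)%:M : 'M[R]_1) 0 k) = h.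
  by apply/funext => x; rewrite [k]ord1 mxE eqxx.
rewrite [X in continuous X]e; exact: hc.
Qed.

Lemma continuous_image_c : continuous (@image_c R).
Proof.
exact: (continuous_compose (@continuous_curve_c R) (deformation_continuous (deformation_straighten R))).
Qed.

Lemma continuous_spiral_lift : continuous (spiral_lift e0 e6).
Proof.
apply: continuous_space_point; first exact: continuous_image_c.
have c1 : continuous (fun s : R => image_c (Num.min s (3 / 20))).
  by apply: (@continuous_compose _ _ _ _ (@image_c R)); [ctn|exact: continuous_image_c].
have c2 : continuous (fun s : R => image_c (Num.max s (1 / 2))).
  by apply: (@continuous_compose _ _ _ _ (@image_c R)); [ctn|exact: continuous_image_c].
have c10 := @continuous_coord R _ _ _ 0 c1; have c11 := @continuous_coord R _ _ _ 1 c1.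
have c21 := @continuous_coord R _ _ _ 1 c2.
have cst (a : R) : continuous (fun _ : R => a) := @continuous_cst_fun R R a.
rewrite /lift_height /bump; apply: continuous_add.
  apply: continuous_mul; first exact: cst.
  apply: continuous_maxr; first exact: cst.
  by apply: continuous_add; [apply: continuous_mul; [exact: cst|exact: c10]|exact: c11].
apply: continuous_mul; first exact: cst.
by apply: continuous_add; [exact: cst|apply: continuous_opp; exact: c21].
Qed.

Lemma straighten_inj : injective (@straighten R).
Proof.
have [H [G [_ _ _ H1 HG]]] := deformation_straighten R.
by move=> z w; rewrite -!H1 => /(can_inj (HG 1).1).
Qed.

Lemma curve_c_crossing1 : curve_c (9 / 10) = plane_point (-2) 0 :> P.
Proof. by rewrite curve_c_final; [congr plane_point; lra|lra]. Qed.

Lemma curve_c_crossing2 : curve_c (7 / 10) = plane_point (-4) 0 :> P.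
Proof. by rewrite curve_c_final; [congr plane_point; lra|lra]. Qed.

Lemma curve_c_crossing1' : curve_c (1 / 10) = plane_point (-2) 0 :> P.
Proof.
have h : 1 / 10 <= 1 / 2 :> R by lra.
have e : 10 * (1 / 10) = 1 :> R by lra.
by rewrite curve_c_spiral // e /archimedean mulr1 cospi sinpi; congr plane_point; lra.
Qed.

Lemma curve_c_crossing2' : curve_c (3 / 10) = plane_point (-4) 0 :> P.
Proof.
have h : 3 / 10 <= 1 / 2 :> R by lra.
have e : 10 * (3 / 10) = 1 + 2%:R :> R by lra.
rewrite curve_c_spiral // e /archimedean cos_pi_nat sin_pi_nat mulr1 cospi sinpi.
by congr plane_point; rewrite -signr_odd /=; lra.
Qed.

Lemma lift_height_crossings :
  [/\ lift_height e0 e6 (1 / 10) = 2 * e0, lift_height e0 e6 (9 / 10) = (20 * 100 - 2) * e6,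
      lift_height e0 e6 (3 / 10) = 0 & lift_height e0 e6 (7 / 10) = (20 * 100 - 60) * e6].
Proof.
split.
- have h : 1 / 10 <= 1 / 2 :> R by lra.
  have h' : 1 / 10 <= 3 / 20 :> R by lra.
  have h9 : 1 / 2 <= 9 / 10 :> R by lra.
  have h9' : 9 / 10 <= 1 :> R by lra.
  have e : 11 - 10 * (9 / 10) = 2 :> R by lra.
  rewrite lift_height_spiral // (min_l h') /image_c curve_c_crossing1' -curve_c_crossing1 -/(image_c (9 / 10)).
  rewrite image_c_final // e axis2 /bump plane_point0 plane_point1 max_r; last by lra.
  by ring.
- have h9 : 1 / 2 <= 9 / 10 :> R by lra.
  have h9' : 9 / 10 <= 1 :> R by lra.
  have e : 11 - 10 * (9 / 10) = 2 :> R by lra.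
  by rewrite lift_height_final // e axis2 mulrC.
- by rewrite lift_height_late //; lra.
- have h9 : 1 / 2 <= 7 / 10 :> R by lra.
  have h9' : 7 / 10 <= 1 :> R by lra.
  have e : 11 - 10 * (7 / 10) = 4 :> R by lra.
  by rewrite lift_height_final // e axis4 mulrC.
Qed.

Hypotheses (e06 : 2 * e0 != (20 * 100 - 2) * e6) (e6n0 : e6 != 0).

(** The straightening is injective, so only the double points of the curve matter,
    and the two strands have different heights over them. *)
Lemma spiral_lift_inj : {in `[0, 1] &, injective (spiral_lift e0 e6)}.
Proof.
have lt_neq (s s' : R) : 0 <= s -> s < s' -> s' <= 1 -> spiral_lift e0 e6 s <> spiral_lift e0 e6 s'.
  move=> s0 ss s1 /space_point_inj[/straighten_inj e eh].
  have [h1 h9 h3 h7] := lift_height_crossings.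
  case: (curve_c_double s0 ss s1 e) eh => -[-> ->]; rewrite ?(h1, h9, h3, h7) => eh.
    by case/eqP: e06.
  by case/eqP: e6n0; lra.
move=> s s'; rewrite !in_itv /= => /andP[s0 s1] /andP[s0' s1'] e.
case: (ltgtP s s') => // ss; exfalso; first exact: (lt_neq s s' s0 ss s1' e).
exact: (lt_neq s' s s0' ss s1 (esym e)).
Qed.

Lemma spiral_lift0 : plane_proj (spiral_lift e0 e6 0) = plane_point 1 0.
Proof.
rewrite proj_space_point.
have e : 0 = (0 + (0.*2)%:R) / 10 :> R by rewrite double0 addr0 mul0r.
by rewrite [X in image_c X]e image_c_upper ?lexx ?ler01 // target0 //= scale1r fold_unit_vector0.
Qed.

Lemma spiral_lift1 : plane_proj (spiral_lift e0 e6 1) = plane_point 0 1.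
Proof.
have h : 1 / 2 <= 1 :> R by lra.
have e : 11 - 10 * 1 = 1 :> R by lra.
by rewrite proj_space_point image_c_final // e axis1.
Qed.
End Lift.

(** * Diagrams drawn with six sticks *)

Section Drawings.
Variable R : realType.
Local Notation P := 'rV[R]_2.
Local Notation P3 := 'rV[R]_(2 + 1).
Implicit Types (p q z w : P) (D : diagram R) (s t : R).

(** The planar isotopy is kept in the stronger form of [deformation], which composes
    and inverts freely. *)
Definition drawing (p1 p2 : P) D (r : set P3) : Prop :=
  [/\ rail_arc p1 p2 r, union_of_sticks 6 r &
    exists (g : R -> P3) (K : P -> P),
    [/\ [/\ {within `[0, 1], continuous g}, {in `[0, 1] &, injective g},
            r = g @` `[0, 1] & rail p1 (g 0) /\ rail p2 (g 1)],
        deformation K,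
        forall s : R, 0 <= s <= 1 -> K (plane_proj (g s)) = curve D s
      & forall s s' : R, 0 <= s <= 1 -> 0 <= s' <= 1 -> s != s' ->
          curve D s = curve D s' ->
          (passes_over D s s' <-> height (g s') < height (g s))]].

Definition drawable p1 p2 D : Prop := exists r, drawing p1 p2 D r.

Lemma drawing_lifts p1 p2 D r : drawing p1 p2 D r -> lifts p1 p2 D r.
Proof.
move=> [arc _ [g [K [gP /deformation_ambient[H [HA H1]] Kg cross]]]]; split=> //.
by exists g, H; split=> // s s01; rewrite H1 Kg.
Qed.

Lemma polyhedronT m : polyhedron (setT : set 'rV[R]_m).
Proof. by exists 0%N, 0, 0; apply/seteqP; split=> // x _ []. Qed.

(** The constant isotopy is piecewise linear with a single piece. *)
Lemma rail_isotopic_refl p1 p2 (r : set P3) : rail_isotopic p1 p2 r r.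
Proof.
have idPL : PL_track (fun _ : R => id : P3 -> P3).
  move=> x _; exists 1%N, (fun _ => setT); split=> [i||i]; first exact: polyhedronT.
    by apply: (@filterE _ (nbhs x) (nbhs_filter x)) => y _; exists ord0.
  exists (col_mx 1%:M 0), 0 => y _ _.
  by rewrite -{2}[y]hsubmxK mul_row_col mulmx1 mulmx0 !addr0.
exists (fun _ => id); split=> [|t _|]; last by rewrite image_id.
  by split=> //; exists (fun _ => id); split.
by rewrite !image_id.
Qed.

Lemma drawing_class p1 p2 D r : drawing p1 p2 D r -> rail_arc_class p1 p2 D r.
Proof.
move=> h; split; first by case: h.
by exists r; [exact: drawing_lifts|exact: rail_isotopic_refl].
Qed.

Section SpaceMap.
Variables (M : 'M[R]_2) (v : P) (b : bool).

Definition plane_affine z : P := z *m M + v.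

Definition space_affine (x : P3) : P3 :=
  space_point (plane_affine (plane_proj x)) ((-1) ^+ b * height x).

Definition space_matrix : 'M[R]_(2 + 1) := block_mx M 0 0 ((-1) ^+ b)%:M.

Lemma space_affineE x : space_affine x = x *m space_matrix + row_mx v 0.
Proof.
rewrite /space_matrix -{2}[x]hsubmxK mul_row_block !mulmx0 addr0 add0r add_row_mx addr0.
congr row_mx; apply/rowP => i; rewrite [i]ord1 mul_mx_scalar !mxE eqxx mulr1n.
by rewrite /height mxE.
Qed.

Lemma space_affine_comb t x y :
  space_affine ((1 - t) *: x + t *: y) = (1 - t) *: space_affine x + t *: space_affine y.
Proof.
rewrite !space_affineE mulmxDl -!scalemxAl !scalerDr addrACA; congr (_ + _).
by rewrite -scalerDl subrK scale1r.
Qed.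

Lemma space_affine_stick x y : space_affine @` stick x y = stick (space_affine x) (space_affine y).
Proof.
apply/seteqP; split=> [_ [_ [t t01 <-] <-]|_ [t t01 <-]].
  by exists t => //; rewrite space_affine_comb.
by exists ((1 - t) *: x + t *: y); [exists t|rewrite space_affine_comb].
Qed.

Lemma space_affine_PL (g : R -> P3) : PL_curve g -> PL_curve (fun s => space_affine (g s)).
Proof.
move=> h x Dx; have [k [Q [Qp cov aff]]] := h x Dx; exists k, Q; split=> // i.
have [A [c E]] := aff i.
exists (A *m space_matrix), (c *m space_matrix + row_mx v 0) => y Dy Qy.
by rewrite /= E // space_affineE mulmxDl mulmxA addrA.
Qed.

Lemma continuous_space_affine : continuous space_affine.
Proof.
rewrite (_ : space_affine = fun x => x *m space_matrix + row_mx v 0); last first.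
  by apply/funext => x; exact: space_affineE.
apply: continuous_row => j; under eq_fun do rewrite mxE.
by apply: continuous_add; [exact: continuous_mulmx_coord|exact: continuous_cst_fun].
Qed.

Hypothesis plane_inj : injective plane_affine.

Lemma space_affine_inj : injective space_affine.
Proof.
move=> x y /space_point_inj[/plane_inj e].
rewrite [x]space_pointE [y]space_pointE e !height_space_point.
by move=> /(can_inj (signrMK b)) ->.
Qed.

Lemma space_affine_rail p x : rail (plane_affine p) (space_affine x) <-> rail p x.
Proof. by rewrite /rail /= proj_space_point; split=> [/plane_inj|->]. Qed.

Lemma space_affine_rail_arc p1 p2 (r : set P3) : rail_arc p1 p2 r ->
  rail_arc (plane_affine p1) (plane_affine p2) (space_affine @` r).
Proof.
move=> [k [kPL kinj kr [k0 k1] kin]]; exists (fun s => space_affine (k s)); split.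
- exact: space_affine_PL.
- by move=> s s' i i' /space_affine_inj; exact: kinj.
- by rewrite kr image_comp.
- by split; apply/space_affine_rail.
- by move=> s /kin[n1 n2]; split; move/space_affine_rail.
Qed.

Lemma space_affine_sticks n (r : set P3) : union_of_sticks n r ->
  union_of_sticks n (space_affine @` r).
Proof.
move=> [a [c [ac ->]]]; exists (fun i => space_affine (a i)), (fun i => space_affine (c i)).
split=> [i|]; first by apply: contra (ac i) => /eqP/space_affine_inj ->.
rewrite image_bigcup; apply: eq_bigcupr => i _; exact: space_affine_stick.
Qed.
End SpaceMap.

(** Sticks, rail arcs and rails are mapped to such.  The map E acts on the diagram:
    it is the identity except for the symmetry, where the planar isotopy has to be
    conjugated because a reflection is not isotopic to the identity.  Reversing the
    heights exchanges all crossings. *)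
Lemma drawing_affine (M : 'M[R]_2) (v : P) (b : bool) (L' E : P -> P) p1 p2 D D' r :
  cancel (plane_affine M v) L' -> injective E ->
  (forall K, deformation K -> deformation (fun z => E (K (L' z)))) ->
  (forall s, curve D' s = E (curve D s)) ->
  (forall s s', passes_over D' s s' =
     if b then passes_over D s' s else passes_over D s s') ->
  drawing p1 p2 D r ->
  drawing (plane_affine M v p1) (plane_affine M v p2) D' (space_affine M v b @` r).
Proof.
move=> LK Einj Kdef cD oD [arc st [g [K [[gc ginj gr [g0 g1]] Kd Kg cross]]]].
have Linj := can_inj LK; have Sinj := space_affine_inj (b := b) Linj.
split; [exact: space_affine_rail_arc|exact: space_affine_sticks|].
exists (fun s => space_affine M v b (g s)), (fun z => E (K (L' z))); split.
- split.
  + apply/subspace_continuousP => s Ds; move/subspace_continuousP: gc => /(_ s Ds) gs.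
    apply: (cvg_comp _ _ gs); exact: continuous_space_affine.
  + by move=> s s' i i' /Sinj; exact: ginj.
  + by rewrite gr image_comp.
  + by split; apply/space_affine_rail.
- exact: Kdef.
- by move=> s s01; rewrite proj_space_point LK Kg // cD.
- move=> s s' s01 s01' ss; rewrite !cD oD !height_space_point => /Einj e.
  case: b {Sinj} oD => oD; last by rewrite !mul1r; exact: cross.
  by rewrite !mulN1r ltrN2; apply: cross => //; rewrite eq_sym.
Qed.
End Drawings.

(** * Naming operations and arbitrary rails *)

Section Transport.
Variable R : realType.
Local Notation P := 'rV[R]_2.
Local Notation P3 := 'rV[R]_(2 + 1).
Implicit Types (p q z w v : P) (D : diagram R) (s t a b c d : R).

(** Transposed, because vectors are rows: the map that it defines sends (x, y) to
    (a x + b y, c x + d y). *)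
Definition matrix2 a b c d : 'M[R]_2 :=
  \matrix_(i < 2, j < 2) [:: [:: a; c]`_j; [:: b; d]`_j]`_i.

Lemma plane_affineE a b c d v z : plane_affine (matrix2 a b c d) v z =
  plane_point (a * z 0 0 + b * z 0 1 + v 0 0) (c * z 0 0 + d * z 0 1 + v 0 1).
Proof.
rewrite [RHS]plane_pointE [LHS]plane_pointE !(plane_point0, plane_point1) /plane_affine !mxE.
rewrite !big_ord_recl !big_ord0 !mxE /= !addr0.
have -> : fintype.lift ord0 ord0 = 1 :> 'I_2 by apply/val_inj.
by congr plane_point; rewrite ![z _ _ * _]mulrC.
Qed.

(** Moving the rails needs both properties: sticks stay straight, and the diagram is
    unchanged up to planar isotopy. *)
Definition affine_deformation (L : P -> P) : Prop :=
  deformation L /\ exists (M : 'M[R]_2) v, L = plane_affine M v.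

Lemma affine_deformation_comp L L' :
  affine_deformation L -> affine_deformation L' -> affine_deformation (L \o L').
Proof.
move=> [dL [M [v LE]]] [dL' [M' [v' LE']]]; split; first exact: deformation_comp.
exists (M' *m M), (v' *m M + v); apply/funext => z.
by rewrite /= LE LE' /plane_affine mulmxDl mulmxA addrA.
Qed.

Lemma affine_shear_x a : affine_deformation (shear_x ( *%R a)).
Proof.
split; first by apply: deformation_shear_x; ctn.
exists (matrix2 1 a 0 1), 0; apply/funext => z; rewrite plane_affineE /shear_x !mxE.
by congr plane_point; ring.
Qed.

Lemma affine_shear_y a : affine_deformation (shear_y ( *%R a)).
Proof.
split; first by apply: deformation_shear_y; ctn.
exists (matrix2 1 0 a 1), 0; apply/funext => z; rewrite plane_affineE /shear_y !mxE.
by congr plane_point; ring.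
Qed.

Lemma affine_translation v : affine_deformation (fun z => z + v).
Proof.
have cont v' : jointly_continuous (fun t z => z + t *: v').
  apply: continuous_row => j.
  have e : (fun x : R * P => (x.2 + x.1 *: v') 0 j) = (fun x => x.2 0 j + x.1 * v' 0 j).
    by apply/funext => x; rewrite !mxE.
  by rewrite [X in continuous X]e; move: (v' 0 j) => c; ctn.
split; last by exists 1%:M, v; apply/funext => z; rewrite /plane_affine mulmx1.
exists (fun t z => z + t *: v), (fun t z => z + t *: - v); split=> // [z|z|t].
- by rewrite scale0r addr0.
- by rewrite scale1r.
- by split=> z; rewrite scalerN ?addrK ?subrK.
Qed.

(** Two shears in the right order map (1,-1) to any nonzero vector. *)
Lemma affine_deformation_pair p1 p2 : p1 != p2 -> exists L,
  [/\ affine_deformation L, L (plane_point 1 0) = p1 & L (plane_point 0 1) = p2].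
Proof.
move=> p12; pose w := p1 - p2; have wE : p1 = w + p2 by rewrite subrK.
suff [N [Nd N0 N1]] : exists N, [/\ affine_deformation N, N 0 = 0 & N (plane_point 1 (-1)) = w].
  exists ((fun z => z + p2) \o N \o (fun z => z + plane_point 0 (-1))); split.
  - apply: affine_deformation_comp; last exact: affine_translation.
    by apply: affine_deformation_comp; [exact: affine_translation|exact: Nd].
  - have e : plane_point 1 0 + plane_point 0 (-1) = plane_point 1 (-1) :> P.
      by apply/rowP => i; rewrite !mxE; case: i => [[|[|//]] i] /=; ring.
    by rewrite /= e N1.
  - have e : plane_point 0 1 + plane_point 0 (-1) = 0 :> P.
      by apply/rowP => i; rewrite !mxE; case: i => [[|[|//]] i] /=; ring.
    by rewrite /= e N0 add0r.
have zE : 0 = plane_point 0 0 :> P.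
  by apply/rowP => i; rewrite !mxE; case: i => [[|[|//]] i].
have [w1|w1] := eqVneq (w 0 1) 0.
  have w0 : w 0 0 != 0.
    apply: contra p12 => /eqP w0; rewrite -subr_eq0 -/w [w]plane_pointE w0 w1.
    by rewrite -zE.
  exists (shear_y ( *%R (w 0 0)^-1) \o shear_x ( *%R (1 - w 0 0))); split.
  - by apply: affine_deformation_comp; [exact: affine_shear_y|exact: affine_shear_x].
  - by rewrite zE /= /shear_y /shear_x !(plane_point0, plane_point1, mulr0, addr0).
  - rewrite [RHS]plane_pointE /= /shear_y /shear_x !(plane_point0, plane_point1) w1.
    have -> : 1 + (1 - w 0 0) * -1 = w 0 0 by ring.
    by rewrite mulVf // addNr.
exists (shear_x ( *%R ((w 0 0 - 1) / w 0 1)) \o shear_y ( *%R (w 0 1 + 1))); split.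
- by apply: affine_deformation_comp; [exact: affine_shear_x|exact: affine_shear_y].
- by rewrite zE /= /shear_y /shear_x !(plane_point0, plane_point1, mulr0, addr0).
- rewrite [RHS]plane_pointE /= /shear_y /shear_x !(plane_point0, plane_point1).
  have -> : -1 + (w 0 1 + 1) * 1 = w 0 1 by ring.
  by rewrite divfK //; congr plane_point; ring.
Qed.

Lemma drawable_move p1 p2 D L : affine_deformation L ->
  drawable p1 p2 D -> drawable (L p1) (L p2) D.
Proof.
move=> [dL [M [v LE]]] [r hr].
have [H [G [Hc Gc H0 H1 HG]]] := dL; have [HG1 GH1] := HG 1.
have LK : cancel L (G 1) by move=> z; rewrite -H1.
have GK : cancel (G 1) L by move=> z; rewrite -H1.
have dG := deformation_inv LK GK dL.
rewrite LE in LK *; exists (space_affine M v false @` r).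
apply: (drawing_affine (b := false) (E := id) LK _ _ _ _ hr) => // K dK.
exact: deformation_comp dK dG.
Qed.

Lemma drawable_mirror p1 p2 D : drawable p1 p2 D -> drawable p1 p2 (mirror D).
Proof.
move=> [r hr]; exists (space_affine 1%:M 0 true @` r).
have idE p : plane_affine 1%:M 0 p = p by rewrite /plane_affine mulmx1 addr0.
rewrite -[p1]idE -[p2]idE.
by apply: (drawing_affine (b := true) (E := id) (L' := id) _ _ _ _ _ hr).
Qed.

Lemma deformation_flip (K : P -> P) (b' : bool) : deformation K ->
  deformation (fun z => flip b' (K (flip b' z))).
Proof.
move=> [H [G [Hc Gc H0 H1 HG]]].
have conj_cont (H' : R -> P -> P) : jointly_continuous H' ->
    jointly_continuous (fun t z => flip b' (H' t (flip b' z))).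
  move=> Hc'; have fc : continuous (fun x : R * P => flip b' x.2).
    by rewrite /flip; apply: continuous_plane_point; ctn; apply: continuous_coord; ctn.
  have tc : continuous (fun x : R * P => x.1) by ctn.
  have := continuous_compose (continuous_pair_fun tc fc) Hc'; move=> c.
  rewrite /jointly_continuous /flip; apply: continuous_plane_point; first exact: continuous_coord.
  by apply: continuous_mul; [exact: continuous_cst_fun|exact: continuous_coord].
exists (fun t z => flip b' (H t (flip b' z))), (fun t z => flip b' (G t (flip b' z))); split.
- exact: conj_cont.
- exact: conj_cont.
- by move=> z; rewrite H0 flipK.
- by move=> z; rewrite H1.
- by move=> t; have [h1 h2] := HG t; split=> z; rewrite flipK ?h1 ?h2 flipK.
Qed.

Lemma drawable_symmetry p1 p2 D : drawable p1 p2 D ->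
  drawable (flip true p1) (flip true p2) (symmetry D).
Proof.
move=> [r hr].
have flE : flip true = plane_affine (matrix2 1 0 0 (-1)) 0.
  by apply/funext => z; rewrite plane_affineE /flip !mxE; congr plane_point; ring.
have LK : cancel (plane_affine (matrix2 1 0 0 (-1)) 0) (flip true) by rewrite -flE; exact: flipK.
rewrite flE; exists (space_affine (matrix2 1 0 0 (-1)) 0 false @` r).
apply: (drawing_affine (b := false) (E := flip true) LK _ _ _ _ hr) => //.
- exact: can_inj (flipK true).
- by move=> K; exact: deformation_flip.
- by move=> s; rewrite /= /flip expr1 mulN1r.
Qed.

Lemma PL_curve_reverse (g : R -> P3) : PL_curve g -> PL_curve (fun s => g (1 - s)).
Proof.
pose ref (y : 'rV[R]_1) : 'rV[R]_1 := const_mx 1 - y.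
have ref0 (y : 'rV[R]_1) : ref y 0 0 = 1 - y 0 0 by rewrite !mxE.
have refD (y : 'rV[R]_1) : 0 <= y 0 0 <= 1 -> 0 <= ref y 0 0 <= 1.
  by rewrite ref0 => /andP[? ?]; apply/andP; split; lra.
have refc : continuous ref.
  apply: continuous_row => j; under eq_fun do rewrite !mxE.
  by apply: continuous_add; [exact: continuous_cst_fun|apply: continuous_opp; exact: coord_continuous].
move=> h x Dx; have [k [Q [Qp cov aff]]] := h (ref x) (refD x Dx).
exists k, (fun i => ref @^-1` Q i); split.
- move=> i; have [m [A [c QE]]] := Qp i; exists m, (- A), (c - const_mx 1 *m A).
  rewrite QE; apply/seteqP; split=> y /= hy j; have := hy j;
    rewrite /ref mulmxBl mulmxN !mxE; lra.
- apply: (@filterS _ (nbhs x) (nbhs_filter x) _ _ _ (refc x _ cov)) => y hy Dy; exact: hy (refD y Dy).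
- move=> i; have [A [c E]] := aff i; exists (- A), (const_mx 1 *m A + c) => y Dy Qy.
  have /= := E (ref y) (refD y Dy) Qy; rewrite ref0 => ->.
  by rewrite /ref mulmxBl mulmxN [X in X + c]addrC -addrA.
Qed.

Lemma drawable_reversal p1 p2 D : drawable p1 p2 D -> drawable p2 p1 (reversal D).
Proof.
have r01 s : 0 <= s <= 1 -> 0 <= 1 - s <= 1 by move=> /andP[? ?]; apply/andP; split; lra.
have rI s : s \in `[0, 1] -> 1 - s \in `[0, 1] by rewrite !in_itv /=; exact: r01.
have rK s : 1 - (1 - s) = s by ring.
have rinj : injective (fun s => 1 - s) by move=> s s' e; lra.
have rev_image (g : R -> P3) : g @` `[0, 1] = (fun s => g (1 - s)) @` `[0, 1].
  apply/seteqP; split=> _ [s si <-]; last by exists (1 - s) => //; exact: rI.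
  by exists (1 - s); [exact: rI|rewrite rK].
move=> [r [[k [kPL kinj kr [k0 k1] kin]] st [g [K [[gc ginj gr [g0 g1]] Kd Kg cross]]]]].
exists r; split=> //.
  exists (fun s => k (1 - s)); split.
  - exact: PL_curve_reverse.
  - by move=> s s' i i' e; apply: rinj; apply: kinj e; exact: rI.
  - by rewrite kr rev_image.
  - by rewrite subr0 subrr.
  - move=> s /andP[s0 s1]; have [|//] := kin (1 - s); apply/andP; split; lra.
exists (fun s => g (1 - s)), K; split.
- split.
  + apply/subspace_continuousP => s /= si.
    move/subspace_continuousP: gc => /(_ (1 - s) (rI s si)) gs.
    apply: cvg_comp gs => W /=; rewrite /within /= !nbhs_simpl => nW.
    have c : continuous (fun s : R => 1 - s) by ctn.
    by apply: (@filterS _ (nbhs s) (nbhs_filter s) _ _ _ (c s _ nW)) => t ht ti; exact: ht (rI t ti).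
  + by move=> s s' i i' e; apply: rinj; apply: ginj e; exact: rI.
  + by rewrite gr rev_image.
  + by rewrite subr0 subrr.
- exact: Kd.
- by move=> s s01; exact: Kg (r01 s s01).
- move=> s s' s01 s01' ss; apply: cross; [exact: r01|exact: r01|].
  by apply: contra ss => /eqP/rinj ->.
Qed.

(** The pair of rails is quantified because reversal exchanges them and symmetry
    reflects them. *)
Lemma drawable_same_name D0 D : same_name D0 D ->
  (forall p1 p2, p1 != p2 -> drawable p1 p2 D0) -> forall p1 p2, p1 != p2 -> drawable p1 p2 D.
Proof.
move=> h h0; elim: h => [//|D' _ IH|D' _ IH|D' _ IH] p1 p2 p12.
- by apply: drawable_reversal; apply: IH; rewrite eq_sym.
- by apply: drawable_mirror; exact: IH.
- rewrite -[p1](flipK true) -[p2](flipK true); apply: drawable_symmetry; apply: IH.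
  by apply: contra p12 => /eqP/(can_inj (flipK true)) ->.
Qed.

(** For the model arc the planar isotopy is the inverse of the straightening. *)
Lemma model_drawable (e0 e6 : R) D : 2 * e0 != (20 * 100 - 2) * e6 -> e6 != 0 ->
  curve D = @curve_c R ->
  (forall s s', (s = 1 / 10 /\ s' = 9 / 10) \/ (s = 3 / 10 /\ s' = 7 / 10) ->
    (passes_over D s s' <-> lift_height e0 e6 s' < lift_height e0 e6 s) /\
    (passes_over D s' s <-> lift_height e0 e6 s < lift_height e0 e6 s')) ->
  forall p1 p2, p1 != p2 -> drawable p1 p2 D.
Proof.
move=> e06 e6n cD cross p1 p2 /affine_deformation_pair[L [dL <- <-]].
apply: drawable_move => //; exists (model_arc e0 e6); split.
- exact: model_rail_arc.
- exact: model_arc_sticks.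
have [H [G [Hc Gc H0 H1 HG]]] := deformation_straighten R; have [HG1 GH1] := HG 1.
have sK : cancel (@straighten R) (G 1) by move=> z; rewrite -H1.
have Ks : cancel (G 1) (@straighten R) by move=> z; rewrite -H1.
exists (spiral_lift e0 e6), (G 1); split.
- split.
  + by apply: continuous_subspaceT; exact: continuous_spiral_lift.
  + exact: spiral_lift_inj.
  + exact: model_arc_lift.
  + by split; [exact: spiral_lift0|exact: spiral_lift1].
- exact: (deformation_inv sK Ks (deformation_straighten R)).
- by move=> s _; rewrite proj_space_point sK cD.
- move=> s s' /andP[s0 s1] /andP[s0' s1'] ss; rewrite cD !height_space_point => e.
  case: (ltgtP s s') ss => // lt _.
    exact: (cross s s' (curve_c_double s0 lt s1' e)).1.
  exact: (cross s' s (curve_c_double s0' lt s1 (esym e))).2.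
Qed.

(** A level spiral and a last edge that goes down: the spiral is above twice. *)
Lemma drawable_2_3 p1 p2 : p1 != p2 -> drawable p1 p2 (diagram_2_3 R).
Proof.
have [h1 h9 h3 h7] := lift_height_crossings (0 : R) (-1).
move=> p12; apply: (@model_drawable 0 (-1) _ _ _ _ _ _ _ p12).
- by apply/eqP; lra.
- by apply/eqP; lra.
- by [].
- by move=> s s' [] [-> ->] /=; rewrite ?(h1, h9, h3, h7); split; split; lra.
Qed.

(** The crossing strands are at heights 4000 and 1998 over (0,2), and at
    0 and 1940 over (0,60). *)
Lemma drawable_2_6 p1 p2 : p1 != p2 -> drawable p1 p2 (diagram_2_6 R).
Proof.
have [h1 h9 h3 h7] := lift_height_crossings (20 * 100 : R) 1.
move=> p12; apply: (@model_drawable (20 * 100) 1 _ _ _ _ _ _ _ p12).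
- by apply/eqP; lra.
- by rewrite oner_neq0.
- by [].
- have n24 : plane_point (-2) 0 <> plane_point (-4) 0 :> P.
    by move=> /plane_point_inj[]; lra.
  have c3 : curve_c (3 / 10) = plane_point (-4) 0 :> P by exact: curve_c_crossing2'.
  have c1 := curve_c_crossing1' R; have c9 := curve_c_crossing1 R; have c7 := curve_c_crossing2 R.
  move=> s s' [] [-> ->] /=; rewrite ?(h1, h9, h3, h7) ?(c1, c9, c3, c7); split; split.
  + by move=> _; lra.
  + by move=> _; left; split=> //; lra.
  + by case=> -[e lt]; [lra|case: (n24 e)].
  + by lra.
  + by case=> -[e lt]; [case: (n24 (esym e))|lra].
  + by lra.
  + by move=> _; lra.
  + by move=> _; right; split=> //; lra.
Qed.
End Transport.

(** * Stick number six *)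

(** Reversal changes only the parametrisation, symmetry reflects the curve, and
    mirror reflection keeps it. *)
Lemma same_name_curve (R : realType) (D0 D : diagram R) : same_name D0 D ->
  exists b1 b2, forall s : R, 0 <= s <= 1 -> flip b1 (curve D (rev b2 s)) = curve D0 s.
Proof.
have r01 (s : R) : 0 <= s <= 1 -> 0 <= 1 - s <= 1 by move=> /andP[? ?]; apply/andP; split; lra.
elim=> [|D' _ [b1 [b2 h]]|D' _ [b1 [b2 h]]|D' _ [b1 [b2 h]]].
- exists false, false => s _; by rewrite /flip mul1r -plane_pointE.
- exists b1, (~~ b2) => s s01; rewrite -h //= /rev; case: (b2) => //=.
  by congr (flip _ (curve _ _)); ring.
- by exists b1, b2.
- exists (~~ b1), b2 => s s01; rewrite -h //= /flip plane_point0 plane_point1.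
  by congr plane_point; case: (b1); rewrite /= ?expr0 ?expr1; ring.
Qed.

Lemma stick_number6 (R : realType) (D0 D : diagram R) (p1 p2 : 'rV[R]_2) :
  curve D0 = @curve_c R -> (forall p1 p2, p1 != p2 -> drawable p1 p2 D0) ->
  p1 != p2 -> same_name D0 D -> stick_number (rail_arc_class p1 p2 D) 6.
Proof.
move=> cD0 dD0 p12 nD; split.
  have [r hr] := drawable_same_name nD dD0 p12.
  by exists r; [exact: drawing_class|case: hr].
move=> r m Dr st; have [b1 [b2 h]] := same_name_curve nD.
by apply: (class_sticks_ge6 p12 _ Dr st (b1 := b1) (b2 := b2)) => s s01; rewrite h ?cD0.
Qed.

Theorem corollary3p11 (R : realType) (p1 p2 : 'rV[R]_2) (hp : p1 != p2) :
  (forall D : diagram R, same_name (diagram_2_3 R) D ->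
     stick_number (rail_arc_class p1 p2 D) 6) /\
  (forall D : diagram R, same_name (diagram_2_6 R) D ->
     stick_number (rail_arc_class p1 p2 D) 6).
Proof.
split=> D; apply: stick_number6 => // q1 q2; [exact: drawable_2_3|exact: drawable_2_6].
Qed.
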